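(* Let $n\ge 3$ and let $\Omega\subset\mathbb{R}^n$ be a smooth bounded radial domain of radius $R$ (the ball of radius $R$ centered at $0$). Let $V$ be a radial function on $\Omega$ with $V(x)=v(|x|)$ for some non-negative function $v$ on $(0,R)$. Then the following two properties are equivalent: 1. The ordinary differential equation $y''(r)+\frac{y'(r)}{r}+v(r)y(r)=0$ has a positive solution on the interval $(0,R)$. 2. The following improved Hardy inequality holds: $$\int_{\Omega}|\nabla u|^{2}\,dx-\Big(\frac{n-2}{2}\Big)^{2}\int_{\Omega}\frac{|u|^{2}}{|x|^{2}}\,dx\ \ge\ \int_{\Omega}V(|x|)|u|^{2}\,dx\qquad\text{for all } u\in H^1_0(\Omega).$$ Moreover, the best constant $$c(V):=\sup\Big\{c:\ \int_{\Omega}|\nabla u|^{2}dx-\Big(\frac{n-2}{2}\Big)^{2}\int_{\Omega}\frac{|u|^{2}}{|x|^{2}}dx\ge c\int_{\Omega}V(|x|)|u|^{2}dx\ \text{ for all } u\in H^1_0(\Omega)\Big\}$$ is given by $$c(V)=\sup\Big\{c:\ y''(r)+\frac{y'(r)}{r}+c\,v(r)y(r)=0\ \text{ has a positive solution on the interval } (0,R)\Big\}.$$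
   Context: For a radial function $V$ we write $V(|x|)$ for $V(x)$, so $V(|x|)=v(|x|)$. ''Positive solution'' means a solution that is strictly positive on the whole interval. *)

(* Defs.v *)
From HB Require Import structures.
From mathcomp Require Import all_boot all_order all_algebra.
From mathcomp Require Import all_classical all_reals all_analysis.
From mathcomp Require Import measurable_realfun.

Set Implicit Arguments.
Unset Strict Implicit.
Unset Printing Implicit Defensive.

Import Order.TTheory GRing.Theory Num.Theory.
Import numFieldNormedType.Exports.

Local Open Scope classical_set_scope.
Local Open Scope ring_scope.

(* 'rV[R]_n carries the sigma-algebra generated by the coordinates, that is,
   the Borel sigma-algebra of R^n. *)
Section measurable_rV.
Context {R : realType} {n : nat}.

Let coords (i : 'I_n) (x : 'rV[R]_n) : measurableTypeR R := x ord0 i.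

Let rV_set0 : g_sigma_preimage coords set0.
Proof. exact: sigma_algebra0. Qed.

Let rV_setC A : g_sigma_preimage coords A -> g_sigma_preimage coords (~` A).
Proof. exact: sigma_algebraC. Qed.

Let rV_bigcup (F : _^nat) : (forall i, g_sigma_preimage coords (F i)) ->
  g_sigma_preimage coords (\bigcup_i F i).
Proof. exact: sigma_algebra_bigcup. Qed.

HB.instance Definition _ := @isMeasurable.Build
  (measure_tuple_display (R.-ocitv.-measurable).-sigma) 'rV[R]_n
  (g_sigma_preimage coords) rV_set0 rV_setC rV_bigcup.

Lemma measurable_coord (i : 'I_n) :
  measurable_fun [set: 'rV[R]_n] (fun x => x ord0 i : measurableTypeR R).
Proof.
move=> _ Y mY; rewrite setTI; apply: sub_sigma_algebra => /=.
rewrite -bigcup_seq/=; exists i => /=; first by rewrite mem_index_enum.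
by exists Y => //; rewrite setTI.
Qed.

End measurable_rV.

Lemma measurable_fun_rVP (R : realType) n d (T : measurableType d)
    (f : T -> 'rV[R]_n) :
  (forall i, measurable_fun [set: T]
     (fun t => f t ord0 i : measurableTypeR R)) ->
  measurable_fun [set: T] f.
Proof.
move=> mf.
pose coords (i : 'I_n) (x : 'rV[R]_n) : measurableTypeR R := x ord0 i.
suff H : g_sigma_preimage (fun i => coords i \o f) `<=` measurable.
  move: H; rewrite g_sigma_preimage_comp => H _ A mA.
  by apply: H; exists A.
apply: smallest_sub; first exact: sigma_algebra_measurable.
move: @coords; case: n f mf => [|k] f mf coords; first by rewrite big_ord0.
rewrite -bigcup_mkord_ord; apply: bigcup_sub => i Ii.
by move=> A [B mB <-]; exact: mf.
Qed.

Section lebesgue_rV_step.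
Context {R : realType} {n : nat}.

Definition consrV (p : measurableTypeR R * 'rV[R]_n) : 'rV[R]_n.+1 :=
  row_mx (const_mx p.1 : 'rV[R]_1) p.2.

Definition splitrV (x : 'rV[R]_n.+1) : measurableTypeR R * 'rV[R]_n :=
  (x ord0 ord0, @rsubmx R 1 1 n x).

Lemma measurable_consrV : measurable_fun setT consrV.
Proof.
apply: measurable_fun_rVP => i.
have -> : (fun t => consrV t ord0 i) = (fun t =>
    match @fintype.split 1 n i with inl _ => t.1 | inr j => t.2 ord0 j end).
  by apply/funext => t; rewrite mxE; case: (fintype.split _) => j; rewrite ?mxE.
case: (fintype.split _) => j; first exact: measurable_fst.
by apply: (measurableT_comp (measurable_coord j)); exact: measurable_snd.
Qed.

Lemma measurable_splitrV : measurable_fun setT splitrV.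
Proof.
apply: measurable_fun_pair; first exact: measurable_coord.
apply: measurable_fun_rVP => i.
rewrite (_ : (fun _ => _) = (fun x : 'rV[R]_n.+1 => x ord0 (@rshift 1 n i))).
  exact: measurable_coord.
by apply/funext => x; rewrite mxE.
Qed.

Lemma consrVK : cancel consrV splitrV.
Proof.
move=> [a x]; rewrite /splitrV /consrV row_mxKr; congr pair.
have -> : ord0 = @lshift 1 n ord0 by exact/val_inj.
by rewrite [LHS](row_mxEl (const_mx a) x) mxE.
Qed.

Variable mu : {sigma_finite_measure set 'rV[R]_n -> \bar R}.

Definition lebesgue_rV_succ : set 'rV[R]_n.+1 -> \bar R :=
  pushforward (@lebesgue_measure R \x mu)%E consrV.

Let succ0 : lebesgue_rV_succ set0 = 0%E.
Proof. by rewrite /lebesgue_rV_succ /pushforward preimage_set0 measure0. Qed.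

Let succ_ge0 A : (0 <= lebesgue_rV_succ A)%E.
Proof. by rewrite /lebesgue_rV_succ /pushforward; exact: measure_ge0. Qed.

Let succ_sigma_additive : semi_sigma_additive lebesgue_rV_succ.
Proof.
apply: (@measure_semi_sigma_additive _ _ _ (pushforward _ _)).
exact: measurable_consrV.
Qed.

HB.instance Definition _ := isMeasure.Build _ _ _ lebesgue_rV_succ
  succ0 succ_ge0 succ_sigma_additive.

Let sigma_finite_succ : sigma_finite setT lebesgue_rV_succ.
Proof.
have /sigma_finiteP[F [TF ndF Foo]] := sigma_finiteT (@lebesgue_measure R).
have /sigma_finiteP[G [TG ndG Goo]] := sigma_finiteT mu.
exists (fun k => splitrV @^-1` (F k `*` G k)).
  apply/esym; rewrite -subTset => x _.
  have [i _ Fi] : (\bigcup_k F k) (splitrV x).1 by rewrite -TF.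
  have [j _ Gj] : (\bigcup_k G k) (splitrV x).2 by rewrite -TG.
  exists (maxn i j) => //; split.
  - by move: Fi; exact/subsetPset/ndF/leq_maxl.
  - by move: Gj; exact/subsetPset/ndG/leq_maxr.
move=> k; have [mF Fk] := Foo k; have [mG Gk] := Goo k; split.
  rewrite -[X in measurable X]setTI; apply: measurable_splitrV => //.
  exact: measurableX.
rewrite /lebesgue_rV_succ /pushforward (_ : _ @^-1` _ = F k `*` G k).
  by rewrite product_measure1E// lte_mul_pinfty// ge0_fin_numE.
by rewrite -comp_preimage (_ : splitrV \o consrV = id)//; exact/funext/consrVK.
Qed.

HB.instance Definition _ :=
  Measure_isSigmaFinite.Build _ _ _ lebesgue_rV_succ sigma_finite_succ.

End lebesgue_rV_step.

Fixpoint lebesgue_rV (R : realType) (n : nat) :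
    {sigma_finite_measure set 'rV[R]_n -> \bar R} :=
  match n with
  | 0 => \d_(0 : 'rV[R]_0)
  | m.+1 => lebesgue_rV_succ (lebesgue_rV R m)
  end.

Section sobolev.
Context {R : realType} {n : nat}.
Implicit Types (Omega : set 'rV[R]_n) (f u : 'rV[R]_n -> R)
  (g : 'I_n -> 'rV[R]_n -> R).

(* The norm that the library puts on 'rV[R]_n is the sup norm. *)
Definition enorm (x : 'rV[R]_n) : R := Num.sqrt (\sum_i x ord0 i ^+ 2).

Definition eball (rho : R) : set 'rV[R]_n := [set x | enorm x < rho].

Definition partial (i : 'I_n) f : 'rV[R]_n -> R :=
  fun x => 'D_(delta_mx ord0 i) f x.

Definition smooth f : Prop := forall s : seq 'I_n,
  continuous (foldr partial f s) /\
  forall i x, derivable (foldr partial f s) x (delta_mx ord0 i).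

Definition test_function Omega f : Prop :=
  [/\ smooth f, compact (closure [set x | f x != 0]) &
      closure [set x | f x != 0] `<=` Omega].

Definition L2 Omega f : Prop := measurable_fun Omega f /\
  (\int[lebesgue_rV R n]_(x in Omega) (f x ^+ 2)%:E < +oo)%E.

Definition weak_gradient Omega u g : Prop :=
  forall phi, test_function Omega phi -> forall i,
    \int[lebesgue_rV R n]_(x in Omega) (u x * partial i phi x) =
    - \int[lebesgue_rV R n]_(x in Omega) (g i x * phi x).

Definition H1 Omega u g : Prop :=
  [/\ L2 Omega u, forall i, L2 Omega (g i) & weak_gradient Omega u g].

(* [H10 Omega u g] : u belongs to H^1_0(Omega), the closure of
   C_c^oo(Omega) in H^1(Omega), and g is its weak gradient (which is unique
   almost everywhere). *)
Definition H10 Omega u g : Prop :=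
  H1 Omega u g /\
  exists phi : nat -> 'rV[R]_n -> R,
    [/\ forall k, test_function Omega (phi k),
        (\int[lebesgue_rV R n]_(x in Omega) ((phi k x - u x) ^+ 2)%:E)%E
          @[k --> \oo] --> 0%E &
        forall i,
        (\int[lebesgue_rV R n]_(x in Omega)
           ((partial i (phi k) x - g i x) ^+ 2)%:E)%E
          @[k --> \oo] --> 0%E].

(* On H^1_0 of a bounded domain both integrals are finite for n >= 3. The
   integrand u^2 / |x|^2 takes the value 0 at the origin, a null set. *)
Definition hardy_deficit Omega u g : \bar R :=
  (\int[lebesgue_rV R n]_(x in Omega) (\sum_i g i x ^+ 2)%:E -
   (((n%:R - 2) / 2) ^+ 2)%:E *
   \int[lebesgue_rV R n]_(x in Omega) (u x ^+ 2 / enorm x ^+ 2)%:E)%E.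

End sobolev.

(* As v need not be continuous, a solution of y'' + y'/r + v y = 0 on (0, rho)
   is a strong one: y is differentiable, y' is locally absolutely continuous
   (it is an indefinite integral of a locally integrable y''), and the equation
   holds almost everywhere. For continuous v these are the classical C^2
   solutions: see [ode_solution_classical]. *)
Definition ode_solution (R : realType) (rho : R) (v y : R -> R) : Prop :=
  (forall r, r \in `]0, rho[ -> derivable y r 1) /\
  exists y2 : R -> R,
    [/\ locally_integrable `]0, rho[ y2,
        forall a b, 0 < a -> a < b -> b < rho ->
          derive1 y b - derive1 y a =
          \int[lebesgue_measure]_(r in `[a, b]) y2 r &
        {ae lebesgue_measure, forall r, r \in `]0, rho[ ->
          y2 r + derive1 y r / r + v r * y r = 0}].

Definition has_positive_solution (R : realType) (rho : R) (v : R -> R) : Prop :=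
  exists2 y, ode_solution rho v y & forall r, r \in `]0, rho[ -> 0 < y r.

Lemma ode_solution_classical (R : realType) (rho : R) (v y : R -> R) :
  {in `]0, rho[, continuous v} ->
  ode_solution rho v y <->
  forall r, r \in `]0, rho[ ->
    [/\ derivable y r 1, derivable (derive1 y) r 1 &
        derive1 (derive1 y) r + derive1 y r / r + v r * y r = 0].
Proof.
move=> cv; pose mu := @lebesgue_measure R.
pose h r := - (derive1 y r / r + v r * y r).
have ch : (forall r, r \in `]0, rho[ -> derivable y r 1) ->
    {in `]0, rho[, continuous (derive1 y)} -> {in `]0, rho[, continuous h}.
  move=> dy cy r rI; have r0 : r != 0.
    by move: rI; rewrite in_itv/= => /andP[/gt_eqF ->].
  apply: cvgN; apply: cvgD; apply: cvgM.
  - exact: cy.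
  - exact: cvgV.
  - exact: cv.
  - by apply/differentiable_continuous; rewrite -derivable1_diffP; exact: dy.
have subI (a b : R) : 0 < a -> b < rho -> `[a, b] `<=` `]0, rho[.
  move=> a0 b1 x /=; rewrite !in_itv/= => /andP[ax xb].
  by rewrite (lt_le_trans a0 ax) (le_lt_trans xb b1).
have cK K : {in `]0, rho[, continuous h} -> K `<=` `]0, rho[ ->
    {within K, continuous h}.
  move=> hc KI; apply: continuous_in_subspaceT => x /set_mem /KI; exact: hc.
have intK K : {in `]0, rho[, continuous h} -> K `<=` `]0, rho[ -> compact K ->
    mu.-integrable K (EFin \o h).
  by move=> hc KI cptK; apply: continuous_compact_integrable => //; exact: cK.
split=> [[dy [y2 [[my2 _ iy2] y1E y2E]]]|H].
- have iab a b : 0 < a -> b < rho -> mu.-integrable `[a, b] (EFin \o y2).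
    move=> a0 b1; apply/integrableP; split.
      by apply/measurable_EFinP; apply: measurable_funS my2 => //; exact: subI.
    by apply: iy2; [exact: subI|exact: segment_compact].
  have cy1 : {in `]0, rho[, continuous (derive1 y)}.
    move=> r; rewrite in_itv/= => /andP[r0 r1].
    have [a0 ar] : 0 < r / 2 /\ r / 2 < r.
      by rewrite divr_gt0// gtr_pMr// invf_lt1// ltr1n.
    have [ru u1] := midf_lt r1.
    set a := r / 2 in a0 ar; set u := _ / 2 in ru u1.
    have := parameterized_integral_continuous (ltW (lt_trans ar ru))
      (iab a u a0 u1).
    move=> /(continuous_within_itvP _ (lt_trans ar ru))[+ _ _] => /(_ r).
    rewrite in_itv/= ar ru => /(_ isT) cF.
    have e1 : {near r, (fun x => derive1 y a + parameterized_integral mu a x y2)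
                       =1 derive1 y}.
      near=> x; have [ax xu] : a < x /\ x < u.
        by split; near: x; [exact: lt_nbhsr|exact: lt_nbhsl].
      by rewrite /parameterized_integral -y1E ?subrKC// (lt_trans xu u1).
    rewrite /continuous_at -(nbhs_singleton e1).
    apply: cvg_trans; first exact: (near_eq_cvg e1).
    by apply: cvgD => //; exact: cvg_cst.
  have hc := ch dy cy1.
  move=> r rI; have := rI; rewrite in_itv/= => /andP[r0 r1].
  have [a0 ar] : 0 < r / 2 /\ r / 2 < r.
    by rewrite divr_gt0// gtr_pMr// invf_lt1// ltr1n.
  have [ru u1] := midf_lt r1; set a := r / 2 in a0 ar; set u := _ / 2 in ru u1.
  pose F x := (\int[mu]_(t in `[a, x]) h t)%R.
  have [||dF F'] := @continuous_FTC1_closed _ h a r u ru _ ar.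
  - by apply: intK => //; [exact: subI|exact: segment_compact].
  - exact: hc.
  have e1 : {near r, (fun x => F x + derive1 y a) =1 derive1 y}.
    near=> x; have [ax xu] : a < x /\ x < u.
      by split; near: x; [exact: lt_nbhsr|exact: lt_nbhsl].
    have xr : x < rho by exact: lt_trans u1.
    suff -> : F x = derive1 y x - derive1 y a by rewrite subrK.
    rewrite y1E// /F /Rintegral; congr fine; apply: ae_eq_integral => //.
    - by have /measurable_int :=
        intK _ hc (subI _ _ a0 xr) (@segment_compact _ _ _).
    - by have /measurable_int := iab _ _ a0 xr.
    - case: y2E => N [mN N0 sN]; exists N; split => //.
      move=> t /= tP; apply: sN => /= tQ; apply: tP => tax.
      have := tQ (subI _ _ a0 xr _ tax) => /eqP.
      by rewrite -addrA addr_eq0 => /eqP ->.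
  have dF1 : is_derive r 1 (fun x => F x + derive1 y a) (h r).
    have dFr : is_derive r 1 F (h r) by split => //; rewrite -derive1E.
    have := is_deriveD dFr (is_derive_cst (derive1 y a) r 1); rewrite addr0.
    exact.
  have [d1 d1E] := near_eq_is_derive e1 dF1.
  by split => //; [exact: dy|rewrite derive1E d1E /h -addrA addNr].
- have dy r : r \in `]0, rho[ -> derivable y r 1 by move=> /H[].
  have dy1 r : r \in `]0, rho[ -> derivable (derive1 y) r 1 by move=> /H[].
  have cy1 : {in `]0, rho[, continuous (derive1 y)}.
    move=> r rI; apply/differentiable_continuous; rewrite -derivable1_diffP.
    exact: dy1.
  have hc := ch dy cy1.
  split=> //; exists h; split.
  - split.
    + apply: open_continuous_measurable_fun; first exact: interval_open.
      by move=> x /set_mem; exact: hc.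
    + exact: interval_open.
    + move=> K KI cptK; have /integrableP[_] := intK _ hc KI cptK.
      by [].
  - move=> a b a0 ab b1; have sab := subI _ _ a0 b1.
    have cin (c : R) : c \in `[a, b] -> {for c, continuous (derive1 y)}.
      by move=> /sab; exact: cy1.
    rewrite /Rintegral (@continuous_FTC2 _ h (derive1 y))//.
    + exact: cK.
    + split.
      * by move=> x xab; apply: dy1; apply: sab; exact: subset_itv_oo_cc xab.
      * by apply: cvg_at_right_filter; apply: cin; rewrite /= in_itv/= lexx ltW.
      * by apply: cvg_at_left_filter; apply: cin; rewrite /= in_itv/= lexx ltW.
    + move=> x xab; have /H[_ _ E] : x \in `]0, rho[.
        by apply: sab; exact: subset_itv_oo_cc xab.
      by apply/eqP; rewrite /h -addr_eq0 addrA; apply/eqP.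
  - by apply: aeW => r _; rewrite /h -addrA addNr.
Unshelve. all: by end_near. Qed.

(* Main.v *)
(* In the variable t = ln r the equation y'' + y'/r + v y = 0 becomes
   Y'' + q Y = 0 on (-oo, ln rho), with q(t) = e^(2t) v(e^t), and after the
   substitution u = |x|^(-m) k(ln |x|), m = (n - 2)/2, the improved Hardy
   inequality for radial u becomes the line inequality
   \int q k^2 <= \int k'^2 for k supported in (-oo, ln rho).

   If Y > 0 is a solution then p = Y' is nonincreasing, hence nonpositive, and
   integrating (p k^2 / Y)' <= k'^2 - q k^2 gives the line inequality with the
   Hardy weight m^2, on every ray of a test function; polar coordinates and the
   density of the test functions give the inequality on H^1_0.

   Conversely, radial test functions yield the line inequality, first for
   smooth k, then by mollification for every k with a bounded derivative and
   compact support. It bounds the Picard iterates of the Riccati equation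
   P' = P^2 + q with P(-oo) = 0: these increase, and testing with
   k(t) = exp(\int_t^b P) bounds their values at b. Their limit P gives the
   positive solution Y = exp(- \int P).

   The formula for the best constant follows by applying the equivalence to
   c v for c >= 0. *)

Require Import Defs.
From mathcomp Require Import all_boot all_order all_algebra.
From mathcomp Require Import all_classical all_reals all_analysis.
From mathcomp Require Import measurable_realfun.
From mathcomp Require Import ring lra.

Set Implicit Arguments.
Unset Strict Implicit.
Unset Printing Implicit Defensive.

Import Order.TTheory GRing.Theory Num.Theory.
Import numFieldNormedType.Exports.

Local Open Scope classical_set_scope.
Local Open Scope ring_scope.

(** * Lebesgue measure on row vectors *)

(** The substitution is exact because [2 m + 2 = n]: the polar density [e^(nt)] splits into
    [e^(2mt)], absorbed by [k], and [e^(2t)], which turns [1/|x|^2] into [1] and the potential into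
    [q]. The square [(k' - m k)^2] differs from [k'^2 + m^2 k^2] by the derivative of [- m k^2], so
    the Hardy constant cancels without loss; this is why both directions meet in the same line
    inequality. The potential is only measurable and nonnegative. Integrability of [q] is not given:
    in one direction it is inherited from the strong solution, in the other it is extracted from the
    inequality itself. Hence the calculus of absolutely continuous functions, the substitution
    [r = e^t] for nonnegative measurable functions, and Riccati iterates with values in the extended
    reals. The sign of [q] makes these iterates monotone, so that only an upper bound has to be
    found. Each iterate is bounded by testing with the exponential built from its predecessor: the
    square of the predecessor then appears on both sides and cancels. *)

Section lebesgue_affine.
Context {R : realType}.
Local Notation mu := (@lebesgue_measure R).

Variables (c : R) (l : {posnum R}).
Let aff (x : measurableTypeR R) : measurableTypeR R := c + l%:num * x.

Let measurable_aff : measurable_fun setT aff.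
Proof. by apply: measurable_funD => //; exact: measurable_funM. Qed.

Lemma affine_preimage_itvoc (a b : R) :
  aff @^-1` `]a, b] = `](a - c) / l%:num, (b - c) / l%:num]%classic.
Proof.
apply/seteqP; split => x /=; rewrite !in_itv/= /aff ltr_pdivrMr// ler_pdivlMr//;
 rewrite ltrBlDl lerBrDl mulrC//.
Qed.

Let mu' : {measure set (measurableTypeR R) -> \bar R} :=
  mscale (l%:num%:nng)
    (measure_function_pushforward__canonical__measure_function_Measure mu measurable_aff).

(** By uniqueness of Lebesgue measure it is enough to compare on half-open intervals, where the
    preimage under [aff] divides the length by [l] and the scaling restores it. *)
Lemma lebesgue_measure_affine (A : set R) : measurable A -> mu A = mu' A.
Proof.
apply: (@lebesgue_measure_unique R mu') => //.
move=> _ [[x y]] _ <-.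
rewrite /mu' /= /mscale /= /pushforward /= affine_preimage_itvoc !lebesgue_measure_itv/= !lte_fin ltr_pM2r// ltrD2r.
case: ifPn => _; last by rewrite mule0.
by rewrite -!EFinD -EFinM; congr EFin; field.
Qed.

Lemma ge0_integral_affine (f : R -> \bar R) :
  measurable_fun setT f -> (forall x, 0 <= f x)%E ->
  (\int[mu]_x f x = l%:num%:E * \int[mu]_x f (c + l%:num * x)%R)%E.
Proof.
move=> mf f0.
rewrite (@eq_measure_integral _ _ _ _ mu' mu)//; last first.
  by move=> A mA _; apply: lebesgue_measure_affine.
rewrite ge0_integral_mscale//=; congr (_ * _)%E.
by rewrite ge0_integral_pushforward//.
Qed.

End lebesgue_affine.

Section rV_measure.
Context {R : realType}.

(** Tonelli for the product behind [lebesgue_rV_succ]; it opens the way to inductions on the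
    dimension. *)
Lemma ge0_integral_consrV n (f : 'rV[R]_n.+1 -> \bar R) :
  measurable_fun setT f -> (forall x, 0 <= f x)%E ->
  (\int[lebesgue_rV R n.+1]_x f x =
   \int[lebesgue_measure]_a \int[lebesgue_rV R n]_x f (consrV (a, x)))%E.
Proof.
move=> mf f0.
rewrite [LHS](@ge0_integral_pushforward _ _ _ _ _ _ (@measurable_consrV R n))//.
rewrite preimage_setT (fubini_tonelli1 (f \o consrV))//.
  by apply: measurableT_comp => //; exact: measurable_consrV.
by move=> x; exact: f0.
Qed.

Lemma consrV_affine n (c x : R) (l : R) (d y : 'rV[R]_n) :
  consrV (c, d) + l *: consrV (x, y) = consrV (c + l * x, d + l *: y).
Proof.
rewrite /consrV /=; apply/rowP => i.
rewrite !mxE; by case: (fintype.split _) => j /=; rewrite ?mxE.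
Qed.

Lemma consrV_surj n (x : 'rV[R]_n.+1) : exists c d, x = @consrV R n (c, d).
Proof.
exists (x ord0 ord0), (@rsubmx R 1 1 n x); rewrite /consrV/=.
have -> : const_mx (x ord0 ord0) = @lsubmx R 1 1 n x.
  apply/rowP => i; rewrite !mxE; congr (x _ _); apply/val_inj => /=.
  by rewrite ord1.
by rewrite hsubmxK.
Qed.

Lemma measurable_affine_rV n (c : 'rV[R]_n) (l : R) :
  measurable_fun setT (fun x : 'rV[R]_n => c + l *: x).
Proof.
apply: measurable_fun_rVP => i.
under eq_fun do rewrite !mxE.
apply: measurable_funD => //; apply: measurable_funM => //.
exact: measurable_coord.
Qed.

(** Induction on the dimension: each coordinate contributes one factor [l] through the affine change
    of variable on the line. *)
Lemma ge0_integral_rV_affine n (c : 'rV[R]_n) (l : R) (f : 'rV[R]_n -> \bar R) :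
  0 < l -> measurable_fun setT f -> (forall x, 0 <= f x)%E ->
  (\int[lebesgue_rV R n]_x f x =
   (l ^+ n)%:E * \int[lebesgue_rV R n]_x f (c + l *: x)%R)%E.
Proof.
move=> l0; elim: n c f => [|n IH] c f mf f0.
  rewrite expr0 mul1e; apply: eq_integral => x _; congr f.
  by apply/rowP; case.
have [c1 [d ->]] := consrV_surj c.
rewrite ge0_integral_consrV// ge0_integral_consrV//; last first.
  by apply: (measurableT_comp mf); exact: measurable_affine_rV.
have mf2 a : measurable_fun setT (fun x => f (consrV (a, x))).
  apply: (measurableT_comp mf); apply: (measurableT_comp (@measurable_consrV R n)).
  exact: measurable_fun_pair.
under eq_integral => a _.
  rewrite (IH d (fun x => f (consrV (a, x))))//; over.
have mF : measurable_fun setT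
   (fun a => \int[lebesgue_rV R n]_x f (consrV (a, (d + l *: x)%R)))%E.
  apply: (@measurable_fun_fubini_tonelli_F _ _ _ _ _ (lebesgue_rV R n)
   (fun p => f (consrV (p.1, (d + l *: p.2)%R)))) => //.
  apply: (measurableT_comp mf); apply: (measurableT_comp (@measurable_consrV R n)).
  apply: measurable_fun_pair; first exact: measurable_fst.
  apply: (measurableT_comp (measurable_affine_rV d l)); exact: measurable_snd.
transitivity ((l ^+ n)%:E * \int[lebesgue_measure]_a
    \int[lebesgue_rV R n]_x f (consrV (a, (d + l *: x)%R)))%E.
  apply: ge0_integralZl => //; first by move=> a _; exact: integral_ge0.
  by rewrite lee_fin exprn_ge0// ltW.
rewrite exprSr EFinM -muleA; congr (_ * _)%E.
rewrite (ge0_integral_affine c1 (PosNum l0) mF)/=; last first.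
  by move=> x; exact: integral_ge0.
congr (_ * _)%E; apply: eq_integral => a _; apply: eq_integral => x _.
by rewrite consrV_affine.
Qed.

End rV_measure.

Section rV_borel.
Context {R : realType} {n : nat}.

Let box (p : 'rV[rat]_n * nat) : set 'rV[R]_n :=
  [set x | forall i, `|ratr (p.1 ord0 i) - x ord0 i| < p.2.+1%:R^-1].

Let measurable_box p : measurable (box p).
Proof.
have -> : box p = \bigcap_(i in [set: 'I_n])
   [set x | `|ratr (p.1 ord0 i) - x ord0 i| < p.2.+1%:R^-1].
  by apply/seteqP; split => x /= Hx i; [move=> _; exact: Hx|exact: (Hx i)].
apply: fin_bigcap_measurable => // i _.
rewrite -[X in measurable X]setTI.
apply: (@measurable_fun_ltr _ _ _ _ (fun x : 'rV[R]_n => `|ratr (p.1 ord0 i) - x ord0 i|) (cst (p.2.+1%:R^-1))) => //.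
apply: measurableT_comp => //; apply: measurable_funB => //.
exact: measurable_coord.
Qed.

(** The measurable sets are generated by the coordinates, the topology by the sup norm. They are
    reconciled by second countability: an open set is the union of the rational boxes that it
    contains. *)
Lemma open_measurable_rV (U : set 'rV[R]_n) : open U -> measurable U.
Proof.
move=> oU.
have -> : U = \bigcup_p (if `[< box p `<=` U >] then box p else set0).
  apply/seteqP; split=> [x Ux|x [p _]]; last by case: asboolP => // + bx; exact.
  have /nbhs_ballP[e /= e0 xeU] : nbhs x U by exact: open_nbhs_nbhs.
  (* The box radius is below [e / 2]: one half for the distance from [x] to the rational centre, one
     half for the box itself. *)
  pose k := Num.truncn (2 / e).
  have k0 : 0 < k.+1%:R^-1 :> R by [].
  have ke : k.+1%:R^-1 < e / 2.
    by rewrite -[ltRHS]invrK ltf_pV2 ?posrE ?invr_gt0 ?divr_gt0// invf_div truncnS_gt.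
  have [c Hc] : exists c : 'rV[rat]_n, forall i, `|ratr (c ord0 i) - x ord0 i| < k.+1%:R^-1.
    have : forall i, exists q : rat, `|ratr q - x ord0 i| < k.+1%:R^-1.
      move=> i; have xk : x ord0 i - k.+1%:R^-1 < x ord0 i + k.+1%:R^-1.
        by rewrite ltrBlDr -addrA ltrDl addr_gt0.
      have [q] := rat_in_itvoo xk.
      by rewrite in_itv/= => qi; exists q; rewrite distrC ltr_distlC.
    move=> /choice[f Hf]; exists (\row_i f i) => i; rewrite mxE; exact: Hf.
  exists (c, k) => //=; case: asboolP; first by move=> _ i; exact: Hc.
  case=> y by_; apply: xeU; split => // i j; rewrite ord1 /ball/=.
  rewrite [e]splitr -(subrKA (ratr (c ord0 j))).
  apply: le_lt_trans (ler_normD _ _) _; apply: ltrD; last exact: lt_trans (by_ j) ke.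
  by rewrite distrC; exact: lt_trans (Hc j) ke.
apply: countable_bigcupT_measurable; first exact: countableP.
move=> p.
by case: ifP => // _; exact: measurable0.
Qed.

Lemma continuous_measurable_rV (f : 'rV[R]_n -> R) :
  continuous f -> measurable_fun setT f.
Proof.
move=> /continuousP cf.
apply: (measurability _ (RGenOpens.measurableE R)) => _ [_ [a [b ->]] <-].
rewrite setTI; apply: open_measurable_rV; apply: cf; exact: interval_open.
Qed.

End rV_borel.

(** * The Euclidean norm and its topology *)

Section enorm_theory.
Context {R : realType} {n : nat}.
Implicit Types x : 'rV[R]_n.

Lemma enorm_ge0 x : 0 <= enorm x.
Proof. exact: sqrtr_ge0. Qed.

Lemma sqr_enorm x : enorm x ^+ 2 = \sum_i x ord0 i ^+ 2.
Proof. by rewrite sqr_sqrtr// sumr_ge0// => i _; exact: sqr_ge0. Qed.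

Lemma enormZ l x : enorm (l *: x) = `|l| * enorm x.
Proof.
rewrite /enorm -sqrtr_sqr -sqrtrM ?sqr_ge0// mulr_sumr; congr Num.sqrt.
by apply: eq_bigr => i _; rewrite mxE exprMn.
Qed.

Lemma coord_le_enorm x i : `|x ord0 i| <= enorm x.
Proof.
rewrite -sqrtr_sqr ler_wsqrtr// (bigD1 i)//= lerDl.
by apply: sumr_ge0 => j _; exact: sqr_ge0.
Qed.

Lemma enorm_eq0 x : (enorm x == 0) = (x == 0).
Proof.
apply/eqP/eqP => [x0|->]; last first.
  by rewrite -(scale0r 0) enormZ normr0 mul0r.
apply/rowP => i; rewrite mxE; apply/eqP; rewrite -normr_le0 -x0.
exact: coord_le_enorm.
Qed.

Lemma enorm_gt0 x : (0 < enorm x) = (x != 0).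
Proof. by rewrite lt_def enorm_ge0 andbT enorm_eq0. Qed.

Lemma continuous_coord (i : 'I_n) : continuous (fun x : 'rV[R]_n => x ord0 i).
Proof. exact: coord_continuous. Qed.

Lemma continuous_sumr (I : Type) (r : seq I) (T : topologicalType) (f : I -> T -> R) :
  (forall i, continuous (f i)) -> continuous (fun x : T => \sum_(i <- r) f i x).
Proof.
move=> cf x; elim: r => [|i r IH].
  by under eq_fun do rewrite big_nil; exact: cvg_cst.
under eq_fun do rewrite big_cons.
by apply: cvgD => //; exact: cf.
Qed.

Lemma continuous_sqr_coord (i : 'I_n) :
  continuous (fun x : 'rV[R]_n => x ord0 i ^+ 2).
Proof.
move=> x; apply: (@continuous_comp _ _ _ (fun x : 'rV[R]_n => x ord0 i) (fun r : R => r ^+ 2)).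
  exact: continuous_coord.
exact: exprn_continuous.
Qed.

Lemma continuous_sqr_enorm : continuous (fun x : 'rV[R]_n => enorm x ^+ 2).
Proof.
under eq_fun do rewrite sqr_enorm.
apply: continuous_sumr => i; exact: continuous_sqr_coord.
Qed.

Lemma continuous_enorm : continuous (@enorm R n).
Proof.
move=> x; apply: continuous_comp; last exact: sqrt_continuous.
by apply: continuous_sumr => i; exact: continuous_sqr_coord.
Qed.

Lemma measurable_enorm : measurable_fun setT (@enorm R n).
Proof. apply: continuous_measurable_rV; exact: continuous_enorm. Qed.

Lemma open_eball (rho : R) : open (@eball R n rho).
Proof.
apply: (@open_comp _ _ (@enorm R n) [set r | r < rho]); last exact: open_lt.
by move=> x _; exact: continuous_enorm.
Qed.

Lemma measurable_eball (rho : R) : measurable (@eball R n rho).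
Proof. by apply: open_measurable_rV; exact: open_eball. Qed.

Lemma mx_norm_le_enorm x : `|x| <= enorm x.
Proof.
rewrite /Num.Def.normr/= mx_normrE; apply/bigmax_leP; split; first exact: enorm_ge0.
by move=> [i j] _ /=; rewrite (ord1 i); exact: coord_le_enorm.
Qed.

End enorm_theory.

Section lebesgue_rV_theory.
Context {R : realType}.

Lemma measurable_cube n (M : R) :
  measurable [set x : 'rV[R]_n | forall i, `|x ord0 i| <= M].
Proof.
have -> : [set x : 'rV[R]_n | forall i, `|x ord0 i| <= M] =
    \bigcap_(i in [set: 'I_n]) [set x : 'rV[R]_n | `|x ord0 i| <= M].
  by apply/seteqP; split => x /= Hx i; [move=> _; exact: Hx|exact: (Hx i)].
apply: fin_bigcap_measurable => // i _; rewrite -[X in measurable X]setTI.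
apply: (@measurable_fun_ler _ _ _ _ (fun x : 'rV[R]_n => `|x ord0 i|) (cst M)) => //.
by apply: measurableT_comp => //; exact: measurable_coord.
Qed.

Lemma lebesgue_rV_cube_lty n (M : R) :
  (lebesgue_rV R n [set x : 'rV[R]_n | forall i, (`|x ord0 i| <= M)%R] < +oo)%E.
Proof.
elim: n => [|n IH] /=.
  by rewrite (le_lt_trans (_ : _ <= 1)%E) ?ltry// diracE lee_fin; case: (_ \in _).
rewrite /lebesgue_rV_succ /pushforward.
set C := (X in lebesgue_rV R n X) in IH *.
have mC : measurable C.
  exact: measurable_cube.
rewrite (_ : consrV @^-1` _ = `[- M, M] `*` C); last first.
  apply/seteqP; split => [[a x] /= H|[a x] /= [aM xC] i].
    split; first by have := H ord0; rewrite in_itv/= /consrV mxE; case: fintype.splitP => // j _; rewrite mxE /= ler_norml.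
    move=> i; have := H (@rshift 1 n i); by rewrite /consrV [X in `|X|](@row_mxEr _ _ 1 n).
  rewrite /consrV mxE; case: (fintype.split _) => j; last exact: xC.
  by rewrite mxE/= ler_norml; rewrite in_itv/= in aM.
rewrite product_measure1E//=; apply: lte_mul_pinfty => //.
by rewrite lebesgue_measure_itv/=; case: ifP => // _; rewrite -EFinB.
Qed.

Lemma lebesgue_rV_eball_lty n (rho : R) : (lebesgue_rV R n (eball rho) < +oo)%E.
Proof.
apply: le_lt_trans (lebesgue_rV_cube_lty n rho).
apply: le_measure; rewrite ?inE; first exact: measurable_eball.
  exact: measurable_cube.
move=> x /= xr i; apply: le_trans (coord_le_enorm _ _) _; exact: ltW.
Qed.

Lemma measurable_set0_rV n : measurable [set (0 : 'rV[R]_n)].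
Proof.
have -> : [set (0 : 'rV[R]_n)] = (@enorm R n) @^-1` [set 0].
  by apply/seteqP; split => x /=; [move=> ->; apply/eqP; rewrite enorm_eq0|move/eqP; rewrite enorm_eq0 => /eqP].
by rewrite -[X in measurable X]setTI; apply: measurable_enorm.
Qed.

(** The origin lies in the hyperplane where the first coordinate vanishes, which is null. The
    dimension has to be positive: [lebesgue_rV R 0] is a Dirac mass. *)
Lemma lebesgue_rV_set0 n : lebesgue_rV R n.+1 [set 0] = 0%E.
Proof.
have mB : measurable [set x : 'rV[R]_n.+1 | x ord0 ord0 = 0].
  rewrite -[X in measurable X]setTI.
  exact: (measurable_coord ord0 measurableT (measurable_set1 0)).
apply/eqP; rewrite eq_le measure_ge0 andbT.
have : (lebesgue_rV R n.+1 [set 0%R] <= lebesgue_rV R n.+1 [set x : 'rV[R]_n.+1 | x ord0 ord0 = 0%R])%E.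
  apply: le_measure; rewrite ?inE//; first exact: measurable_set0_rV.
  by move=> x /= ->; rewrite mxE.
move=> /le_trans; apply; rewrite /= /lebesgue_rV_succ /pushforward.
rewrite (_ : consrV @^-1` _ = [set 0] `*` setT); last first.
  by apply/seteqP; split => -[a x] /=; rewrite /consrV mxE; case: fintype.splitP => // j _; rewrite mxE/= => // -[].
by rewrite product_measure1E//= lebesgue_measure_set1 mul0e.
Qed.

End lebesgue_rV_theory.

(** * Polar coordinates *)

Lemma measurable_invr (R : realType) : measurable_fun setT (fun r : R => r^-1).
Proof.
rewrite -(setUv [set (0 : R)]); apply/measurable_funU => //.
  exact: measurableC.
split; first exact: measurable_fun_set1.
apply: open_continuous_measurable_fun.
  exact/closed_openC/closed_eq.
by move=> x /set_mem /= /eqP x0; exact: inv_continuous.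
Qed.

Section polar.
Context {R : realType} {n : nat}.
Implicit Types (x z : 'rV[R]_n) (A : 'rV[R]_n -> R).

(* Integrating [1 = \int_R in_shell (e^(-t) x) dt] against [A x dx] and
   rescaling gives polar coordinates without a surface measure: the shell with
   weight [|z|^-n] stands for the unit sphere. *)
Definition in_shell z : bool := (1 <= enorm z) && (enorm z < expR 1).

Definition shell_weight z : R := if in_shell z then enorm z ^- n else 0.

Lemma measurable_in_shell : measurable_fun setT in_shell.
Proof.
apply: measurable_and.
  by apply: (@measurable_fun_ler _ _ _ _ (cst 1) (@enorm R n)) => //; exact: measurable_enorm.
by apply: (@measurable_fun_ltr _ _ _ _ (@enorm R n) (cst (expR 1))) => //; exact: measurable_enorm.
Qed.

Lemma measurable_shell_weight : measurable_fun setT shell_weight.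
Proof.
apply: measurable_fun_ifT => //; first exact: measurable_in_shell.
apply: (@measurableT_comp _ _ _ _ _ _ (fun r : R => r ^- n)); last exact: measurable_enorm.
apply: (@measurableT_comp _ _ _ _ _ _ (fun r : R => r^-1)) => //; exact: measurable_invr.
Qed.

Lemma shell_weight_ge0 z : 0 <= shell_weight z.
Proof.
by rewrite /shell_weight; case: ifP => // _; rewrite invr_ge0 exprn_ge0// enorm_ge0.
Qed.

(** The admissible [t] fill the interval from [ln (enorm x) - 1] to [ln (enorm x)]; the radii [1]
    and [expR 1] of the shell are chosen to make its length one. *)
Lemma integral_in_shell x : x != 0 ->
  (\int[lebesgue_measure]_t ((in_shell (expR (- t) *: x))%:R%:E : \bar R) = 1)%E.
Proof.
rewrite -enorm_gt0 => x0.
transitivity (\int[lebesgue_measure]_t (\1_(`](ln (enorm x) - 1), ln (enorm x)]%classic : set R) t)%:E)%E.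
  apply: eq_integral => t _; congr EFin; rewrite indicE mem_setE in_itv/=.
  rewrite /in_shell enormZ gtr0_norm ?expR_gt0// -[in LHS](lnK (x := enorm x)) ?posrE//.
  rewrite -expRD ltr_expR -[in X in (X <= _)]expR0 ler_expR addrC subr_ge0 andbC.
  by rewrite ltrBlDr addrC -ltrBlDr.
rewrite integral_indic//= setIT lebesgue_measure_itv/= lte_fin gtrBl ltr01.
by rewrite -EFinB opprB addrC subrK.
Qed.

End polar.

Section polar_coordinates.
Context {R : realType} {n : nat}.
Local Notation mu := (@lebesgue_measure R).
Local Notation leb := (lebesgue_rV R n.+1).

Lemma measurable_scale_rV m d (T : measurableType d) (f : T -> R) (g : T -> 'rV[R]_m) :
  measurable_fun setT f -> measurable_fun setT g ->
  measurable_fun setT (fun t => f t *: g t).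
Proof.
move=> mf mg; apply: measurable_fun_rVP => i.
under eq_fun do rewrite mxE.
apply: measurable_funM => //.
by apply: (measurableT_comp (measurable_coord i)).
Qed.

Lemma ge0_integral_translate (c : R) (f : R -> \bar R) :
  measurable_fun setT f -> (forall x, 0 <= f x)%E ->
  (\int[mu]_x f (c + x)%R = \int[mu]_x f x)%E.
Proof.
move=> mf f0; rewrite [RHS](ge0_integral_affine c 1%:pos)//= mul1e.
by apply: eq_integral => x _; rewrite mul1r.
Qed.

Lemma ge0_integral_polar (A : 'rV[R]_n.+1 -> R) :
  measurable_fun setT A -> (forall x, 0 <= A x) ->
  (\int[leb]_x (A x)%:E =
   \int[leb]_z ((shell_weight z)%:E *
     \int[mu]_t (A (expR t *: ((enorm z)^-1 *: z)) * expR (n.+1%:R * t))%:E))%E.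
Proof.
move=> mA A0.
pose F (p : R * 'rV[R]_n.+1) : \bar R :=
  (A p.2 * (in_shell (expR (- p.1) *: p.2))%:R)%:E.
have mshell d (T : measurableType d) (f : T -> 'rV[R]_n.+1) :
    measurable_fun setT f -> measurable_fun setT (fun t => (in_shell (f t))%:R : R).
  move=> mf.
  apply: (@measurableT_comp _ _ _ _ _ _ (fun b : bool => b%:R : R)) => //.
  by apply: (measurableT_comp measurable_in_shell).
have mF : measurable_fun setT F.
  apply/measurable_EFinP/measurable_funM.
    by apply: (measurableT_comp mA); exact: measurable_snd.
  apply: mshell; apply: measurable_scale_rV; last exact: measurable_snd.
  apply: measurableT_comp => //; apply: measurableT_comp => //; exact: measurable_fst.
have F0 p : (0 <= F p)%E by rewrite lee_fin mulr_ge0.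
transitivity (\int[leb]_x \int[mu]_t F (t, x))%E.
  apply: ge0_ae_eq_integral => //.
  - exact/measurable_EFinP.
  - exact: (@measurable_fun_fubini_tonelli_G _ _ _ _ _ mu F).
  - by move=> x _; rewrite lee_fin.
  - by move=> x _; exact: integral_ge0.
  (* At the origin no dilation enters the shell and the inner integral vanishes, so the two
     integrands agree only almost everywhere. *)
  - exists [set 0]; split; [exact: measurable_set0_rV|exact: lebesgue_rV_set0|].
    move=> x /= /not_implyP[_] H; apply: contrapT => /eqP x0; apply: H.
    rewrite /F /=; under eq_integral do rewrite EFinM.
    rewrite ge0_integralZl//.
    + by rewrite integral_in_shell// mule1.
    + apply/measurable_EFinP; apply: mshell; apply: measurable_scale_rV => //.
      by apply: measurableT_comp => //; exact: measurableT_comp.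
    + by rewrite lee_fin.
transitivity (\int[mu]_t \int[leb]_x F (t, x))%E.
  exact/esym/(@fubini_tonelli _ _ _ _ _ mu leb F).
(* The integrand after the substitution [x = expR t *: z], together with its Jacobian. *)
pose H (p : R * 'rV[R]_n.+1) : \bar R :=
  (A (expR p.1 *: p.2) * expR (n.+1%:R * p.1) * (in_shell p.2)%:R)%:E.
have mexp d (T : measurableType d) (f : T -> R) :
    measurable_fun setT f -> measurable_fun setT (fun t => expR (f t)).
  by move=> mf; apply: measurableT_comp.
have mH : measurable_fun setT H.
  apply/measurable_EFinP/measurable_funM; last by apply: mshell; exact: measurable_snd.
  apply: measurable_funM.
    apply: (measurableT_comp mA); apply: measurable_scale_rV; last exact: measurable_snd.
    apply: mexp; exact: measurable_fst.
  apply: mexp; apply: measurable_funM => //; exact: measurable_fst.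
have H0 p : (0 <= H p)%E by rewrite lee_fin !mulr_ge0// expR_ge0.
transitivity (\int[mu]_t \int[leb]_z H (t, z))%E.
  apply: eq_integral => t _.
  rewrite (@ge0_integral_rV_affine _ _ 0 (expR t))//; first last.
  - exact: (measurableT_comp mF (measurable_pair1 t)).
  - exact: expR_gt0.
  rewrite -ge0_integralZl//.
  - apply: eq_integral => z _; rewrite /F /H /= add0r scalerA -expRD addNr expR0 scale1r.
    by rewrite -EFinM mulrA expRM_natl [_ ^+ _ * _]mulrC.
  - apply: (measurableT_comp mF); apply: measurable_fun_pair => //.
    exact: measurable_affine_rV.
transitivity (\int[leb]_z \int[mu]_t H (t, z))%E.
  exact: (@fubini_tonelli _ _ _ _ _ mu leb H).
apply: eq_integral => z _; rewrite /H /shell_weight /=.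
case: ifPn => [zs|_]; last first.
  by rewrite mul0e; under eq_integral do rewrite mulr0; rewrite integral0.
have z0 : 0 < enorm z by case/andP: zs => + _; exact: lt_le_trans.
under eq_integral do rewrite mulr1.
pose G t := (A (expR t *: z) * expR (n.+1%:R * t))%:E.
have mG : measurable_fun setT G.
  apply/measurable_EFinP/measurable_funM.
    apply: (measurableT_comp mA); apply: measurable_scale_rV => //.
  by apply: mexp; apply: measurable_funM.
(* Shifting [t] by [ln (enorm z)] normalizes [z]; the Jacobian then releases the factor
   [enorm z ^- n.+1], which is the shell weight. *)
rewrite -(@ge0_integral_translate (- ln (enorm z)) G)//; last first.
  by move=> t; rewrite lee_fin mulr_ge0// expR_ge0.
rewrite -ge0_integralZl//.
- apply: eq_integral => t _; rewrite /G expRD expRN lnK ?posrE// scalerA -EFinM; congr EFin.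
  rewrite [_^-1 * expR t]mulrC mulrDr expRD mulrCA; congr (_ * _).
  by rewrite mulrN expRN expRM_natl lnK// posrE.
- apply/measurable_EFinP/measurable_funM.
    apply: (measurableT_comp mA); apply: measurable_scale_rV => //.
  by apply: mexp; apply: measurable_funM.
- by move=> t _; rewrite lee_fin mulr_ge0// expR_ge0.
- by rewrite lee_fin invr_ge0 exprn_ge0// ltW.
Qed.

Lemma lebesgue_rV_setT_gt0 m : (0 < lebesgue_rV R m setT)%E.
Proof.
elim: m => [|m IH]; first by rewrite /= diracT lte01.
rewrite /= /lebesgue_rV_succ /pushforward preimage_setT -setXTT.
rewrite product_measure1E// mule_gt0//.
have E : mu setT = +oo%E by rewrite -set_itvNyy lebesgue_measure_itv.
by apply: (eq_ind_r (fun z : \bar R => (0 < z)%E) _ E); rewrite ltry.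
Qed.

(** The surface area of the unit sphere: integrating [|z|^-(n+1)] over the shell multiplies that
    area by the integral of [1/r] from [1] to [expR 1], which is one. *)
Definition sphere_area : \bar R := \int[leb]_z (shell_weight z)%:E.

Lemma ge0_integral_radial (B : R -> R) :
  measurable_fun setT B -> (forall x, 0 <= B x) ->
  (\int[leb]_x (B (enorm x))%:E =
   sphere_area * \int[mu]_t (B (expR t) * expR (n.+1%:R * t))%:E)%E.
Proof.
move=> mB B0; rewrite (@ge0_integral_polar (fun x => B (enorm x)))//; last first.
  by apply: (measurableT_comp mB); exact: measurable_enorm.
rewrite /sphere_area -ge0_integralZr//.
- apply: eq_integral => z _; rewrite /shell_weight; case: ifPn => [zs|]; last by rewrite !mul0e.
  have z0 : 0 < enorm z by case/andP: zs => + _; exact: lt_le_trans.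
  congr (_ * _)%E; apply: eq_integral => t _; rewrite !enormZ.
  by rewrite !gtr0_norm ?expR_gt0 ?invr_gt0// mulVf ?mulr1 ?gt_eqF.
- by apply/measurable_EFinP; exact: measurable_shell_weight.
- by move=> z _; rewrite lee_fin shell_weight_ge0.
- by apply: integral_ge0 => t _; rewrite lee_fin mulr_ge0// expR_ge0.
Qed.

Lemma sphere_area_lty : (sphere_area < +oo)%E.
Proof.
rewrite /sphere_area.
apply: (@le_lt_trans _ _ (\int[leb]_z (\1_(eball (expR 1)) z)%:E)%E).
  apply: ge0_le_integral => //.
  - by move=> z _; rewrite lee_fin shell_weight_ge0.
  - by apply/measurable_EFinP; exact: measurable_shell_weight.
  - by apply/measurable_EFinP; apply: measurable_indic; exact: measurable_eball.
  - move=> z _; rewrite lee_fin /shell_weight /in_shell indicE.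
    case: ifPn => // /andP[z1 ze]; rewrite mem_set//= invf_le1 ?exprn_ege1//.
    by rewrite exprn_gt0// (lt_le_trans ltr01).
rewrite integral_indic//; last exact: measurable_eball.
by rewrite setIT; exact: lebesgue_rV_eball_lty.
Qed.

(** If the area vanished, the radial formula for the constant one would make the whole space
    null. *)
Lemma sphere_area_gt0 : (0 < sphere_area)%E.
Proof.
rewrite lt0e; apply/andP; split; last first.
  by apply: integral_ge0 => z _; rewrite lee_fin shell_weight_ge0.
apply/eqP => w0.
have := @ge0_integral_radial (cst 1) (measurable_cst _) (fun _ => ler01).
rewrite w0 mul0e => H; have := lebesgue_rV_setT_gt0 n.+1.
by rewrite -[X in (_ < X)%E]mul1e -integral_cst// H ltxx.
Qed.

End polar_coordinates.

(** * Absolutely continuous functions *)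

Section integrable_EFin.
Context d (T : measurableType d) {R : realType} (m : {measure set T -> \bar R}).
Variables (D : set T) (mD : measurable D).
Implicit Types f g : T -> R.

Lemma integrableZ_EFin (r : R) f : m.-integrable D (EFin \o f) ->
  m.-integrable D (EFin \o (fun x => r * f x)).
Proof. by move=> fi; exact: (integrableZl mD r fi). Qed.

Lemma integrableD_EFin f g : m.-integrable D (EFin \o f) ->
  m.-integrable D (EFin \o g) -> m.-integrable D (EFin \o (fun x => f x + g x)).
Proof. by move=> fi gi; exact: (integrableD mD fi gi). Qed.

Lemma integrableB_EFin f g : m.-integrable D (EFin \o f) ->
  m.-integrable D (EFin \o g) -> m.-integrable D (EFin \o (fun x => f x - g x)).
Proof. by move=> fi gi; exact: (integrableB mD fi gi). Qed.

End integrable_EFin.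

Section absolutely_continuous.
Context {R : realType}.
Local Notation mu := (@lebesgue_measure R).
Implicit Types (a b : R) (P p G g : R -> R).

(** Absolute continuity on a segment, with [p] a chosen density of the derivative. The integral form
    is stable under products and under changes of the density on null sets, and this is how
    equations that hold almost everywhere are handled. *)
Definition antiderivative_on a b P p : Prop :=
  mu.-integrable `[a, b] (EFin \o p) /\
  forall s, s \in `[a, b] -> P s - P a = \int[mu]_(x in `[a, s]) p x.

Lemma antiderivative_onB a b P p s t : antiderivative_on a b P p ->
  a <= s -> s <= t -> t <= b ->
  P t - P s = \int[mu]_(x in `[s, t]) p x.
Proof.
move=> [ip Pp] as_ st tb.
have iat : mu.-integrable `[a, t] (EFin \o p).
  by apply: integrableS ip => //; apply: subset_itvl; rewrite bnd_simp.
rewrite -Rintegral_itv_obnd_cbnd; last first.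
  by apply: integrableS iat => //; apply: subset_itvr; rewrite bnd_simp.
rewrite -(Rintegral_itvB iat) ?bnd_simp//.
rewrite -!Pp ?in_itv/= ?as_ ?(le_trans st) ?(le_trans as_)//.
by rewrite opprB addrA subrK.
Qed.

Lemma antiderivative_onS a b P p s t : antiderivative_on a b P p ->
  a <= s -> t <= b -> antiderivative_on s t P p.
Proof.
move=> H as_ tb; split.
  by case: H => ip _; apply: integrableS ip => // x /=; rewrite !in_itv/= => /andP[sx xt]; rewrite (le_trans as_ sx) (le_trans xt tb).
move=> x; rewrite in_itv/= => /andP[sx xt].
by apply: antiderivative_onB H _ _ _ => //; exact: le_trans tb.
Qed.

Lemma antiderivative_continuous a b P p : a <= b -> antiderivative_on a b P p ->
  {within `[a, b], continuous P}.
Proof.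
move=> ab [ip Pp].
have c0 := parameterized_integral_continuous ab ip.
have H : {within `[a, b], continuous (fun x => P a + parameterized_integral mu a x p)}.
  by move=> x; apply: cvgD; [exact: cvg_cst|exact: c0].
apply: subspace_eq_continuous H => x; rewrite inE/= => xab.
by rewrite /from_subspace /parameterized_integral -Pp// subrKC.
Qed.

Lemma antiderivative_integrableM a b P p g : a <= b -> antiderivative_on a b P p ->
  mu.-integrable `[a, b] (EFin \o g) ->
  mu.-integrable `[a, b] (EFin \o (fun x => P x * g x)).
Proof.
move=> ab Pp ig.
have cP := antiderivative_continuous ab Pp.
apply: (@integrableMr _ _ _ mu `[a, b] _ P (EFin \o g)) => //.
  exact: subspace_continuous_measurable_fun.
have /compact_bounded[M [Mr HM]] := continuous_compact cP (@segment_compact _ a b).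
exists M; split => // x Mx y yab; exact: HM.
Qed.

(** Integration by parts by Fubini: the function [p(x) g(y)] is integrated over the triangle
    [x <= y] in both orders. One order gives the integral of [p (G b - G)], the other that of
    [g (P - P a)]. *)
Lemma antiderivativeM a b P p G g : a <= b ->
  antiderivative_on a b P p -> antiderivative_on a b G g ->
  P b * G b - P a * G a = \int[mu]_(x in `[a, b]) (p x * G x + P x * g x).
Proof.
move=> ab Pp Gg; have [ip _] := Pp; have [ig _] := Gg.
pose p' : R -> R := p \_ `[a, b]; pose g' : R -> R := g \_ `[a, b].
have ip' : mu.-integrable setT (EFin \o p').
  by rewrite /p' -restrict_EFin; apply/(integrable_mkcond _ _).1.
have ig' : mu.-integrable setT (EFin \o g').
  by rewrite /g' -restrict_EFin; apply/(integrable_mkcond _ _).1.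
have mp' : measurable_fun setT p' by case/integrableP: ip' => /measurable_EFinP.
have mg' : measurable_fun setT g' by case/integrableP: ig' => /measurable_EFinP.
pose F (z : R * R) : \bar R := (p' z.1 * (g' z.2 * (z.1 <= z.2)%R%:R))%:E.
have mF : measurable_fun setT F.
  apply/measurable_EFinP; apply: measurable_funM.
    by apply: (measurableT_comp mp'); exact: measurable_fst.
  apply: measurable_funM.
    by apply: (measurableT_comp mg'); exact: measurable_snd.
  apply: (@measurableT_comp _ _ _ _ _ _ (fun b : bool => b%:R : R)) => //.
  by apply: measurable_fun_ler; [exact: measurable_fst|exact: measurable_snd].
have iF : (mu \x mu)%E.-integrable setT F.
  apply/integrable12ltyP => //.
  apply: (@le_lt_trans _ _ (\int[mu]_x (`|p' x|%:E * \int[mu]_y `|g' y|%:E))%E).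
    apply: ge0_le_integral => //.
    - by move=> x _; exact: integral_ge0.
    - have mAF : measurable_fun setT (abse \o F) by apply: measurableT_comp => //; exact: mF.
      apply: (@measurable_fun_fubini_tonelli_F _ _ _ _ _ mu (abse \o F)).
        exact: mAF.
      by move=> ?; exact: abse_ge0.
    - apply: emeasurable_funM => //; apply/measurable_EFinP; exact: measurableT_comp.
    - move=> x _; rewrite -ge0_integralZl//.
      + apply: ge0_le_integral => //.
        * apply/measurable_EFinP; apply: measurableT_comp => //.
          apply/measurable_EFinP; exact: (measurableT_comp mF (measurable_pair1 x)).
        * apply: measurable_funeM; apply/measurable_EFinP; exact: measurableT_comp.
        * move=> y _; rewrite /F /= -EFinM lee_fin !normrM ler_wpM2l// ler_piMr//.
          by case: (x <= y)%R; rewrite ?normr1 ?normr0.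
      + apply/measurable_EFinP; exact: measurableT_comp.
  rewrite ge0_integralZr//.
  - apply: lte_mul_pinfty.
    + exact: integral_ge0.
    + by case/integrableP: ip' => _ h; rewrite ge0_fin_numE//; exact: integral_ge0.
    + by case/integrableP: ig'.
  - apply/measurable_EFinP; exact: measurableT_comp.
  - exact: integral_ge0.
have FF := Fubini iF.
have E1 : (\int[mu]_x \int[mu]_y F (x, y) =
           \int[mu]_(x in `[a, b]) (p x * (G b - G x))%:E)%E.
  rewrite [RHS]integral_mkcond; apply: eq_integral => x _.
  rewrite /F /= patchE /p' patchE mem_setE; case: ifPn => [|_]; last first.
    by under eq_integral do rewrite mul0r; rewrite integral0.
  rewrite in_itv/= => /andP[ax xb].
  under eq_integral do rewrite EFinM.
  have E : (fun y => (g' y * (x <= y)%R%:R)%:E) = (EFin \o g) \_ `[x, b].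
    apply/funext => y; rewrite /g' !patchE !mem_setE !in_itv/=.
    case: (leP x y) => xy /=; last by rewrite mulr0.
    by rewrite (le_trans ax xy) mulr1/=; case: ifP.
  rewrite integralZl//; last first.
    rewrite E; apply/(integrable_mkcond _ _).1 => //.
    by apply: integrableS ig => //; apply: subset_itvr; rewrite bnd_simp.
  rewrite E -integral_mkcond EFinM (antiderivative_onB Gg ax xb (lexx _)).
  rewrite fineK//; apply: integrable_fin_num => //.
  by apply: integrableS ig => //; apply: subset_itvr; rewrite bnd_simp.
have E2 : (\int[mu]_y \int[mu]_x F (x, y) =
           \int[mu]_(y in `[a, b]) (g y * (P y - P a))%:E)%E.
  rewrite [RHS]integral_mkcond; apply: eq_integral => y _.
  rewrite /F /= patchE /g' patchE mem_setE; case: ifPn => [|_]; last first.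
    by under eq_integral do rewrite mul0r mulr0; rewrite integral0.
  rewrite in_itv/= => /andP[ay yb].
  have E : (fun x => (p' x * (g y * (x <= y)%R%:R))%:E) =
      fun x => ((g y)%:E * ((EFin \o p) \_ `[a, y]) x)%E.
    apply/funext => x; rewrite /p' !patchE !mem_setE !in_itv/=.
    case: (leP x y) => xy /=; last by rewrite !mulr0 andbF mule0.
    rewrite (le_trans xy yb) andbT mulr1; case: ifP => _; last by rewrite mul0r mule0.
    by rewrite -EFinM mulrC.
  under eq_integral do rewrite (congr1 (fun f => f _) E).
  rewrite integralZl//; last first.
    apply/(integrable_mkcond _ _).1 => //.
    by apply: integrableS ip => //; apply: subset_itvl; rewrite bnd_simp.
  rewrite -integral_mkcond EFinM (antiderivative_onB Pp (lexx _) ay yb).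
  rewrite fineK//; apply: integrable_fin_num => //.
  by apply: integrableS ip => //; apply: subset_itvl; rewrite bnd_simp.
have ipG : mu.-integrable `[a, b] (EFin \o (fun x => p x * G x)).
  rewrite (_ : _ \o _ = EFin \o (fun x => G x * p x)); last by apply/funext => x/=; rewrite mulrC.
  exact: antiderivative_integrableM Gg ip.
have iPg := antiderivative_integrableM ab Pp ig.
(* Equality of the two iterated integrals after the constants [G b] and [P a] have been taken out;
   the formula follows by rearrangement. *)
have H : G b * (P b - P a) - \int[mu]_(x in `[a, b]) (p x * G x) =
    \int[mu]_(x in `[a, b]) (P x * g x) - P a * (G b - G a).
  rewrite (antiderivative_onB Pp (lexx _) ab (lexx _)) (antiderivative_onB Gg (lexx _) ab (lexx _)).
  rewrite -!RintegralZl// -!RintegralB//; last 2 first.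
    exact: integrableZ_EFin.
    exact: integrableZ_EFin.
  transitivity (fine (\int[mu]_x \int[mu]_y F (x, y))).
    rewrite E1; congr fine; apply: eq_integral => x _; congr EFin; ring.
  rewrite FF E2; congr fine; apply: eq_integral => x _; congr EFin; ring.
rewrite RintegralD//.
move: H; set I1 := (\int[mu]_(x in _) (p x * _)); set I2 := (\int[mu]_(x in _) _) => H.
have -> : I1 + I2 = G b * (P b - P a) + P a * (G b - G a) by rewrite -[G b * _](subrK I1) H; ring.
ring.
Qed.

End absolutely_continuous.

Section antiderivative_theory.
Context {R : realType}.
Local Notation mu := (@lebesgue_measure R).
Implicit Types (a b : R) (P p G g : R -> R).

Lemma is_derive_continuous (f : R -> R) (x df : R) : is_derive x 1 f df -> {for x, continuous f}.
Proof.
by move=> [fx _]; apply/differentiable_continuous; rewrite -derivable1_diffP.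
Qed.

Lemma antiderivative_onC1 a b G g : a <= b ->
  (forall x, x \in `[a, b] -> is_derive x 1 G (g x)) ->
  {within `[a, b], continuous g} -> antiderivative_on a b G g.
Proof.
move=> ab dG cg; split.
  by apply: continuous_compact_integrable => //; exact: segment_compact.
move=> s; rewrite in_itv/= => /andP[]; rewrite le_eqVlt => /predU1P[<- _|as_ sb].
  by rewrite subrr set_itv1 Rintegral_set1.
have ss : `[a, s] `<=` `[a, b] by apply: subset_itvl; rewrite bnd_simp.
rewrite /Rintegral (@continuous_FTC2 _ g G)//.
- exact: continuous_subspaceW cg.
- split.
  + by move=> x /subset_itv_oo_cc /ss /dG [].
  + by apply: cvg_at_right_filter; apply: is_derive_continuous (dG _ _); rewrite in_itv/= lexx.
  + by apply: cvg_at_left_filter; apply: is_derive_continuous (dG _ _); rewrite in_itv/= ltW.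
- by move=> x /subset_itv_oo_cc /ss /dG [_]; rewrite derive1E.
Qed.

Lemma antiderivative_onM a b P p G g : a <= b ->
  antiderivative_on a b P p -> antiderivative_on a b G g ->
  antiderivative_on a b (fun x => P x * G x) (fun x => p x * G x + P x * g x).
Proof.
move=> ab Pp Gg; split.
  apply: integrableD_EFin => //.
    rewrite (_ : EFin \o _ = EFin \o (fun x => G x * p x)); last by apply/funext => x/=; rewrite mulrC.
    by apply: antiderivative_integrableM Gg _ => //; case: Pp.
  by apply: antiderivative_integrableM Pp _ => //; case: Gg.
move=> s /andP[]; rewrite !bnd_simp => as_ sb.
by apply: antiderivativeM => //; apply: antiderivative_onS; eauto.
Qed.

Lemma ae_imply (P Q : R -> Prop) : {ae mu, forall x, P x} ->
  (forall x, P x -> Q x) -> {ae mu, forall x, Q x}.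
Proof.
move=> [N [mN N0 sN]] PQ; exists N; split => // x /= nQ; apply: sN => /= Px.
by apply: nQ; exact: PQ.
Qed.

(** This is the entry point of the differential equation, which determines the density of the
    derivative only up to a null set. *)
Lemma antiderivative_on_ae a b P p (Q q : R -> R) :
  antiderivative_on a b P p -> measurable_fun `[a, b] q ->
  (forall x, x \in `[a, b] -> P x = Q x) ->
  {ae mu, forall x, x \in `[a, b] -> p x = q x} ->
  antiderivative_on a b Q q.
Proof.
move=> [ip Pp] mq PQ pq.
have mp : measurable_fun `[a, b] p by case/integrableP: ip => /measurable_EFinP.
have aepq s : s <= b -> ae_eq mu `[a, s]%classic (EFin \o p) (EFin \o q).
  move=> sb; apply: (ae_imply pq) => x /= H /andP[ax xs]; congr EFin; apply: H.
  by apply/andP; split => //; exact: le_trans xs _.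
split.
  apply/integrableP; split; first exact/measurable_EFinP.
  case/integrableP: ip => _; apply: le_lt_trans; rewrite le_eqVlt; apply/orP; left; apply/eqP.
  apply: ge0_ae_eq_integral => //.
  - by apply: measurableT_comp => //; exact/measurable_EFinP.
  - by apply: measurableT_comp => //; exact/measurable_EFinP.
  - by apply: (ae_imply (aepq b (lexx _))) => x /= H /H [->].
move=> s sab; have [as_ sb] := andP sab; rewrite !bnd_simp in as_ sb.
rewrite -!PQ// ?Pp//; last by rewrite in_itv/= lexx (le_trans as_).
have ss : `[a, s] `<=` `[a, b] by apply: subset_itvl; rewrite bnd_simp.
rewrite /Rintegral; congr fine; apply: ae_eq_integral => //.
- by apply/measurable_EFinP; exact: measurable_funS mp.
- by apply/measurable_EFinP; exact: measurable_funS mq.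
- exact: aepq.
Qed.

End antiderivative_theory.

(** * The substitution [r = expR t] for nonnegative measurable functions *)

Section exp_substitution.
Context {R : realType}.
Local Notation mu := (@lebesgue_measure R).

Let positive_shell : \bar R :=
  \int[lebesgue_rV R 1]_z (shell_weight z * (0 < z ord0 ord0)%R%:R)%:E.

Let measurable_gt0 d (T : measurableType d) (f : T -> R) :
  measurable_fun setT f -> measurable_fun setT (fun x => (0 < f x)%R%:R : R).
Proof.
move=> mf; apply: (@measurableT_comp _ _ _ _ _ _ (fun b : bool => b%:R : R)) => //.
exact: measurable_fun_ltr.
Qed.

(** Polar coordinates in dimension one, for a function living on the positive half line: the shell
    points with positive coordinate all have direction [1], so the inner integral comes out as a
    common factor. *)
Let polar1 (f : R -> R) : measurable_fun setT f -> (forall x, 0 <= f x) ->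
  (\int[mu]_(r in `]0%R, +oo[) (f r)%:E =
   positive_shell * \int[mu]_t (f (expR t) * expR t)%:E)%E.
Proof.
move=> mf f0.
pose A (x : 'rV[R]_1) := f (x ord0 ord0) * (0 < x ord0 ord0)%R%:R.
have mA : measurable_fun setT A.
  apply: measurable_funM; last by apply: measurable_gt0; exact: measurable_coord.
  by apply: (measurableT_comp mf); exact: measurable_coord.
have A0 x : 0 <= A x by rewrite mulr_ge0.
transitivity (\int[lebesgue_rV R 1]_x (A x)%:E)%E.
  rewrite ge0_integral_consrV//; last by apply/measurable_EFinP.
  rewrite integral_mkcond; apply: eq_integral => a _.
  have -> : (\int[lebesgue_rV R 0]_x (A (consrV (a, x)))%:E =
      \int[lebesgue_rV R 0]_x (cst ((f a * (0 < a)%R%:R)%:E) x))%E.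
    apply: eq_integral => x _; rewrite /A /consrV mxE.
    by case: fintype.splitP => // j _; rewrite mxE.
  rewrite integral_cst//= diracT mule1 patchE mem_setE in_itv/= andbT.
  by case: ifP => _; rewrite ?mulr1 ?mulr0.
rewrite ge0_integral_polar//.
set C := (\int[mu]_t (f (expR t) * expR t)%:E)%E.
have C0 : (0 <= C)%E.
  by apply: integral_ge0 => t _; rewrite lee_fin mulr_ge0// expR_ge0.
transitivity (\int[lebesgue_rV R 1]_z ((shell_weight z * (0 < z ord0 ord0)%R%:R)%:E * C))%E.
  apply: eq_integral => z _; rewrite /shell_weight; case: ifPn => [zs|]; last by rewrite !mul0e mul0r mul0e.
  have z0 : 0 < enorm z by case/andP: zs => + _; exact: lt_le_trans.
  rewrite EFinM -muleA; congr (_ * _)%E; rewrite /C.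
  case: (ltP 0 (z ord0 ord0)) => zp; rewrite ?mul1e ?mul0e.
    apply: eq_integral => t _; rewrite mul1r /A !mxE.
    have -> : (enorm z)^-1 * z ord0 ord0 = 1.
      by rewrite /enorm big_ord_recl big_ord0 addr0 sqrtr_sqr gtr0_norm// mulVf// gt_eqF.
    by rewrite mulr1 expR_gt0 mulr1.
  apply: integral0_eq => t _; rewrite /A !mxE.
  rewrite [X in (0 < X)%R]mulrA ltNge mulr_ge0_le0 ?mulr0 ?mul0r//.
  by rewrite mulr_ge0 ?expR_ge0// invr_ge0 ltW.
move: C C0 => C C0; apply: ge0_integralZr => //.
  apply/measurable_EFinP; apply: measurable_funM; first exact: measurable_shell_weight.
  by apply: measurable_gt0; exact: measurable_coord.
by move=> z _; rewrite lee_fin mulr_ge0// shell_weight_ge0.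
Qed.

(** The constant is calibrated on the indicator of [[1, expR 1]], for which both integrals equal
    [expR 1 - 1]. *)
Let positive_shell1 : positive_shell = 1%E.
Proof.
have e1 : 1 < expR 1 :> R by rewrite expR_gt1.
have := polar1 (measurable_indic (measurable_itv `[1, expR 1])) (fun x => ltac:(by rewrite indicE)).
rewrite integral_indic//= setIidl; last first.
  by move=> x /=; rewrite !in_itv/= => /andP[x1 _]; rewrite andbT (lt_le_trans _ x1).
rewrite lebesgue_measure_itv/= lte_fin e1.
have -> : (\int[mu]_t (\1_`[1, expR 1] (expR t) * expR t)%:E = (expR 1 - 1)%:E)%E.
  transitivity (\int[mu]_(t in `[0%R, 1%R]) (expR t)%:E)%E.
    rewrite [RHS]integral_mkcond; apply: eq_integral => t _.
    rewrite patchE indicE !mem_setE !in_itv/= -[in X in (X <= expR t)%R]expR0 !ler_expR.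
    by case: ifP => _; rewrite ?mul1r ?mul0r.
  rewrite (@continuous_FTC2 _ _ expR) ?expR0//.
  - apply: continuous_subspaceT; exact: continuous_expR.
  - split; first by move=> x _; exact: derivable_expR.
    + by apply: cvg_at_right_filter; exact: continuous_expR.
    + by apply: cvg_at_left_filter; exact: continuous_expR.
  - by move=> x _; rewrite derive1E derive_val.
have : (0 <= positive_shell)%E.
  by apply: integral_ge0 => z _; rewrite lee_fin mulr_ge0// shell_weight_ge0.
case: positive_shell => [c|_|] //.
  rewrite -EFinD -EFinM => _ [] H; congr EFin; apply: (@mulIf _ (expR 1 - 1)).
    by rewrite subr_eq0 gt_eqF.
  by rewrite mul1r -H.
by rewrite gt0_mulye// lte_fin subr_gt0.
Qed.

Lemma ge0_integral_expR (f : R -> R) :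
  measurable_fun setT f -> (forall x, 0 <= f x) ->
  (\int[mu]_(r in `]0%R, +oo[) (f r)%:E = \int[mu]_t (f (expR t) * expR t)%:E)%E.
Proof. by move=> mf f0; rewrite polar1// positive_shell1 mul1e. Qed.

Lemma ge0_integral_expR_itv (f : R -> R) (a b : R) :
  measurable_fun setT f -> (forall x, 0 <= f x) ->
  (\int[mu]_(r in `[expR a, expR b]) (f r)%:E =
   \int[mu]_(t in `[a, b]) (f (expR t) * expR t)%:E)%E.
Proof.
move=> mf f0.
pose B := f \* \1_`[expR a, expR b].
have E := @ge0_integral_expR B.
transitivity (\int[mu]_(r in `]0%R, +oo[) (B r)%:E)%E.
  rewrite integral_mkcond [RHS]integral_mkcond; apply: eq_integral => r _.
  rewrite !patchE !mem_setE !in_itv/= andbT /B /= indicE mem_setE in_itv/=.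
  case: ifPn => [/andP[ar rb]|_]; last by rewrite mulr0; case: ifP.
  by rewrite mulr1 (lt_le_trans _ ar)// expR_gt0.
rewrite E.
- rewrite [RHS]integral_mkcond; apply: eq_integral => t _.
  rewrite patchE mem_setE in_itv/= /B /= indicE mem_setE in_itv/= !ler_expR.
  by case: ifP => _; rewrite ?mulr1 ?mulr0 ?mul0r.
- by apply: measurable_funM => //; exact: measurable_indic.
- by move=> x; rewrite mulr_ge0// indicE.
Qed.

End exp_substitution.

(** * The equation in the logarithmic variable *)

Section derive_rules.
Context {R : realType}.
Implicit Types f g : R -> R.

Lemma is_derive_mul f g (x df dg d : R) : is_derive x 1 f df ->
  is_derive x 1 g dg -> d = df * g x + f x * dg ->
  is_derive x 1 (fun t => f t * g t) d.
Proof.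
move=> Hf Hg ->; rewrite (_ : _ + _ = f x *: dg + g x *: df).
  exact: (is_deriveM Hf Hg).
by rewrite addrC /GRing.scale/= [g x * _]mulrC.
Qed.

Lemma is_derive_add f g (x df dg d : R) : is_derive x 1 f df ->
  is_derive x 1 g dg -> d = df + dg -> is_derive x 1 (fun t => f t + g t) d.
Proof. by move=> Hf Hg ->; exact: (is_deriveD Hf Hg). Qed.

Lemma is_derive_comp f g (x df dg d : R) : is_derive (g x) 1 f df ->
  is_derive x 1 g dg -> d = df * dg -> is_derive x 1 (fun t => f (g t)) d.
Proof. by move=> Hf Hg ->; exact: (is_derive1_comp Hf Hg). Qed.

Lemma is_derive_inv f (x df d : R) : f x != 0 -> is_derive x 1 f df ->
  d = - df / f x ^+ 2 -> is_derive x 1 (fun t => (f t)^-1) d.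
Proof.
move=> fx0 Hf ->; rewrite (_ : _ / _ = - (f x) ^- 2 *: df).
  exact: (is_deriveV fx0 Hf).
by rewrite /GRing.scale/= !mulNr mulrC.
Qed.

Lemma is_derive_scale (c : R) f (x df d : R) : is_derive x 1 f df -> d = c * df ->
  is_derive x 1 (fun t => c * f t) d.
Proof.
by move=> Hf ->; apply: is_derive_mul (is_derive_cst c x 1) Hf _; rewrite mul0r add0r.
Qed.

Lemma is_derive_expRM (c x d : R) : d = c * expR (c * x) ->
  is_derive x 1 (fun t => expR (c * t)) d.
Proof.
move=> ->; apply: is_derive_comp (is_derive_expR _) _ _.
by rewrite /GRing.scale/= mulr1 mulrC.
Qed.

End derive_rules.

Section lebesgue_opp.
Context {R : realType}.
Local Notation mu := (@lebesgue_measure R).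
Implicit Types (D : set R) (f : R -> R).

Lemma integrable_opp D f : measurable D -> mu.-integrable D (EFin \o f) ->
  mu.-integrable D (EFin \o (fun x => - f x)).
Proof.
move=> mD fi; have := @integrableZ_EFin _ (measurableTypeR R) R mu D mD (-1) f fi.
rewrite (_ : EFin \o _ = EFin \o (fun x => - f x))//.
by apply/funext => x /=; rewrite mulN1r.
Qed.

Lemma integrable_oppP D f : measurable D ->
  mu.-integrable D (EFin \o (fun x => - f x)) -> mu.-integrable D (EFin \o f).
Proof.
move=> mD /(integrable_opp mD); rewrite (_ : EFin \o _ = EFin \o f)//.
by apply/funext => x /=; rewrite opprK.
Qed.

Lemma Rintegral_opp D f : measurable D -> mu.-integrable D (EFin \o f) ->
  \int[mu]_(x in D) (- f x) = - \int[mu]_(x in D) f x.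
Proof.
move=> mD fi; rewrite -mulN1r -RintegralZl//.
by apply: eq_Rintegral => x _; rewrite mulN1r.
Qed.

End lebesgue_opp.

Section log_variable.
Context {R : realType} (rho : R) (v : R -> R).
Local Notation mu := (@lebesgue_measure R).

(** Extension by zero makes sign and measurability global, so that integrals over the whole line and
    compositions with [enorm] can be formed freely. *)
Definition potential (r : R) : R := (v \_ `]0, rho[) r.

Definition log_potential (t : R) : R := potential (expR t) * expR t ^+ 2.

Hypothesis v_ge0 : forall r, r \in `]0, rho[ -> 0 <= v r.
Hypothesis v_meas : measurable_fun `]0, rho[ v.

Lemma potentialE r : r \in `]0, rho[ -> potential r = v r.
Proof. by move=> r0; rewrite /potential patchE mem_setE r0. Qed.

Lemma potential_ge0 r : 0 <= potential r.
Proof. by rewrite /potential patchE mem_setE; case: ifP => // /v_ge0. Qed.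

Lemma measurable_potential : measurable_fun setT potential.
Proof. by apply/(measurable_restrictT _ _).1. Qed.

Lemma log_potential_ge0 t : 0 <= log_potential t.
Proof. by rewrite mulr_ge0 ?potential_ge0// exprn_ge0// expR_ge0. Qed.

Lemma measurable_log_potential : measurable_fun setT log_potential.
Proof.
apply: measurable_funM; last exact: measurable_funX.
exact: (measurableT_comp measurable_potential).
Qed.

End log_variable.

Section ode_log.
Context {R : realType} (rho : R) (v y : R -> R).
Local Notation mu := (@lebesgue_measure R).
Hypothesis rho0 : 0 < rho.
Hypothesis v_ge0 : forall r, r \in `]0, rho[ -> 0 <= v r.
Hypothesis v_meas : measurable_fun `]0, rho[ v.
Hypothesis y_sol : ode_solution rho v y.
Hypothesis y_gt0 : forall r, r \in `]0, rho[ -> 0 < y r.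

Local Notation q := (log_potential rho v).
Let T := ln rho.
Let Y t := y (expR t).
Let p t := expR t * derive1 y (expR t).

Let expT t : t < T -> expR t \in `]0, rho[.
Proof.
by move=> tT; rewrite in_itv/= expR_gt0/= -[ltRHS]lnK ?posrE// ltr_expR.
Qed.

Let dY t : t < T -> is_derive t 1 Y (p t).
Proof.
move=> tT; have [dy _] := y_sol.
apply: is_derive_comp (is_derive_expR t) _; last by rewrite /p mulrC.
by apply: DeriveDef; [exact: dy (expT tT)|rewrite derive1E].
Qed.

Let Y_gt0 t : t < T -> 0 < Y t.
Proof. by move=> tT; apply: y_gt0; exact: expT. Qed.

(** The self-adjoint form [(r y')' = - r v y] of the equation. The product rule gives the density
    [y2 r + y'], which the equation identifies almost everywhere. *)
Let momentum_r a b : a <= b -> b < T ->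
  antiderivative_on (expR a) (expR b) (fun r => derive1 y r * r)
    (fun r => - (potential rho v r * y r * r)).
Proof.
move=> ab bT; have [dy [y2 [[my2 _ ly2] Dy ode]]] := y_sol.
have ss : `[expR a, expR b] `<=` `]0, rho[.
  move=> r /=; rewrite !in_itv/= => /andP[ar rb]; rewrite (lt_le_trans (expR_gt0 a) ar)/=.
  by have := expT bT; rewrite in_itv/= => /andP[_]; exact: le_lt_trans.
have eab : expR a <= expR b by rewrite ler_expR.
have Hy' : antiderivative_on (expR a) (expR b) (derive1 y) y2.
  split.
    apply/integrableP; split; first by apply/measurable_EFinP; exact: measurable_funS my2.
    by apply: ly2 => //; exact: segment_compact.
  move=> s; rewrite in_itv/= => /andP[]; rewrite le_eqVlt => /predU1P[<- _|as_ sb].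
    by rewrite subrr set_itv1 Rintegral_set1.
  rewrite Dy// ?expR_gt0//; have : s \in `]0, rho[ by apply: ss; rewrite /= in_itv/= ltW.
  by rewrite in_itv/= => /andP[].
have Hid : antiderivative_on (expR a) (expR b) id (cst 1).
  have d1 x : x \in `[expR a, expR b] -> is_derive x 1 id (cst (1 : R) x) by move=> _; exact: is_derive_id.
  by apply: (antiderivative_onC1 eab d1); apply: continuous_subspaceT => x; exact: cvg_cst.
have Hp := antiderivative_onM eab Hy' Hid.
have cy : {within `[expR a, expR b], continuous y}.
  apply: continuous_in_subspaceT => x /set_mem /ss xr.
  by apply: differentiable_continuous; rewrite -derivable1_diffP; exact: dy.
have cy' := antiderivative_continuous eab Hy'.
apply: (antiderivative_on_ae Hp) => //.
  apply: measurable_funN; apply: measurable_funM => //; apply: measurable_funM.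
    by apply: measurable_funTS; exact: measurable_potential.
  exact: subspace_continuous_measurable_fun.
apply: (ae_imply ode) => r /= H rab; have rr : r \in `]0, rho[ := ss _ rab.
have r0 : r != 0 by move: rr; rewrite in_itv/= => /andP[/gt_eqF ->].
have := H rr; rewrite -(potentialE v rr) => E.
have -> : y2 r = - (derive1 y r / r + potential rho v r * y r).
  by apply/eqP; rewrite -addr_eq0 addrA E.
by rewrite mulr1 mulNr mulrDl divfK// opprD addrAC addNr add0r.
Qed.

(** The substitution [r = expR t] in [momentum_r]. It requires nonnegative integrands, which is
    where the signs of [v] and [y] enter; finiteness on the [r] side yields the integrability of
    [q Y]. *)
Lemma momentum_antiderivative a b : a <= b -> b < T ->
  antiderivative_on a b p (fun t => - (q t * Y t)).
Proof.
move=> ab bT; have M := momentum_r ab bT.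
pose f : R -> R := (fun r => potential rho v r * y r * r) \_ `[expR a, expR b].
have ss r : r \in `[expR a, expR b] -> r \in `]0, rho[.
  rewrite !in_itv/= => /andP[ar rb]; rewrite (lt_le_trans (expR_gt0 a) ar)/=.
  by have := expT bT; rewrite in_itv/= => /andP[_]; exact: le_lt_trans.
have f0 r : 0 <= f r.
  rewrite /f patchE mem_setE; case: ifPn => // rab.
  rewrite !mulr_ge0 ?potential_ge0//; first by rewrite ltW// y_gt0// ss.
  by have := ss _ rab; rewrite in_itv/= => /andP[/ltW].
have iM : mu.-integrable `[expR a, expR b] (EFin \o (fun r => potential rho v r * y r * r)).
  by apply: integrable_oppP => //; exact: M.1.
have mf : measurable_fun setT f.
  apply/(measurable_restrictT _ _).1 => //.
  by case/integrableP: iM => /measurable_EFinP.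
have E s : s \in `[a, b] -> (\int[mu]_(r in `[expR a, expR s]) (f r)%:E =
    \int[mu]_(t in `[a, s]) (q t * Y t)%:E)%E.
  rewrite in_itv/= => /andP[as_ sb].
  rewrite (ge0_integral_expR_itv a s mf f0); apply: eq_integral => t; rewrite mem_setE in_itv/= => /andP[at_ ts].
  rewrite /f patchE mem_setE in_itv/= !ler_expR at_ (le_trans ts sb)/= /log_potential.
  by congr EFin; rewrite /Y; ring.
have E' s : s \in `[a, b] -> (\int[mu]_(r in `[expR a, expR s]) (f r)%:E =
    \int[mu]_(r in `[expR a, expR s]) (potential rho v r * y r * r)%:E)%E.
  rewrite in_itv/= => /andP[as_ sb].
  apply: eq_integral => r; rewrite mem_setE in_itv/= => /andP[ar rs].
  by rewrite /f patchE mem_setE in_itv/= ar (le_trans rs)// ler_expR.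
have bab : b \in `[a, b] by rewrite in_itv/= lexx ab.
have cY : {within `[a, b], continuous Y}.
  apply: continuous_in_subspaceT => x /set_mem; rewrite /= in_itv/= => /andP[_ xb].
  exact: is_derive_continuous (dY (le_lt_trans xb bT)).
have mqY : measurable_fun `[a, b] (fun t => q t * Y t).
  apply: measurable_funM; first by apply: measurable_funTS; exact: measurable_log_potential.
  exact: subspace_continuous_measurable_fun.
have qY0 t : t <= b -> 0 <= q t * Y t.
  move=> tb; apply: mulr_ge0; first exact: log_potential_ge0.
  by rewrite ltW// Y_gt0// (le_lt_trans tb).
have iqY : mu.-integrable `[a, b] (EFin \o (fun t => q t * Y t)).
  apply/integrableP; split; first exact/measurable_EFinP.
  rewrite (_ : (\int[mu]_(x in _) _)%E = \int[mu]_(t in `[a, b]) (q t * Y t)%:E)%E.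
    rewrite -E// E'//; case/integrableP: (iM) => _; apply: le_lt_trans.
    rewrite le_eqVlt; apply/orP; left; apply/eqP; apply: eq_integral => r; rewrite mem_setE => rab.
    have := f0 r; rewrite /f patchE mem_setE rab => ?.
    by rewrite /= ger0_norm.
  apply: eq_integral => t; rewrite mem_setE in_itv/= => /andP[_ tb].
  by rewrite /= ger0_norm// qY0.
split.
  exact: integrable_opp.
move=> s sab; have [as_ sb] : a <= s /\ s <= b by move: sab; rewrite in_itv/= => /andP.
have ss' : `[expR a, expR s] `<=` `[expR a, expR b].
  by apply: subset_itvl; rewrite bnd_simp ler_expR.
have ssl : `[a, s] `<=` `[a, b] by apply: subset_itvl; rewrite bnd_simp.
rewrite /p mulrC [expR a * _]mulrC M.2; last by rewrite in_itv/= !ler_expR as_.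
rewrite !Rintegral_opp//; [|exact: integrableS iqY|exact: integrableS iM].
by congr (- _); rewrite /Rintegral -E'// E.
Qed.

(* As [p] is nonincreasing, [p t0 > 0] would make [Y] negative near [-oo]. *)
Lemma momentum_le0 t : t < T -> p t <= 0.
Proof.
move=> tT; rewrite leNgt; apply/negP => pt0.
have pmon s : s <= t -> p t <= p s.
  move=> st; rewrite -subr_ge0 -opprB oppr_ge0.
  rewrite (momentum_antiderivative st tT).2 ?in_itv/= ?lexx ?st//.
  have [ip _] := momentum_antiderivative st tT.
  rewrite Rintegral_opp//; last exact: integrable_oppP.
  rewrite oppr_le0; apply: Rintegral_ge0 => x; rewrite /= in_itv/= => /andP[_ xt].
  by rewrite mulr_ge0 ?log_potential_ge0// ltW// Y_gt0// (le_lt_trans xt).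
(* The tangent to [Y] at [t] reaches zero at [t - Y t / p t]; going one unit further leaves room in
   the mean value estimate. *)
pose s := t - (Y t / p t + 1).
have st : s < t by rewrite ltrBlDr ltrDl addr_gt0// divr_gt0// Y_gt0.
have dYs x : x \in `]s, t[ -> is_derive x 1 Y (p x).
  by rewrite in_itv/= => /andP[_ xt]; apply: dY; exact: lt_trans tT.
have cY : {within `[s, t], continuous Y}.
  apply: continuous_in_subspaceT => x /set_mem; rewrite /= in_itv/= => /andP[_ xb].
  exact: is_derive_continuous (dY (le_lt_trans xb tT)).
have [c /andP[]] := MVT st dYs cY.
rewrite !bnd_simp => sc ct E.
have := Y_gt0 (lt_trans st tT); apply/negP; rewrite -leNgt.
have -> : Y s = Y t - p c * (t - s) by rewrite -E; ring.
rewrite subr_le0 (@le_trans _ _ (p t * (t - s)))//.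
  by rewrite /s opprB addrC subrK mulrDr mulrCA mulfV ?gt_eqF// !mulr1 lerDl ltW.
by rewrite ler_wpM2r ?subr_ge0 ?(ltW st)// pmon// ltW.
Qed.

End ode_log.

Section line_inequality.
Context {R : realType}.
Local Notation mu := (@lebesgue_measure R).
Variables (T : R) (Y p q : R -> R).
Hypothesis dY : forall t, t < T -> is_derive t 1 Y (p t).
Hypothesis Y_gt0 : forall t, t < T -> 0 < Y t.
Hypothesis p_le0 : forall t, t < T -> p t <= 0.
Hypothesis p_anti : forall a b, a <= b -> b < T ->
  antiderivative_on a b p (fun t => - (q t * Y t)).
Hypothesis q_meas : measurable_fun setT q.
Hypothesis q_ge0 : forall t, 0 <= q t.

Section line.
Variables (k dk : R -> R) (a e : R).
Hypothesis dk_k : forall t : R, is_derive t 1 k (dk t).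
Hypothesis dk_cont : continuous dk.
Hypothesis ae : a <= e.
Hypothesis eT : e < T.
Hypothesis ke : k e = 0.

Let k_cont : continuous k.
Proof. by move=> t; exact: is_derive_continuous (dk_k t). Qed.

Let anti_sqr : antiderivative_on a e (fun t => k t * k t) (fun t => dk t * k t + k t * dk t).
Proof.
have Hk : antiderivative_on a e k dk.
  by apply: antiderivative_onC1 => //; exact: continuous_subspaceT.
exact: antiderivative_onM.
Qed.

Let ltT t : t \in `[a, e] -> t < T.
Proof. by rewrite in_itv/= => /andP[_ te]; exact: le_lt_trans eT. Qed.

Let Y_cont : {within `[a, e], continuous Y}.
Proof.
apply: continuous_in_subspaceT => x /set_mem xae.
exact: is_derive_continuous (dY (ltT xae)).
Qed.

Let p_cont : {within `[a, e], continuous p}.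
Proof. exact: antiderivative_continuous (p_anti ae eT). Qed.

Let anti_inv : antiderivative_on a e (fun t => (Y t)^-1) (fun t => - p t / Y t ^+ 2).
Proof.
have Yn0 t : t \in `[a, e] -> Y t != 0 by move=> tae; rewrite gt_eqF// Y_gt0// ltT.
apply: antiderivative_onC1 => //.
  by move=> t tae; apply: is_derive_inv (dY (ltT tae)) _ => //; exact: Yn0.
apply/subspace_continuousP => t tae; apply: cvgM.
  by apply: cvgN; move/subspace_continuousP : p_cont; exact.
apply: cvgV; first by rewrite expf_neq0// Yn0.
by apply: cvgM; move/subspace_continuousP : Y_cont; exact.
Qed.

Let anti_prod : antiderivative_on a e (fun t => p t * (k t * k t * (Y t)^-1))
  (fun t => - (q t * Y t) * (k t * k t * (Y t)^-1) +
    p t * ((dk t * k t + k t * dk t) * (Y t)^-1 + k t * k t * (- p t / Y t ^+ 2))).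
Proof.
apply: antiderivative_onM => //; first exact: p_anti.
exact: antiderivative_onM.
Qed.

(** The hypothesis [p_anti] gives integrability of [q Y]; multiplying this density by the absolutely
    continuous [k ^+ 2 / Y] gives that of [q k ^+ 2]. *)
Let int_qk : mu.-integrable `[a, e] (EFin \o (fun t => q t * k t ^+ 2)).
Proof.
have H := antiderivative_onM ae anti_sqr anti_inv.
have := antiderivative_integrableM ae H (p_anti ae eT).1.
move=> /(integrable_opp (measurable_itv _)); apply: eq_integrable => //.
move=> t; rewrite mem_setE => tae /=; congr EFin.
have Yt : Y t != 0 by rewrite gt_eqF// Y_gt0// ltT.
by field.
Qed.

Let int_dk : mu.-integrable `[a, e] (EFin \o (fun t => dk t ^+ 2)).
Proof.
apply: continuous_compact_integrable; first exact: segment_compact.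
by apply: continuous_subspaceT => x; apply: cvgM; exact: dk_cont.
Qed.

(* [(p k^2 / Y)' = - q k^2 + 2 (p / Y) k k' - (p / Y)^2 k^2 <= k'^2 - q k^2]. *)
Lemma line_inequality :
  \int[mu]_(t in `[a, e]) (q t * k t ^+ 2) <= \int[mu]_(t in `[a, e]) dk t ^+ 2.
Proof.
rewrite -subr_ge0 -RintegralB//.
have [ip Ep] := anti_prod.
apply: (@le_trans _ _ (\int[mu]_(t in `[a, e]) (- (q t * Y t) * (k t * k t * (Y t)^-1) +
    p t * ((dk t * k t + k t * dk t) * (Y t)^-1 + k t * k t * (- p t / Y t ^+ 2))))).
  (* Total increment of [p k^2 / Y]: the end [e] contributes zero, and the end [a] contributes
     [- p k^2 / Y >= 0] by the sign of [p]. Thus [k] may be nonzero at [a], as it is for test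
     functions that do not vanish near the centre of the ball. *)
  rewrite -Ep ?in_itv/= ?lexx ?ae// ke mulr0 mul0r mulr0 sub0r oppr_ge0.
  have aT := le_lt_trans ae eT.
  by rewrite mulr_le0_ge0 ?p_le0// mulr_ge0 -?expr2 ?sqr_ge0// invr_ge0 ltW// Y_gt0.
apply: le_Rintegral => //.
  by apply: integrableB_EFin.
move=> t /= tae; have Yt : Y t != 0 by rewrite gt_eqF// Y_gt0// ltT.
rewrite -subr_ge0 (_ : _ - _ = (dk t - p t * k t / Y t) ^+ 2) ?sqr_ge0//.
by field.
Qed.

Lemma ge0_line_inequality :
  (\int[mu]_(t in `[a, e]) (q t * k t ^+ 2)%:E <= \int[mu]_(t in `[a, e]) (dk t ^+ 2)%:E)%E.
Proof.
by rewrite -[leLHS]fineK ?integrable_fin_num// -[leRHS]fineK ?integrable_fin_num// lee_fin line_inequality.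
Qed.

End line.

Variable m : R.
Hypothesis m_ge0 : 0 <= m.

Section weighted_line.
Variables (f df : R -> R) (e : R).
Hypothesis df_f : forall t : R, is_derive t 1 f (df t).
Hypothesis df_cont : continuous df.
Hypothesis eT : e < T.
Hypothesis fe : forall t, e <= t -> f t = 0.

Let f_cont : continuous f.
Proof. by move=> t; exact: is_derive_continuous (df_f t). Qed.

(** When [f] is the restriction of a test function to a ray, this undoes the factor [|x|^-m]. *)
Let k t := expR (m * t) * f t.
Let dk t := expR (m * t) * (df t + m * f t).

Let exp_cont : continuous (fun t : R => expR (m * t)).
Proof.
move=> t; apply: (@continuous_comp _ _ _ (fun t : R => m * t) expR).
  by apply: cvgM; [exact: cvg_cst|exact: cvg_id].
exact: continuous_expR.
Qed.

Let dk_k (t : R) : is_derive t 1 k (dk t).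
Proof.
apply: is_derive_mul (is_derive_expRM (erefl _)) (df_f t) _; rewrite /dk; ring.
Qed.

Let dk_cont : continuous dk.
Proof.
move=> t; apply: cvgM; first exact: exp_cont.
by apply: cvgD; [exact: df_cont|apply: cvgM; [exact: cvg_cst|exact: f_cont]].
Qed.

Let k_cont : continuous k.
Proof. by move=> t; exact: is_derive_continuous (dk_k t). Qed.

(** From [f' e^(mt) = k' - m k] one gets [f'^2 e^(2mt) = k'^2 + m^2 k^2 - m (k^2)']. As [k e = 0],
    the last term integrates to [m k(a)^2 >= 0], and the line inequality for [k] does the rest. *)
Let weighted_line_inequality_itv a : a <= e ->
  (\int[mu]_(t in `[a, e]) ((m ^+ 2 + q t) * f t ^+ 2 * expR (2 * m * t))%:E <=
   \int[mu]_(t in `[a, e]) (df t ^+ 2 * expR (2 * m * t))%:E)%E.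
Proof.
move=> ae.
have ke : k e = 0 by rewrite /k fe// mulr0.
have E2 t : expR (2 * m * t) = expR (m * t) ^+ 2 by rewrite -mulrA expRM_natl.
have cint g : continuous g -> mu.-integrable `[a, e] (EFin \o g).
  move=> cg; apply: continuous_compact_integrable; first exact: segment_compact.
  exact: continuous_subspaceT.
have mk2 : measurable_fun setT (fun t => k t ^+ 2).
  by apply: measurable_funX; exact: continuous_measurable_fun.
have ck2 : continuous (fun t => k t ^+ 2) by move=> t; apply: cvgM; exact: k_cont.
have cdk2 : continuous (fun t => dk t ^+ 2) by move=> t; apply: cvgM; exact: dk_cont.
have -> : (\int[mu]_(t in `[a, e]) ((m ^+ 2 + q t) * f t ^+ 2 * expR (2 * m * t))%:E =
    \int[mu]_(t in `[a, e]) (m ^+ 2 * k t ^+ 2)%:E + \int[mu]_(t in `[a, e]) (q t * k t ^+ 2)%:E)%E.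
  rewrite -ge0_integralD//.
  - by apply: eq_integral => t _; rewrite -EFinD E2 /k; congr EFin; ring.
  - by move=> t _; rewrite lee_fin mulr_ge0// sqr_ge0.
  - by apply/measurable_EFinP; apply: measurable_funTS; exact: measurable_funM.
  - by move=> t _; rewrite lee_fin mulr_ge0// sqr_ge0.
  - by apply/measurable_EFinP; apply: measurable_funTS; exact: measurable_funM.
apply: (@le_trans _ _ (\int[mu]_(t in `[a, e]) (m ^+ 2 * k t ^+ 2)%:E + \int[mu]_(t in `[a, e]) (dk t ^+ 2)%:E)%E).
  by apply: leeD2l; exact: ge0_line_inequality.
have ikdk : mu.-integrable `[a, e] (EFin \o (fun t => dk t * k t + k t * dk t)).
  by apply: cint => t; apply: cvgD; apply: cvgM; [exact: dk_cont|exact: k_cont|exact: k_cont|exact: dk_cont].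
have im : mu.-integrable `[a, e] (EFin \o (fun t => m ^+ 2 * k t ^+ 2)).
  by apply: cint => t; apply: cvgM; [exact: cvg_cst|exact: ck2].
have idk : mu.-integrable `[a, e] (EFin \o (fun t => dk t ^+ 2)) by exact: cint.
have idf : mu.-integrable `[a, e] (EFin \o (fun t => df t ^+ 2 * expR (2 * m * t))).
  rewrite (_ : (fun t => _) = (fun t => df t * df t * (expR (m * t) * expR (m * t)))).
    by apply: cint => t; apply: cvgM; apply: cvgM; [exact: df_cont|exact: df_cont|exact: exp_cont|exact: exp_cont].
  by apply/funext => t; rewrite E2 !expr2.
rewrite -[X in (X + _)%E]fineK ?integrable_fin_num//.
rewrite -[X in (_ + X)%E]fineK ?integrable_fin_num//.
rewrite -[leRHS]fineK ?integrable_fin_num// -EFinD lee_fin.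
rewrite -/(Rintegral _ _ _) -/(Rintegral _ _ _) -/(Rintegral _ _ _).
rewrite -RintegralD// -subr_ge0 -RintegralB//; last exact: integrableD_EFin.
rewrite (_ : \int[mu]_(t in _) _ = \int[mu]_(t in `[a, e]) (- m * (dk t * k t + k t * dk t))); last first.
  apply: eq_Rintegral => t _; rewrite E2 /k /dk; ring.
rewrite RintegralZl//.
have Hk : antiderivative_on a e k dk.
  by apply: antiderivative_onC1 => //; exact: continuous_subspaceT.
have [_ <-] := antiderivative_onM ae Hk Hk; last by rewrite in_itv/= lexx ae.
by rewrite ke mul0r sub0r mulNr mulrN opprK mulr_ge0// -expr2 sqr_ge0.
Qed.

(** Monotone convergence as the left end tends to [-oo], that is, to the centre of the ball. *)
Lemma weighted_line_inequality :
  (\int[mu]_t ((m ^+ 2 + q t) * f t ^+ 2 * expR (2 * m * t))%:E <=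
   \int[mu]_t (df t ^+ 2 * expR (2 * m * t))%:E)%E.
Proof.
pose F i : set R := `[e - i%:R, e]%classic.
have mexp : measurable_fun setT (fun t : R => expR (2 * m * t)).
  by apply: measurableT_comp => //; exact: measurable_funM.
have mg : measurable_fun setT (fun t => ((m ^+ 2 + q t) * f t ^+ 2 * expR (2 * m * t))%:E).
  apply/measurable_EFinP; apply: measurable_funM => //; apply: measurable_funM.
    exact: measurable_funD.
  by apply: measurable_funX; exact: continuous_measurable_fun.
have mh : measurable_fun setT (fun t => (df t ^+ 2 * expR (2 * m * t))%:E).
  apply/measurable_EFinP; apply: measurable_funM => //.
  by apply: measurable_funX; exact: continuous_measurable_fun.
have g0 t : (0 <= ((m ^+ 2 + q t) * f t ^+ 2 * expR (2 * m * t))%:E)%E.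
  by rewrite lee_fin mulr_ge0 ?expR_ge0// mulr_ge0 ?sqr_ge0// addr_ge0 ?sqr_ge0.
have h0 t : (0 <= (df t ^+ 2 * expR (2 * m * t))%:E)%E.
  by rewrite lee_fin mulr_ge0 ?expR_ge0// sqr_ge0.
have -> : (\int[mu]_t ((m ^+ 2 + q t) * f t ^+ 2 * expR (2 * m * t))%:E =
   \int[mu]_(t in \bigcup_i F i) ((m ^+ 2 + q t) * f t ^+ 2 * expR (2 * m * t))%:E)%E.
  rewrite [RHS]integral_mkcond; apply: eq_integral => t _; rewrite patchE.
  case: ifPn => // /negP tF; rewrite fe ?expr0n ?mulr0 ?mul0r//.
  rewrite leNgt; apply/negP => te; apply: tF; rewrite inE.
  exists (Num.truncn (e - t)).+1 => //; rewrite /F /= in_itv/= (ltW te) andbT.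
  by rewrite lerBlDr -lerBlDl ltW// truncnS_gt.
have ndF : nondecreasing_seq F.
  move=> i j ij; apply/subsetPset; apply: subset_itvr; rewrite bnd_simp.
  by rewrite lerB// ler_nat.
have cv : (\int[mu]_(t in F i) ((m ^+ 2 + q t) * f t ^+ 2 * expR (2 * m * t))%:E)%E @[i --> \oo] -->
    (\int[mu]_(t in \bigcup_i F i) ((m ^+ 2 + q t) * f t ^+ 2 * expR (2 * m * t))%:E)%E.
  apply: ge0_nondecreasing_set_cvg_integral => // i; first exact: measurable_itv.
  exact: measurable_funTS.
apply: (cvge_to_le cv).
apply: nearW => i.
apply: (@le_trans _ _ (\int[mu]_(t in F i) (df t ^+ 2 * expR (2 * m * t))%:E)%E).
  by apply: weighted_line_inequality_itv; rewrite gerBl.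
by apply: ge0_subset_integral => //; exact: measurable_itv.
Qed.

End weighted_line.
End line_inequality.

(** * Rays and test functions *)

Section line_derivatives.
Context {R : realType}.

Lemma is_derive_epsilon (f : R -> R) (x l : R) :
  (forall e, 0 < e -> exists2 d, 0 < d & forall h, h != 0 -> `|h| < d ->
     `|l - h^-1 * (f (h + x) - f x)| <= e) ->
  is_derive x 1 f l.
Proof.
move=> H.
have cv : h^-1 *: ((f \o shift x) (h *: (1 : R)) - f x) @[h --> 0^'] --> l.
  apply/cvgrPdist_le => e e0; have [d d0 Hd] := H e e0.
  near=> h; rewrite /= /GRing.scale/= mulr1; apply: Hd.
    near: h; exact: nbhs_dnbhs_neq.
  near: h; apply: dnbhs0_lt; exact: d0.
apply: DeriveDef; first by apply/cvg_ex; exists l.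
exact: cvg_lim cv.
Unshelve. all: by end_near. Qed.

Lemma is_derive_line n (f : 'rV[R]_n -> R) (w u : 'rV[R]_n) (t : R) :
  derivable f (w + t *: u) u ->
  is_derive t 1 (fun s : R => f (w + s *: u)) ('D_u f (w + t *: u)).
Proof.
move=> df.
have E : (fun h : R => h^-1 *: (((fun s => f (w + s *: u)) \o shift t) (h *: 1) - f (w + t *: u)))
    = (fun h => h^-1 *: ((f \o shift (w + t *: u)) (h *: u) - f (w + t *: u))).
  apply/funext => h /=; congr (_ *: (f _ - _)).
  rewrite (_ : h *: (1 : R) = h); last by rewrite /GRing.scale/= mulr1.
  by rewrite scalerDl addrCA.
by apply: DeriveDef; [rewrite /derivable E|rewrite /derive E].
Qed.

Lemma MVT_dist (f df : R -> R) (a b : R) :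
  (forall x : R, is_derive x 1 f (df x)) ->
  exists2 c, `|c - a| <= `|b - a| & f b - f a = df c * (b - a).
Proof.
move=> fd.
have cf : continuous f by move=> x; exact: is_derive_continuous (fd x).
case: (leP a b) => [ab|/ltW ba].
  have [c] := MVT_segment ab (fun x _ => fd x) (continuous_subspaceT cf).
  rewrite in_itv/= => /andP[ac cb] E; exists c => //.
  by rewrite !ger0_norm ?subr_ge0// lerB.
have [c] := MVT_segment ba (fun x _ => fd x) (continuous_subspaceT cf).
rewrite in_itv/= => /andP[bc ca] E; exists c => //.
  by rewrite !ler0_norm ?subr_le0// lerN2 lerB.
by rewrite -[LHS]opprB E -mulrN opprB.
Qed.

End line_derivatives.

Section rays.
Context {R : realType} {n : nat}.
Implicit Types (f : 'rV[R]_n -> R) (x z w : 'rV[R]_n).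

Definition C1 f : Prop := forall i, continuous (partial i f) /\
  forall x, derivable f x (delta_mx ord0 i).

(** Vertices of the staircase path from [0] to [z], one coordinate direction per step. *)
Let trunc z (j : nat) : 'rV[R]_n := \row_i (if (i < j)%N then z ord0 i else 0).

Let truncS z (j : 'I_n) : trunc z j.+1 = trunc z j + z ord0 j *: delta_mx ord0 j.
Proof.
apply/rowP => i; rewrite !mxE eqxx/= ltnS leq_eqVlt (inj_eq val_inj).
have [->|ij] := eqVneq i j; first by rewrite ltnn mulr1 add0r.
by rewrite mulr0 addr0.
Qed.

Let norm_trunc z j (i : 'I_n) : `|trunc z j ord0 i| <= `|z|.
Proof.
rewrite mxE; case: ifP => _; last by rewrite normr0.
by rewrite [leRHS]/Num.Def.normr/= mx_normrE; apply/bigmax_geP; right; exists (ord0, i).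
Qed.

(** The increment along [z] is telescoped over the staircase path, the mean value theorem is applied
    to each step, and continuity of the partial derivatives brings all the intermediate points back
    to [x]. *)
Lemma C1_line f x z : C1 f ->
  is_derive (0 : R) 1 (fun s : R => f (x + s *: z)) (\sum_i z ord0 i * partial i f x).
Proof.
move=> cf; apply: is_derive_epsilon => e e0.
(* Each of the [n] steps costs at most the norm of [z] times this bound; the summand [1] keeps the
   denominator positive. *)
have [d d0 Hd] : exists2 d, 0 < d & forall y : 'rV[R]_n, (forall i, `|y ord0 i - x ord0 i| < d) ->
    forall i, `|partial i f y - partial i f x| <= e / (n%:R * `|z| + 1).
  have C0 : 0 < e / (n%:R * `|z| + 1) by rewrite divr_gt0// ltr_wpDl// mulr_ge0.
  have : \forall y \near x, forall i, `|partial i f y - partial i f x| <= e / (n%:R * `|z| + 1).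
    suff : forall i, \forall y \near x, `|partial i f y - partial i f x| <= e / (n%:R * `|z| + 1).
      move=> H; exact: (@filter_forall _ 'I_n (fun i y => `|partial i f y - partial i f x| <= e / (n%:R * `|z| + 1)) (nbhs x) _ H).
    move=> i; have [/(_ x) /cvgrPdist_le /(_ _ C0) + _] := cf i.
    by apply: filterS => y; rewrite distrC.
  move=> /nbhs_ballP[d /= d0 Hd]; exists d => // y Hy; apply: Hd; split => // i j.
  by rewrite (ord1 i) /ball/= distrC.
exists (d / (`|z| + 1)); first by rewrite divr_gt0// ltr_wpDl.
move=> h h0 hd; rewrite addr0 scale0r addr0.
have step (j : 'I_n) : exists2 y : 'rV[R]_n, (forall i, `|y ord0 i - x ord0 i| < d) &
    f (x + h *: trunc z j.+1) - f (x + h *: trunc z j) = partial j f y * (h * z ord0 j).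
  have [c cb E] := @MVT_dist R (fun s => f ((x + h *: trunc z j) + s *: delta_mx ord0 j))
     (fun s => partial j f ((x + h *: trunc z j) + s *: delta_mx ord0 j)) 0 (h * z ord0 j)
     (fun s => is_derive_line ((cf j).2 _)).
  exists ((x + h *: trunc z j) + c *: delta_mx ord0 j); last first.
    by move: E; rewrite scale0r addr0 subr0 => <-; rewrite truncS scalerDr scalerA addrA.
  move=> i; have -> : (x + h *: trunc z j + c *: delta_mx ord0 j) ord0 i - x ord0 i =
      h * trunc z j ord0 i + c * delta_mx (ord0 : 'I_1) j ord0 i.
    by rewrite !mxE; ring.
  move: cb; rewrite !subr0 => cb.
  have key : `|h| * `|z| < d.
    rewrite (@le_lt_trans _ _ (`|h| * (`|z| + 1)))//; first by rewrite ler_wpM2l// lerDl.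
    by rewrite -ltr_pdivlMr// ltr_wpDl.
  rewrite !mxE eqxx /=; have [->|ij] := eqVneq i j.
    rewrite ltnn mulr0 add0r mulr1 (le_lt_trans cb)// normrM (le_lt_trans _ key)//.
    by rewrite ler_wpM2l//; have := norm_trunc z j.+1 j; rewrite mxE ltnSn.
  rewrite mulr0 addr0 normrM (le_lt_trans _ key)// ler_wpM2l//.
  by have := norm_trunc z j i; rewrite mxE.
have [y Hy] := choice (fun j => let: ex_intro2 y P Q := step j in ex_intro _ y (conj P Q)).
have tele : f (x + h *: z) - f x = \sum_(j < n) partial j f (y j) * (h * z ord0 j).
  have -> : f (x + h *: z) - f x = \sum_(0 <= j < n) (f (x + h *: trunc z j.+1) - f (x + h *: trunc z j)).
    rewrite telescope_sumr//; congr (f _ - f _).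
      by congr (_ + _ *: _); apply/rowP => i; rewrite mxE ltn_ord.
    rewrite (_ : trunc z 0 = 0) ?scaler0 ?addr0//.
    by apply/rowP => i; rewrite !mxE.
  rewrite big_mkord; apply: eq_bigr => j _; exact: (Hy j).2.
rewrite tele mulr_sumr -sumrB.
apply: le_trans (ler_norm_sum _ _ _) _.
apply: (@le_trans _ _ (\sum_(j < n) `|z| * (e / (n%:R * `|z| + 1)))).
  apply: ler_sum => j _.
  rewrite (_ : _ - _ = z ord0 j * (partial j f x - partial j f (y j))); last by field.
  rewrite normrM ler_pM//.
    by have := norm_trunc z j.+1 j; rewrite mxE ltnSn.
  rewrite distrC; exact: (Hd _ (Hy j).1 j).
have D0 : 0 < n%:R * `|z| + 1 by rewrite ltr_wpDl// mulr_ge0.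
rewrite sumr_const card_ord.
have -> : (`|z| * (e / (n%:R * `|z| + 1))) *+ n = n%:R * `|z| / (n%:R * `|z| + 1) * e.
  by rewrite -mulr_natl; ring.
by rewrite ger_pMl// ler_pdivrMr// mul1r lerDl.
Qed.

Lemma C1_ray f w (s : R) : C1 f ->
  is_derive s 1 (fun s : R => f (s *: w)) (\sum_i w ord0 i * partial i f (s *: w)).
Proof.
move=> cf; have := C1_line (s *: w) w cf => d0.
have E : (fun s' : R => f (s' *: w)) = (fun s' => (fun h : R => f (s *: w + h *: w)) (s' - s)).
  by apply/funext => s'; rewrite -scalerDl addrC subrK.
have d1 : is_derive (s - s) 1 (fun h : R => f (s *: w + h *: w)) (\sum_i w ord0 i * partial i f (s *: w)).
  by rewrite subrr.
have d2 : is_derive s 1 (fun s' : R => s' - s) 1.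
  by apply: is_derive_add (is_derive_id s 1) (is_derive_cst (- s) s 1) _; rewrite addr0.
have := @is_derive_comp R (fun h : R => f (s *: w + h *: w)) (fun s' : R => s' - s) s _ _ _ d1 d2 (erefl _).
rewrite mulr1 => d3.
by rewrite E; exact: d3.
Qed.

Lemma C1_log_ray f w (t : R) : C1 f ->
  is_derive t 1 (fun t : R => f (expR t *: w))
    (expR t * \sum_i w ord0 i * partial i f (expR t *: w)).
Proof.
move=> cf; apply: is_derive_comp (C1_ray w (expR t) cf) (is_derive_expR t) _.
by rewrite mulrC.
Qed.

Lemma continuous_scale w : continuous (fun t : R => expR t *: w).
Proof.
move=> t; apply: (@continuous_comp _ _ _ expR (fun k : R => k *: w)).
  exact: continuous_expR.
exact: scalel_continuous.
Qed.

Lemma continuous_log_ray_derivative f w : C1 f ->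
  continuous (fun t : R => expR t * \sum_i w ord0 i * partial i f (expR t *: w)).
Proof.
move=> cf t; apply: cvgM; first exact: continuous_expR.
apply: continuous_sumr => i {}t; apply: cvgM; first exact: cvg_cst.
apply: (@continuous_comp _ _ _ (fun t : R => expR t *: w) (partial i f)); first exact: continuous_scale.
exact: (cf i).1.
Qed.

(** Cauchy-Schwarz for a unit vector, read off from the squared residual of the projection of [g]
    onto [w]. It is where the tangential part of the gradient is discarded. *)
Lemma sqr_radial_derivative_le (w : 'rV[R]_n) (g : 'I_n -> R) : enorm w = 1 ->
  (\sum_i w ord0 i * g i) ^+ 2 <= \sum_i g i ^+ 2.
Proof.
move=> w1; set c := \sum_i _ * _.
have : 0 <= \sum_i (g i - c * w ord0 i) ^+ 2 by apply: sumr_ge0 => i _; exact: sqr_ge0.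
rewrite (eq_bigr (fun i => g i ^+ 2 - (2 * c) * (w ord0 i * g i) + c ^+ 2 * w ord0 i ^+ 2)); last first.
  by move=> i _; ring.
rewrite big_split/= sumrB -!mulr_sumr -sqr_enorm w1 -/c => H.
rewrite -subr_ge0; apply: le_trans H _; rewrite le_eqVlt; apply/orP; left; apply/eqP; ring.
Qed.

Lemma smooth_C1 f : smooth f -> C1 f.
Proof. by move=> sf i; split; [exact: (sf [:: i]).1|move=> x; exact: (sf [::]).2]. Qed.

End rays.

Section test_functions.
Context {R : realType} {n : nat}.
Implicit Types (f : 'rV[R]_n -> R).

Lemma test_function0 (rho : R) f x : test_function (eball rho) f -> rho <= enorm x -> f x = 0.
Proof.
move=> [_ _ sub] rx; apply/eqP; apply/negPn/negP => fx.
have /sub : closure [set x | f x != 0] x by exact: subset_closure.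
by rewrite /eball/= ltNge rx.
Qed.

(** The boundary point [rho *: w] lies outside the closed support, hence so does a piece of the ray
    around it. This provides the strict inequality [e < ln rho] that the line inequality asks
    for. *)
Lemma test_function_ray (rho : R) f w : 0 < rho -> enorm w = 1 ->
  test_function (eball rho) f ->
  exists2 e, expR e < rho & forall t, e <= t -> f (expR t *: w) = 0.
Proof.
move=> rho0 w1 tf; have [sf _ sub] := tf.
have nK : (~` closure [set x | f x != 0]) (rho *: w).
  by move=> /sub; rewrite /eball/= enormZ w1 mulr1 gtr0_norm// ltxx.
have oK : open (~` closure [set x | f x != 0]) by exact/closed_openC/closed_closure.
have : nbhs (rho *: w) (~` closure [set x | f x != 0]) by exact: open_nbhs_nbhs.
have cw : {for rho, continuous (fun k : R => k *: w)} by exact: scalel_continuous.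
move=> /cw /nbhs_ballP[d /= d0 Hd].
(* The first entry keeps [e] positive, so that its logarithm makes sense; the second keeps the
   points between [e] and [rho] at distance less than [d] from [rho]. *)
pose e := Num.max (rho / 2) (rho - d / 2).
have e0 : 0 < e by rewrite lt_max divr_gt0.
have erho : e < rho.
  by rewrite gt_max ltr_pdivrMr// ltr_pMr// ltr1n gtrBl divr_gt0.
exists (ln e); first by rewrite lnK.
move=> t et; have et' : e <= expR t by rewrite -[leLHS]lnK// ler_expR.
case: (leP rho (expR t)) => trho.
  by apply: (test_function0 tf); rewrite enormZ w1 mulr1 gtr0_norm ?expR_gt0.
apply/eqP/negPn/negP => ft.
apply: (Hd (expR t)); last exact: subset_closure.
rewrite /ball/= gtr0_norm ?subr_gt0// ltrBlDr -ltrBlDl (lt_le_trans _ et')//.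
by rewrite lt_max; apply/orP; right; rewrite ltrD2l ltrN2 ltr_pdivrMr// ltr_pMr// ltr1n.
Qed.

End test_functions.

Section hardy_test_functions.
Context {R : realType} (n : nat) (rho : R) (v y : R -> R).
Local Notation mu := (@lebesgue_measure R).
Hypothesis rho0 : 0 < rho.
Hypothesis v_ge0 : forall r, r \in `]0, rho[ -> 0 <= v r.
Hypothesis v_meas : measurable_fun `]0, rho[ v.
Hypothesis y_sol : ode_solution rho v y.
Hypothesis y_gt0 : forall r, r \in `]0, rho[ -> 0 < y r.

Variable m : R.
Hypothesis m_ge0 : 0 <= m.
Hypothesis m2 : 2 * m + 2 = n.+1%:R.

Definition hardy_weight (x : 'rV[R]_n.+1) : R :=
  m ^+ 2 / enorm x ^+ 2 + potential rho v (enorm x).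

Lemma hardy_weight_ge0 x : 0 <= hardy_weight x.
Proof.
by rewrite addr_ge0 ?potential_ge0// mulr_ge0 ?sqr_ge0// invr_ge0 sqr_ge0.
Qed.

Lemma measurable_hardy_weight : measurable_fun setT hardy_weight.
Proof.
apply: measurable_funD.
  apply: measurable_funM => //.
  apply: (@measurableT_comp _ _ _ _ _ _ (fun r : R => r^-1)); first exact: measurable_invr.
  by apply: measurable_funX; exact: measurable_enorm.
apply: (@measurableT_comp _ _ _ _ _ _ (potential rho v)); last exact: measurable_enorm.
exact: measurable_potential.
Qed.

(** The inequality holds on each ray separately. The polar density is [e^(2mt) e^(2t)]; the factor
    [e^(2t)] turns [hardy_weight] into [m^2 + q] and is also the square of the factor [e^t] in the
    logarithmic derivative along the ray. *)
Lemma hardy_test_function phi : test_function (eball rho) phi ->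
  (\int[lebesgue_rV R n.+1]_x (hardy_weight x * phi x ^+ 2)%:E <=
   \int[lebesgue_rV R n.+1]_x (\sum_i partial i phi x ^+ 2)%:E)%E.
Proof.
move=> tphi; have [sphi _ _] := tphi; have cphi := smooth_C1 sphi.
have mphi : measurable_fun setT phi by apply: continuous_measurable_rV; exact: (sphi [::]).1.
have mgrad : measurable_fun setT (fun x => \sum_i partial i phi x ^+ 2).
  apply: measurable_sum => i; apply: measurable_funX.
  by apply: continuous_measurable_rV; exact: (cphi i).1.
have mA : measurable_fun setT (fun x => hardy_weight x * phi x ^+ 2).
  by apply: measurable_funM; [exact: measurable_hardy_weight|exact: measurable_funX].
have A0 x : 0 <= hardy_weight x * phi x ^+ 2 by rewrite mulr_ge0 ?sqr_ge0// hardy_weight_ge0.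
have G0 x : 0 <= \sum_i partial i phi x ^+ 2 by apply: sumr_ge0 => i _; exact: sqr_ge0.
rewrite (ge0_integral_polar mA A0) (ge0_integral_polar mgrad G0).
have mpolar (B : 'rV[R]_n.+1 -> R) : measurable_fun setT B -> (forall x, 0 <= B x) ->
    measurable_fun setT (fun z => ((shell_weight z)%:E *
     \int[mu]_t (B (expR t *: ((enorm z)^-1 *: z)) * expR (n.+1%:R * t))%:E)%E).
  move=> mB B0; apply: emeasurable_funM; first by apply/measurable_EFinP; exact: measurable_shell_weight.
  apply: (@measurable_fun_fubini_tonelli_G _ _ _ _ _ mu
     (fun p : R * 'rV[R]_n.+1 => (B (expR p.1 *: ((enorm p.2)^-1 *: p.2)) * expR (n.+1%:R * p.1))%:E)).
    apply/measurable_EFinP; apply: measurable_funM.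
      apply: (measurableT_comp mB); apply: measurable_scale_rV.
        by apply: measurableT_comp => //; exact: measurable_fst.
      apply: measurable_scale_rV; last exact: measurable_snd.
      apply: (@measurableT_comp _ _ _ _ _ _ (fun r : R => r^-1)); first exact: measurable_invr.
      by apply: (measurableT_comp measurable_enorm); exact: measurable_snd.
    by apply: measurableT_comp => //; apply: measurable_funM => //; exact: measurable_fst.
  by move=> p; rewrite lee_fin mulr_ge0 ?expR_ge0.
apply: ge0_le_integral => //.
- move=> z _; rewrite mule_ge0 ?lee_fin ?shell_weight_ge0//.
  by apply: integral_ge0 => t _; rewrite lee_fin mulr_ge0 ?expR_ge0.
- exact: (mpolar _ mA A0).
- exact: (mpolar _ mgrad G0).
move=> z _; case: (boolP (in_shell z)) => zs; last first.
  by rewrite /shell_weight (negbTE zs) !mul0e.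
rewrite lee_wpmul2l ?lee_fin ?shell_weight_ge0//.
have z0 : 0 < enorm z by case/andP: zs => + _; exact: lt_le_trans.
set w := (enorm z)^-1 *: z.
have w1 : enorm w = 1 by rewrite enormZ gtr0_norm ?invr_gt0// mulVf ?gt_eqF.
have nw t : enorm (expR t *: w) = expR t by rewrite enormZ w1 mulr1 gtr0_norm ?expR_gt0.
have [e erho phie] := test_function_ray rho0 w1 tphi.
have eT : e < ln rho by rewrite -ltr_expR lnK.
pose f t := phi (expR t *: w).
pose df t := expR t * \sum_i w ord0 i * partial i phi (expR t *: w).
have dff (t : R) : is_derive t 1 f (df t) by exact: C1_log_ray.
have cdf : continuous df by exact: continuous_log_ray_derivative.
have dY (t : R) : t < ln rho -> is_derive t 1 (fun t => y (expR t)) (expR t * derive1 y (expR t)).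
  move=> tT; have [dy _] := y_sol.
  apply: is_derive_comp (is_derive_expR t) _; last by rewrite mulrC.
  apply: DeriveDef; last by rewrite derive1E.
  by apply: dy; rewrite in_itv/= expR_gt0/= -[ltRHS]lnK ?posrE// ltr_expR.
have Yp (t : R) : t < ln rho -> 0 < y (expR t).
  by move=> tT; apply: y_gt0; rewrite in_itv/= expR_gt0/= -[ltRHS]lnK ?posrE// ltr_expR.
have := @weighted_line_inequality R (ln rho) (fun t => y (expR t)) (fun t => expR t * derive1 y (expR t))
  (log_potential rho v) dY Yp (momentum_le0 rho0 v_ge0 v_meas y_sol y_gt0)
  (momentum_antiderivative rho0 v_ge0 v_meas y_sol y_gt0) (measurable_log_potential v_meas)
  (log_potential_ge0 v_ge0) m m_ge0 f df e dff cdf eT phie.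
have E (t : R) : expR (n.+1%:R * t) = expR (2 * m * t) * expR t ^+ 2.
  by rewrite -m2 -expRM_natl -expRD; congr expR; ring.
move=> H; apply: le_trans (le_trans H _).
  rewrite le_eqVlt; apply/orP; left; apply/eqP; apply: eq_integral => t _; congr EFin.
  rewrite /hardy_weight nw E /log_potential /f; field.
  by rewrite gt_eqF// expR_gt0.
have mray (B : 'rV[R]_n.+1 -> R) : measurable_fun setT B -> measurable_fun setT (fun t : R => B (expR t *: w)).
  by move=> mB; apply: (measurableT_comp mB); exact: measurable_scale_rV.
have mexp (c : R) : measurable_fun setT (fun t : R => expR (c * t)).
  by apply: measurableT_comp => //; exact: measurable_funM.
apply: ge0_le_integral => //.
- by move=> t _; rewrite lee_fin mulr_ge0 ?sqr_ge0 ?expR_ge0.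
- apply/measurable_EFinP; apply: measurable_funM; last exact: mexp.
  by apply: measurable_funX; exact: continuous_measurable_fun.
- apply/measurable_EFinP; apply: measurable_funM; last exact: mexp.
  exact: (mray (fun x => \sum_i partial i phi x ^+ 2)).
move=> t _; rewrite lee_fin E mulrCA [leLHS]mulrC.
rewrite ler_wpM2l ?expR_ge0// /df exprMn mulrC ler_wpM2r ?sqr_ge0//.
exact: sqr_radial_derivative_le.
Qed.

End hardy_test_functions.

(** * Passage from test functions to [H10] *)

Section young.
Context d (T : measurableType d) {R : realType} (mu : {measure set T -> \bar R}).
Variables (D : set T) (mD : measurable D).
Implicit Types f g W : T -> R.

Lemma young_sqr (e a b : R) : 0 < e ->
  a ^+ 2 <= (1 + e) * b ^+ 2 + (1 + e^-1) * (b - a) ^+ 2.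
Proof.
move=> e0; rewrite -subr_ge0.
rewrite (_ : _ - _ = e * (b + (b - a) / e) ^+ 2); last by field; rewrite gt_eqF.
by rewrite mulr_ge0 ?sqr_ge0 ?ltW.
Qed.

(** A substitute for the triangle inequality that compares the integrals themselves. The bound [M]
    on the weight is essential, since the error is measured in the unweighted [L^2] distance. *)
Lemma ge0_integral_young (W f g : T -> R) (e M : R) : 0 < e -> 0 <= M ->
  measurable_fun D W -> (forall x, D x -> 0 <= W x <= M) ->
  measurable_fun D f -> measurable_fun D g ->
  (\int[mu]_(x in D) (W x * f x ^+ 2)%:E <=
   (1 + e)%:E * \int[mu]_(x in D) (W x * g x ^+ 2)%:E +
   ((1 + e^-1) * M)%:E * \int[mu]_(x in D) ((g x - f x) ^+ 2)%:E)%E.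
Proof.
move=> e0 M0 mW W0 mf mg.
have W0' x : D x -> 0 <= W x by move=> /W0 /andP[].
have c1 : 0 <= 1 + e by rewrite addr_ge0// ltW.
have c2 : 0 <= 1 + e^-1 by rewrite addr_ge0// invr_ge0 ltW.
have m1 : measurable_fun D (fun x => (W x * g x ^+ 2)%:E).
  by apply/measurable_EFinP; apply: measurable_funM => //; exact: measurable_funX.
have m2 : measurable_fun D (fun x => ((g x - f x) ^+ 2)%:E).
  by apply/measurable_EFinP; apply: measurable_funX; exact: measurable_funB.
rewrite -!ge0_integralZl//; first last.
- by move=> x Dx; rewrite lee_fin mulr_ge0 ?sqr_ge0 ?W0'.
- by rewrite lee_fin mulr_ge0.
- by move=> x _; rewrite lee_fin sqr_ge0.
rewrite -ge0_integralD//; first last.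
- exact: measurable_funeM.
- by move=> x _; rewrite -EFinM lee_fin mulr_ge0 ?sqr_ge0// mulr_ge0.
- exact: measurable_funeM.
- by move=> x Dx; rewrite -EFinM lee_fin mulr_ge0// mulr_ge0 ?sqr_ge0 ?W0'.
apply: ge0_le_integral => //.
- by move=> x Dx; rewrite lee_fin mulr_ge0 ?sqr_ge0 ?W0'.
- by apply/measurable_EFinP; apply: measurable_funM => //; exact: measurable_funX.
- by apply: emeasurable_funD; exact: measurable_funeM.
move=> x Dx; rewrite -!EFinM -EFinD lee_fin.
apply: (@le_trans _ _ (W x * ((1 + e) * g x ^+ 2 + (1 + e^-1) * (g x - f x) ^+ 2))).
  by rewrite ler_wpM2l ?W0'// young_sqr.
rewrite mulrDr mulrCA lerD2l mulrCA -mulrA ler_wpM2l// ler_wpM2r ?sqr_ge0//.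
by have /andP[] := W0 _ Dx.
Qed.

End young.

Section density.
Context {R : realType} (n : nat) (rho : R) (W : 'rV[R]_n -> R).
Local Notation leb := (lebesgue_rV R n).
Hypothesis W_ge0 : forall x, 0 <= W x.
Hypothesis W_meas : measurable_fun setT W.
Hypothesis ineq : forall phi, test_function (eball rho) phi ->
  (\int[leb]_x (W x * phi x ^+ 2)%:E <= \int[leb]_x (\sum_i partial i phi x ^+ 2)%:E)%E.

Lemma test_function_partial0 (phi : 'rV[R]_n -> R) (i : 'I_n) x : test_function (eball rho) phi ->
  ~ eball rho x -> partial i phi x = 0.
Proof.
move=> [_ _ sub] nx.
have nK : (~` closure [set x | phi x != 0]) x by move=> /sub.
have nb : nbhs x (~` closure [set x | phi x != 0]).
  by apply: open_nbhs_nbhs; split => //; exact/closed_openC/closed_closure.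
rewrite /partial (@near_eq_derive _ _ _ phi (cst 0)); first by rewrite derive_cst.
apply: filterS nb => y ny; apply/eqP/negPn/negP => phiy; apply: ny.
exact: subset_closure.
Qed.

Let ineq_eball phi : test_function (eball rho) phi ->
  (\int[leb]_(x in eball rho) (W x * phi x ^+ 2)%:E <=
   \sum_i \int[leb]_(x in eball rho) (partial i phi x ^+ 2)%:E)%E.
Proof.
move=> tphi; have [sphi _ _] := tphi.
have mphi : measurable_fun setT phi by apply: continuous_measurable_rV; exact: (sphi [::]).1.
have mdphi i : measurable_fun setT (partial i phi) by apply: continuous_measurable_rV; exact: (sphi [:: i]).1.
have mB := @measurable_eball R n rho.
rewrite -ge0_integral_sum//; first last.
- by move=> i x _; rewrite lee_fin sqr_ge0.
- by move=> i; apply/measurable_EFinP; apply: measurable_funTS; exact: measurable_funX.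
under [leRHS]eq_integral do rewrite sumEFin.
apply: (@le_trans _ _ (\int[leb]_x (W x * phi x ^+ 2)%:E)%E).
  apply: ge0_subset_integral => //.
  - by apply/measurable_EFinP; apply: measurable_funM => //; exact: measurable_funX.
  - by move=> x _; rewrite lee_fin mulr_ge0 ?sqr_ge0.
apply: (le_trans (ineq tphi)).
rewrite le_eqVlt; apply/orP; left; apply/eqP.
rewrite [RHS]integral_mkcond; apply: eq_integral => x _; rewrite patchE.
case: ifPn => // /negP; rewrite inE => nx.
by rewrite big1// => i _; rewrite (test_function_partial0 i tphi nx) expr0n.
Qed.

(* On the sets [F j] where [W <= j] the left side is continuous for the
   convergence in [L^2]; then [j] tends to infinity. *)
Lemma hardy_H10 u g : H10 (eball rho) u g ->
  (\int[leb]_(x in eball rho) (W x * u x ^+ 2)%:E <=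
   \int[leb]_(x in eball rho) (\sum_i g i x ^+ 2)%:E)%E.
Proof.
move=> [[[mu ufin] Lg _] [phi [tphi cu cg]]].
have mg i : measurable_fun (eball rho) (g i) by case: (Lg i).
have gfin i : (\int[leb]_(x in eball rho) (g i x ^+ 2)%:E < +oo)%E by case: (Lg i).
have mB := @measurable_eball R n rho.
have mphi k : measurable_fun (eball rho) (phi k).
  by apply: measurable_funTS; apply: continuous_measurable_rV; case: (tphi k) => s _ _; exact: (s [::]).1.
have mdphi i k : measurable_fun (eball rho) (partial i (phi k)).
  by apply: measurable_funTS; apply: continuous_measurable_rV; case: (tphi k) => s _ _; exact: (s [:: i]).1.
have mg2 i : measurable_fun (eball rho) (fun x => (g i x ^+ 2)%:E).
  by apply/measurable_EFinP; exact: measurable_funX.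
under [leRHS]eq_integral do rewrite -sumEFin.
rewrite ge0_integral_sum//; last by move=> i x _; rewrite lee_fin sqr_ge0.
set A := (\sum_i _)%E.
have A0 : (0 <= A)%E.
  by apply: sume_ge0 => i _; apply: integral_ge0 => x _; rewrite lee_fin sqr_ge0.
have Afin : A \is a fin_num by rewrite ge0_fin_numE// /A; apply: lte_sum_pinfty.
pose F (j : nat) := eball rho `&` [set x | W x <= j%:R].
have mF j : measurable (F j).
  apply: measurableI => //; rewrite -[X in measurable X]setTI.
  exact: (@measurable_fun_ler _ _ _ _ W (cst j%:R)).
(* Young's inequality is applied twice, to replace [u] by [phi k] and to replace [partial i (phi k)]
   by [g i]; hence the two factors [1 + e]. Only the first use carries the weight, bounded by [j] on
   [F j]. *)
have step (j k : nat) (e : R) : 0 < e ->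
  (\int[leb]_(x in F j) (W x * u x ^+ 2)%:E <=
   (1 + e)%:E * ((1 + e)%:E * A + (1 + e^-1)%:E * \sum_i \int[leb]_(x in eball rho) ((partial i (phi k) x - g i x) ^+ 2)%:E)
   + ((1 + e^-1) * j%:R)%:E * \int[leb]_(x in eball rho) ((phi k x - u x) ^+ 2)%:E)%E.
  move=> e0.
  have c1 : 0 <= 1 + e by rewrite addr_ge0// ltW.
  have c2 : 0 <= 1 + e^-1 by rewrite addr_ge0// invr_ge0 ltW.
  have sF : F j `<=` eball rho by move=> x [].
  apply: (le_trans (@ge0_integral_young _ _ _ leb (F j) (mF j) W u (phi k) e j%:R e0 _ _ _ _ _)) => //.
  - exact: measurable_funTS.
  - by move=> x [_ /= Wx]; rewrite W_ge0.
  - exact: measurable_funS mu.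
  - exact: measurable_funS (mphi k).
  apply: leeD.
    rewrite lee_wpmul2l ?lee_fin//.
    apply: (@le_trans _ _ (\int[leb]_(x in eball rho) (W x * phi k x ^+ 2)%:E)%E).
      apply: ge0_subset_integral => //.
      + apply/measurable_EFinP; apply: measurable_funM; last exact: measurable_funX.
        exact: measurable_funTS.
      + by move=> x _; rewrite lee_fin mulr_ge0 ?sqr_ge0.
    apply: (le_trans (ineq_eball (tphi k))).
    rewrite /A !ge0_sume_distrr; last 2 first.
    - by move=> i _; apply: integral_ge0 => x _; rewrite lee_fin sqr_ge0.
    - by move=> i _; apply: integral_ge0 => x _; rewrite lee_fin sqr_ge0.
    rewrite -big_split/=; apply: lee_sum => i _.
    have := @ge0_integral_young _ _ _ leb (eball rho) mB (cst 1) (partial i (phi k)) (g i) e 1 e0 ler01 (measurable_cst _).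
    rewrite mulr1 => Y.
    have {}Y := Y (fun x _ => ltac:(by rewrite /= ler01 lexx)) (mdphi i k) (mg i).
    move: Y; under eq_integral do rewrite mul1r.
    move=> Y; apply: (le_trans Y); apply: leeD.
      by under eq_integral do rewrite mul1r.
    rewrite lee_wpmul2l ?lee_fin//.
    rewrite le_eqVlt; apply/orP; left; apply/eqP; apply: eq_integral => x _; congr EFin.
    by rewrite -sqrrN opprB.
  rewrite lee_wpmul2l ?lee_fin ?mulr_ge0//.
  apply: ge0_subset_integral => //.
  + by apply/measurable_EFinP; apply: measurable_funX; exact: measurable_funB.
  + by move=> x _; rewrite lee_fin sqr_ge0.
have stepe (j : nat) (e : R) : 0 < e ->
  (\int[leb]_(x in F j) (W x * u x ^+ 2)%:E <= (1 + e)%:E * ((1 + e)%:E * A))%E.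
  move=> e0.
  have cv : ((1 + e)%:E * ((1 + e)%:E * A + (1 + e^-1)%:E * \sum_i \int[leb]_(x in eball rho) ((partial i (phi k) x - g i x) ^+ 2)%:E)
     + ((1 + e^-1) * j%:R)%:E * \int[leb]_(x in eball rho) ((phi k x - u x) ^+ 2)%:E)%E @[k --> \oo] -->
     ((1 + e)%:E * ((1 + e)%:E * A + (1 + e^-1)%:E * 0) + ((1 + e^-1) * j%:R)%:E * 0)%E.
    apply: cvgeD.
    - by rewrite mule0 fin_num_adde_defl.
    - apply: cvgeZl => //; apply: cvgeD.
      + by rewrite mule0 fin_num_adde_defl.
      + exact: cvg_cst.
      + apply: cvgeZl => //.
        have := @cvg_nnesum nat \oo _ R 'I_n (index_enum 'I_n) (fun i k =>
          \int[leb]_(x in eball rho) ((partial i (phi k) x - g i x) ^+ 2)%:E)%E (fun _ => 0%E) xpredT.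
        rewrite big1//; apply; last by move=> i _; exact: cg.
        by move=> i _; apply: nearW => k; apply: integral_ge0 => x _; rewrite lee_fin sqr_ge0.
    - by apply: cvgeZl.
  move: cv; rewrite !mule0 !adde0 => cv.
  by apply: (cvge_ge _ cv); apply: nearW => k; exact: step.
have stepA (j : nat) : (\int[leb]_(x in F j) (W x * u x ^+ 2)%:E <= A)%E.
  apply/lee_addgt0Pr => d d0.
  pose a := fine A; have a0 : 0 <= a by rewrite fine_ge0.
  (* For [e <= 1] one has [(1 + e)^2 <= 1 + 3 e], so the excess over [a] is at most [3 a e <= d]. *)
  pose e := Num.min 1 (d / (3 * a + 1)).
  have D0 : 0 < 3 * a + 1 by rewrite ltr_wpDl// mulr_ge0.
  have e0 : 0 < e by rewrite lt_min ltr01 divr_gt0.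
  apply: (le_trans (stepe j e e0)).
  rewrite -(fineK Afin) -/a -!EFinM -EFinD lee_fin.
  have e1 : e <= 1 by rewrite ge_min lexx.
  have ed : e * (3 * a + 1) <= d by rewrite -ler_pdivlMr// ge_min lexx orbT.
  have ee : e * e <= e by rewrite ger_pMr.
  have aee : a * (e * e) <= a * e by rewrite ler_wpM2l.
  nra.
have ndF : nondecreasing_seq F.
  move=> i j ij; apply/subsetPset => x [Bx /= Wx]; split => //=.
  by rewrite (le_trans Wx)// ler_nat.
have -> : eball rho = \bigcup_j F j.
  apply/seteqP; split => [x Bx|x [j _ []//]].
  exists (Num.truncn (W x)).+1 => //; split => //=.
  by rewrite ltW// truncnS_gt.
have cv : (\int[leb]_(x in F i) (W x * u x ^+ 2)%:E)%E @[i --> \oo] -->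
    (\int[leb]_(x in \bigcup_i F i) (W x * u x ^+ 2)%:E)%E.
  apply: ge0_nondecreasing_set_cvg_integral => //.
  - move=> i; apply/measurable_EFinP; apply: measurable_funM; first exact: measurable_funTS.
    by apply: measurable_funX; apply: measurable_funS mu => // x [].
  - by move=> i x _; rewrite lee_fin mulr_ge0 ?sqr_ge0.
by apply: (cvge_to_le cv); apply: nearW => i; exact: stepA.
Qed.

End density.

(** * Smooth steps and mollification *)

Section bump.
Context {R : realType}.
Local Notation mu := (@lebesgue_measure R).
Implicit Types (p : {poly R}) (j : nat) (x : R).

Definition bump p j x : R :=
  if `|x| < 1 then p.[x] / (1 - x ^+ 2) ^+ j * expR (- (1 - x ^+ 2)^-1) else 0.

(* All derivatives of [exp (- 1 / (1 - x^2))] have the form [bump p j]. *)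
Definition bump_step p j : {poly R} :=
  p^`() * (1%:P - 'X^2) ^+ 2 + ((2 * j%:R)%:P * 'X * (1%:P - 'X^2) - 2%:P * 'X) * p.

Lemma bump0 p j x : 1 <= `|x| -> bump p j x = 0.
Proof. by rewrite /bump ltNge => ->. Qed.

Lemma horner_bound p x : `|x| <= 1 -> `|p.[x]| <= \sum_(i < size p) `|p`_i|.
Proof.
move=> x1; rewrite horner_coef; apply: le_trans (ler_norm_sum _ _ _) _.
apply: ler_sum => i _; rewrite normrM normrX ler_piMr//.
exact: exprn_ile1.
Qed.

(** The number [expR w^-1] is the [j.+2]-th power of [expR (w * j.+2%:R)^-1], whose base is at least
    [(w * j.+2%:R)^-1]. The exponent exceeds [j] by two in order to leave the factor [w ^+ 2]. *)
Lemma exp_inv_bound (w : R) j : 0 < w ->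
  w ^- j * expR (- w^-1) <= j.+2%:R ^+ j.+2 * w ^+ 2.
Proof.
move=> w0; have N0 : 0 < j.+2%:R :> R by [].
have H : (w * j.+2%:R) ^- j.+2 <= expR w^-1.
  have -> : w^-1 = j.+2%:R * (w * j.+2%:R)^-1 by field; rewrite !gt_eqF.
  rewrite expRM_natl -exprVn lerXn2r ?nnegrE ?expR_ge0// ?invr_ge0 ?mulr_ge0 ?ltW//.
  by rewrite (lt_le_trans _ (expR_ge1Dx _))// ltrDr.
rewrite expRN ler_pdivrMr ?expR_gt0//.
apply: (@le_trans _ _ (j.+2%:R ^+ j.+2 * w ^+ 2 * (w * j.+2%:R) ^- j.+2)).
  rewrite le_eqVlt; apply/orP; left; apply/eqP.
  rewrite exprMn -[in w ^+ j.+2]addn2 exprD; field.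
  by rewrite !expf_neq0// gt_eqF.
by rewrite ler_wpM2l// mulr_ge0 ?exprn_ge0 ?ltW.
Qed.

(** Second-order vanishing at [|x| = 1] is what makes the function differentiable there. It comes
    from [1 - x^2 <= 2 (1 - |x|)], whose square is the origin of the [4]. *)
Lemma bump_bound p j : exists2 C, 0 <= C & forall x, `|bump p j x| <= C * (1 - `|x|) ^+ 2.
Proof.
pose M := \sum_(i < size p) `|p`_i|.
have M0 : 0 <= M by apply: sumr_ge0.
exists (M * (j.+2%:R ^+ j.+2 * 4)); first by rewrite mulr_ge0// mulr_ge0// exprn_ge0.
move=> x; rewrite /bump; case: ifPn => x1; last first.
  by rewrite normr0 mulr_ge0 ?sqr_ge0// mulr_ge0// mulr_ge0// exprn_ge0.
set w := 1 - x ^+ 2.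
have wE : w = (1 - `|x|) * (1 + `|x|) by rewrite /w -real_normK ?num_real//; ring.
have w0 : 0 < w by rewrite wE mulr_gt0 ?subr_gt0// ltr_pwDl.
have w2 : w <= 2 * (1 - `|x|) by rewrite wE mulrC ler_wpM2r ?subr_ge0 ?(ltW x1)//; lra.
rewrite -mulrA normrM -mulrA ler_pM ?normr_ge0 ?horner_bound ?(ltW x1)//.
rewrite ger0_norm ?mulr_ge0 ?invr_ge0 ?exprn_ge0 ?expR_ge0 ?(ltW w0)//.
apply: (le_trans (exp_inv_bound j w0)).
rewrite -[leRHS]mulrA ler_wpM2l ?exprn_ge0// (_ : 4 * _ = (2 * (1 - `|x|)) ^+ 2); last by ring.
by rewrite lerXn2r ?nnegrE ?(ltW w0)// (le_trans (ltW w0)).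
Qed.

Lemma is_derive_horner p x : is_derive x 1 (fun y => p.[y]) p^`().[x].
Proof.
elim/poly_ind: p => [|p c IH].
  rewrite deriv0 horner0 (_ : (fun _ => _) = cst 0); first exact: is_derive_cst.
  by apply/funext => y; rewrite horner0.
rewrite (_ : (fun y => _) = (fun y => p.[y] * y + c)); last first.
  by apply/funext => y; rewrite !hornerE.
rewrite derivD derivM derivX derivC addr0 mulr1 !hornerE.
have d1 : is_derive x 1 (fun y : R => p.[y] * y) (p^`().[x] * x + p.[x]).
  by apply: is_derive_mul IH (is_derive_id x 1) _; rewrite mulr1.
by apply: is_derive_add d1 (is_derive_cst c x 1) _; rewrite addr0.
Qed.

Lemma is_derive_bump p j x : is_derive x 1 (bump p j) (bump (bump_step p j) j.+2 x).
Proof.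
case: (ltrgtP `|x| 1) => x1.
- have w0 (y : R) : `|y| < 1 -> 0 < 1 - y ^+ 2.
    by move=> y1; rewrite subr_gt0 -real_normK ?num_real// expr_lt1.
  pose F (y : R) := p.[y] * ((1 - y ^+ 2) ^- j) * expR (- (1 - y ^+ 2)^-1).
  have nF : {near x, F =1 bump p j}.
    have : \forall y \near x, `|y| < 1.
      have /cvgr_lt := (@norm_continuous _ R^o x : `|y| @[y --> x] --> `|x|).
      exact.
    by apply: filterS => y y1; rewrite /bump y1.
  apply: (near_eq_is_derive nF); rewrite /bump x1.
  have wn0 : 1 - x ^+ 2 != 0 by rewrite gt_eqF// w0.
  have dw : is_derive x 1 (fun y : R => 1 - y ^+ 2) (- (2 * x)).
    have d2 : is_derive x 1 (fun y : R => (-1) * (y * y)) (- (2 * x)).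
      have d3 : is_derive x 1 (fun y : R => y * y) (1 * x + x * 1).
        exact: is_derive_mul (is_derive_id x 1) (is_derive_id x 1) (erefl _).
      by apply: is_derive_scale d3 _; ring.
    rewrite (_ : (fun y : R => 1 - y ^+ 2) = fun y => 1 + (-1) * (y * y)); last by apply/funext => y; ring.
    have d4 := @is_derive_add R (cst (1 : R)) _ x 0 _ _ (is_derive_cst (1 : R) x 1) d2 (erefl _).
    by rewrite add0r in d4; exact: d4.
  have dwV := @is_derive_inv R (fun y : R => 1 - y ^+ 2) x _ _ wn0 dw (erefl _).
  have dwVj k : is_derive x 1 (fun y : R => (1 - y ^+ 2) ^- k) (k%:R * (2 * x) / (1 - x ^+ 2) ^+ k.+1).
    elim: k => [|k IH].
      rewrite (_ : (fun y : R => _) = cst 1); last by apply/funext => y; rewrite expr0 invr1.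
      by rewrite !mul0r; exact: is_derive_cst.
    rewrite (_ : (fun y : R => _) = fun y => (1 - y ^+ 2)^-1 * (1 - y ^+ 2) ^- k); last first.
      by apply/funext => y; rewrite exprS invfM.
    apply: is_derive_mul dwV IH _; move: wn0; set w := 1 - x ^+ 2 => wn0.
    by rewrite -[in LHS]natr1 !exprS; field; rewrite wn0 ?expf_neq0.
  have dE : is_derive x 1 (fun y : R => expR (- (1 - y ^+ 2)^-1)) (- (2 * x) / (1 - x ^+ 2) ^+ 2 * expR (- (1 - x ^+ 2)^-1)).
    apply: (is_derive_comp (g := fun y : R => - (1 - y ^+ 2)^-1) (is_derive_expR _)).
    by rewrite !mulNr !opprK mulrN mulrC.
  apply: is_derive_mul (is_derive_mul (is_derive_horner p x) (dwVj j) (erefl _)) dE _.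
  rewrite /bump_step !(hornerD, hornerN, hornerM, hornerC, hornerX, hornerXn, horner_exp); move: wn0; set w := 1 - x ^+ 2 => wn0.
  by rewrite !exprS; field; rewrite wn0 ?expf_neq0.
- have nF : {near x, cst 0 =1 bump p j}.
    have : \forall y \near x, 1 < `|y|.
      have /cvgr_gt := (@norm_continuous _ R^o x : `|y| @[y --> x] --> `|x|).
      exact.
    by apply: filterS => y y1; rewrite bump0// ltW.
  by apply: (near_eq_is_derive nF); rewrite bump0 ?(ltW x1)//; exact: is_derive_cst.
(* At the edge the difference quotient is at most [C |h|], so the derivative is zero, in agreement
   with [bump0] for the next bump. *)
- rewrite [X in is_derive _ _ _ X]bump0 ?x1//; have [C C0 HC] := bump_bound p j.
  apply: is_derive_epsilon => e e0; exists (e / (C + 1)); first by rewrite divr_gt0// ltr_wpDl.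
  move=> h h0 hd; rewrite (bump0 _ _ (x := x)) ?x1// subr0 sub0r normrN normrM normfV.
  rewrite ler_pdivrMl ?normr_gt0//; apply: (le_trans (HC _)).
  have h1 : (1 - `|h + x|) ^+ 2 <= `|h| ^+ 2.
    rewrite -[leLHS]real_normK ?num_real// lerXn2r ?nnegrE//.
    by rewrite -x1 (le_trans (ler_dist_dist _ _))// distrC addrK.
  apply: (@le_trans _ _ ((C + 1) * `|h| ^+ 2)); first by rewrite ler_pM ?sqr_ge0// lerDl.
  by rewrite expr2 mulrCA ler_wpM2l// mulrC -ler_pdivlMr ?ltr_wpDl// ltW.
Qed.

Let P (k : nat) : {poly R} := iteri k (fun k p => bump_step p k.*2) 1.

(** The [k]-th derivative of [exp (- 1 / (1 - x^2))]; each derivation raises the exponent of the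
    denominator by two. *)
Definition std_bump (k : nat) : R -> R := bump (P k) k.*2.

Lemma is_derive_std_bump k x : is_derive x 1 (std_bump k) (std_bump k.+1 x).
Proof. exact: is_derive_bump. Qed.

Lemma std_bump_eq0 k x : 1 <= `|x| -> std_bump k x = 0.
Proof. exact: bump0. Qed.

Lemma std_bump_ge0 x : 0 <= std_bump 0 x.
Proof.
rewrite /std_bump /bump; case: ifP => // _.
by rewrite /P /= hornerE expr0 divr1 mul1r expR_ge0.
Qed.

Let cb k : continuous (std_bump k).
Proof. by move=> x; exact: is_derive_continuous (is_derive_std_bump k x). Qed.

(** The lower limit lies strictly to the left of the support, so that the fundamental theorem of
    calculus applies at every [x >= -1]. *)
Let F (x : R) := \int[mu]_(t in `[-2, x]) std_bump 0 t.

Let F_low x : x <= -1 -> F x = 0.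
Proof.
move=> x1; rewrite /F /Rintegral integral0_eq// => t; rewrite /= in_itv/= => /andP[t2 tx].
by rewrite std_bump_eq0// ler_normr; apply/orP; right; lra.
Qed.

Let dF x : is_derive x 1 F (std_bump 0 x).
Proof.
case: (ltP x (-1)) => x1.
  have nF : {near x, cst 0 =1 F}.
    have : \forall y \near x, y < -1 by exact: lt_nbhsl.
    by apply: filterS => y y1; rewrite F_low// ltW.
  apply: (near_eq_is_derive nF); rewrite std_bump_eq0; first exact: is_derive_cst.
  by rewrite ler_normr; apply/orP; right; lra.
have xx1 : x < x + 1 by rewrite ltrDl.
have x2 : -2 < x by lra.
have ib : mu.-integrable `[-2, x + 1] (EFin \o std_bump 0).
  apply: continuous_compact_integrable; first exact: segment_compact.
  exact: continuous_subspaceT.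
have [dFx F'] := continuous_FTC1_closed xx1 ib x2 (cb (x := x)).
by apply: DeriveDef; [exact: dFx|rewrite -derive1E].
Qed.

(** If [F 1] were zero, the monotone [F] would vanish on [[-2, 1]], and the mean value theorem would
    give a zero of the bump inside its support. *)
Let F_pos : 0 < F 1.
Proof.
have FE : {in `[-2, 1], forall x, 0 <= F x} by move=> x _; apply: Rintegral_ge0 => t _; exact: std_bump_ge0.
rewrite lt_def FE ?andbT; last by rewrite in_itv/= lexx andbT; lra.
apply/negP => /eqP F1.
have cF : continuous F by move=> x; exact: is_derive_continuous (dF x).
have mono (a b : R) : a <= b -> F a <= F b.
  move=> ab; have [c _ E] := MVT_segment ab (fun x _ => dF x) (continuous_subspaceT cF).
  by rewrite -subr_ge0 E mulr_ge0 ?std_bump_ge0 ?subr_ge0.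
have hh : (-2^-1 : R) < 2^-1 by rewrite gtrN.
have [c] := MVT hh (fun x _ => dF x) (continuous_subspaceT cF).
rewrite in_itv/= => /andP[c1 c2].
have z a : -2 <= a -> a <= 1 -> F a = 0.
  move=> a1 a2; apply/eqP; rewrite eq_le -{1}F1 mono// FE// in_itv/= a1 a2//.
rewrite !z ?subrr; [|lra..]; move/esym/eqP; rewrite mulf_eq0 => /orP[|]; last by rewrite gt_eqF//; lra.
have c3 : `|c| < 1 by rewrite ltr_norml; apply/andP; split; lra.
by rewrite /std_bump /bump c3 /P /= hornerE expr0 divr1 mul1r expR_eq0.
Qed.

(** The primitive of the standard bump divided by its total mass. Smoothness is carried by the whole
    sequence of derivatives, so the mollified and radial functions built from it are again indexed
    by the order of derivation. *)
Lemma smooth_step : exists th : nat -> R -> R,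
  [/\ forall k (x : R), is_derive x 1 (th k) (th k.+1 x),
      forall x, x <= -1 -> th 0%N x = 0,
      forall x, 1 <= x -> th 0%N x = 1,
      forall k x, 1 <= `|x| -> th k.+1 x = 0 &
      forall x, 0 <= th 1%N x].
Proof.
pose c := (F 1)^-1.
exists (fun k x => if k is k'.+1 then c * std_bump k' x else c * F x).
have cF : continuous F by move=> x; exact: is_derive_continuous (dF x).
split=> [[|k] x|x x1|x x1|k x x1|x].
- exact: is_derive_scale (dF x) (erefl _).
- exact: is_derive_scale (is_derive_std_bump k x) (erefl _).
- by rewrite F_low ?mulr0.
- suff E : F x = F 1 by rewrite E /c mulVf// gt_eqF.
  have [d] := MVT_segment x1 (fun y _ => dF y) (continuous_subspaceT cF).
  rewrite in_itv/= => /andP[d1 _]; rewrite std_bump_eq0 ?mul0r => [/eqP|].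
    by rewrite subr_eq0 => /eqP.
  by rewrite (le_trans d1)// ler_norm.
- by rewrite std_bump_eq0// mulr0.
- by rewrite mulr_ge0 ?std_bump_ge0// invr_ge0 ltW.
Qed.

End bump.

Lemma bounded_integrable_itv (R : realType) (f : R -> R) (C : R) (a' b' : R) : measurable_fun setT f ->
  (forall x, x \in `[a', b'] -> `|f x| <= C) -> lebesgue_measure.-integrable `[a', b'] (EFin \o f).
Proof.
move=> mf fC; apply/integrableP; split.
  by apply/measurable_EFinP; exact: measurable_funTS.
apply: (@le_lt_trans _ _ (\int[lebesgue_measure]_(x in `[a', b']) (cst C%:E x))%E).
  apply: ge0_le_integral => //.
  - by apply: measurableT_comp => //; apply/measurable_EFinP; exact: measurable_funTS.
rewrite integral_cst//= lebesgue_measure_itv/=.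
by case: ifP => _; rewrite ?mule0 ?ltry// -EFinB -EFinM ltry.
Qed.

Section mollifier.
Context {R : realType}.
Local Notation mu := (@lebesgue_measure R).
Variable th : nat -> R -> R.
Hypothesis dth : forall k (x : R), is_derive x 1 (th k) (th k.+1 x).
Hypothesis th_low : forall x, x <= -1 -> th 0%N x = 0.
Hypothesis th_high : forall x, 1 <= x -> th 0%N x = 1.
Hypothesis th_out : forall k x, 1 <= `|x| -> th k.+1 x = 0.
Hypothesis th1_ge0 : forall x, 0 <= th 1%N x.

Let cth k : continuous (th k).
Proof. by move=> x; exact: is_derive_continuous (dth k x). Qed.

Lemma smooth_step_bounded k : exists2 C, 0 <= C & forall x, `|th k x| <= C.
Proof.
have cf : {within `[-1, 1], continuous (th k)} by exact: continuous_subspaceT.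
have /compact_bounded[M [Mr HM]] := continuous_compact cf (@segment_compact _ (-1) 1).
pose C := Num.max (M + 1) 1.
exists C; first by rewrite le_max ler01 orbT.
move=> x; case: (boolP (x \in `[-1, 1])) => xI.
  by rewrite le_max HM//; rewrite ltrDl.
rewrite le_max; apply/orP; right.
case: k cf HM => [|k] _ _.
  case: (leP x (-1)) => x1; first by rewrite th_low// normr0.
  rewrite th_high ?normr1//; move: xI; rewrite in_itv/= (ltW x1)/= -ltNge; exact: ltW.
rewrite th_out ?normr0// ler_normr.
by move: xI; rewrite in_itv/= negb_and -!ltNge => /orP[] /ltW h; apply/orP; [right|left]; lra.
Qed.

Lemma smooth_step_mono (x y : R) : x <= y -> th 0%N x <= th 0%N y.
Proof.
move=> xy; have [c _ E] := MVT_segment xy (fun z _ => dth 0 z) (continuous_subspaceT (cth (k := 0%N))).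
by rewrite -subr_ge0 E mulr_ge0 ?subr_ge0.
Qed.

Lemma smooth_step_itv x : 0 <= th 0%N x <= 1.
Proof.
apply/andP; split.
  case: (leP x (-1)) => x1; first by rewrite th_low.
  by rewrite -(th_low (lexx (-1))) smooth_step_mono// ltW.
case: (leP 1 x) => x1; first by rewrite th_high.
by rewrite -(th_high (lexx 1)) smooth_step_mono// ltW.
Qed.

Variables (a b e M : R) (g : R -> R).
Hypothesis ab : a <= b.
Hypothesis e0 : 0 < e.
Hypothesis mg : measurable_fun setT g.
Hypothesis gM : forall x, `|g x| <= M.

Let M0 : 0 <= M.
Proof. exact: le_trans (gM 0). Qed.

(** The step [th 0] replaces the indicator of [s <= x], so order [0] is a smooth version of the
    primitive of [g] from [a]. Order [k] is its [k]-th derivative, the factor [e ^- k] being due to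
    the chain rule; order [1] is a convolution of [g]. *)
Definition mollified (k : nat) (x : R) : R :=
  e ^- k * \int[mu]_(s in `[a, b]) (g s * th k ((x - s) / e)).

Let mth k (x : R) : measurable_fun setT (fun s : R => th k ((x - s) / e)).
Proof.
apply: (@measurableT_comp _ _ _ _ _ _ (th k)); first exact: continuous_measurable_fun.
by apply: measurable_funM => //; exact: measurable_funB.
Qed.

Let int_gth k x : mu.-integrable `[a, b] (EFin \o (fun s => g s * th k ((x - s) / e))).
Proof.
have [C C0 HC] := smooth_step_bounded k.
apply: (@bounded_integrable_itv _ _ (M * C)); first exact: measurable_funM.
by move=> s _; rewrite normrM ler_pM.
Qed.

Lemma is_derive_mollified k (x : R) : is_derive x 1 (mollified k) (mollified k.+1 x).
Proof.
pose f (x s : R) := g s * th k ((x - s) / e).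
have dfs (x' s : R) : is_derive x' 1 (f ^~ s) (g s * (th k.+1 ((x' - s) / e) / e)).
  have d1 : is_derive x' 1 (fun x : R => (x - s) / e) e^-1.
    apply: (@is_derive_mul R (fun x => x - s) (fun=> e^-1) x' 1 0).
    - by apply: is_derive_add (is_derive_id x' 1) (is_derive_cst (- s) x' 1) _; rewrite addr0.
    - by rewrite mulr0 addr0 mul1r.
  have d2 := @is_derive_comp R (th k) (fun x => (x - s) / e) x' _ _ _ (dth k ((x' - s) / e)) d1 (erefl _).
  exact: is_derive_scale d2 (erefl _).
have pE (x' s : R) : partial1of2 f x' s = g s * (th k.+1 ((x' - s) / e) / e).
  by rewrite partial1of2E; have [_ ->] := dfs x' s.
have [C C0 HC] := smooth_step_bounded k.+1.
have xI : `]x - 1, x + 1[%classic x by rewrite /= in_itv/= gtrBl ltr01 ltrDl ltr01.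
have G0 (s : R) : 0 <= cst (M * (C / e)) s by rewrite /= mulr_ge0// divr_ge0// ltW.
have iG : mu.-integrable `[a, b] (EFin \o cst (M * (C / e))).
  by apply: (@bounded_integrable_itv _ _ `|M * (C / e)|).
have Gub (x' s : R) : `]x - 1, x + 1[%classic x' -> `[a, b]%classic s -> `|partial1of2 f x' s| <= cst (M * (C / e)) s.
  move=> _ _; rewrite pE normrM ler_pM// normrM normfV (gtr0_norm e0).
  by rewrite ler_wpM2r// invr_ge0 ltW.
have intf (x' : R) : `]x - 1, x + 1[%classic x' -> mu.-integrable `[a, b] (EFin \o f x').
  by move=> _; exact: int_gth.
have derf (x' s : R) : `]x - 1, x + 1[%classic x' -> `[a, b]%classic s -> derivable (f ^~ s) x' 1.
  by move=> _ _; case: (dfs x' s).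
have D := @derivable_under_integral R _ _ mu f _ (measurable_itv `[a, b]) x (x - 1) (x + 1) xI intf derf _ G0 iG Gub.
have E := @differentiation_under_integral R _ _ mu f _ (measurable_itv `[a, b]) x (x - 1) (x + 1) xI intf derf _ G0 iG Gub.
have dF : is_derive x 1 (fun x : R => \int[mu]_(s in `[a, b]) f x s)
   (e^-1 * \int[mu]_(s in `[a, b]) (g s * th k.+1 ((x - s) / e))).
  apply: DeriveDef; first exact: D.
  rewrite -derive1E E -RintegralZl//.
  by apply: eq_Rintegral => s _; rewrite pE; ring.
rewrite /mollified; apply: is_derive_scale dF _.
by rewrite mulrA exprS invfM [e^-1 * _]mulrC.
Qed.

Lemma continuous_mollified k : continuous (mollified k).
Proof. by move=> x; exact: is_derive_continuous (is_derive_mollified k x). Qed.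

Lemma mollified_low k x : x <= a - e -> mollified k x = 0.
Proof.
move=> xa; rewrite /mollified /Rintegral integral0_eq ?mulr0// => s; rewrite /= in_itv/= => /andP[sa _].
have h : (x - s) / e <= -1 by rewrite ler_pdivrMr//; lra.
case: k => [|k]; first by rewrite th_low ?mulr0.
by rewrite th_out ?mulr0// ler_normr; apply/orP; right; lra.
Qed.

Hypothesis int_g : \int[mu]_(s in `[a, b]) g s = 0.

(** Here the vanishing mean of [g] yields compact support: right of [b + e] the step is identically
    one on [[a, b]]. *)
Lemma mollified_high k x : b + e <= x -> mollified k x = 0.
Proof.
move=> xb.
have h s : s \in `[a, b] -> 1 <= (x - s) / e.
  by rewrite in_itv/= => /andP[_ sb]; rewrite ler_pdivlMr//; lra.
rewrite /mollified; case: k => [|k].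
  rewrite (_ : \int[mu]_(s in _) _ = 0) ?mulr0// -int_g; apply: eq_Rintegral => s.
  by rewrite mem_setE => sab; rewrite th_high ?mulr1// h.
rewrite /Rintegral integral0_eq ?mulr0// => s sab.
by rewrite th_out ?mulr0// ler_normr h.
Qed.

(** The smooth and the sharp step differ only for [s] within [e] of [x], a set of length [2 * e],
    and there by at most one. *)
Lemma mollified_dist x :
  `|mollified 0 x - \int[mu]_(s in `[a, b]) (g s * (s <= x)%R%:R)| <= 2 * M * e.
Proof.
rewrite /mollified expr0 invr1 mul1r.
have mind : measurable_fun setT (fun s : R => (s <= x)%R%:R : R).
  apply: (@measurableT_comp _ _ _ _ _ _ (fun b : bool => b%:R : R)) => //.
  exact: measurable_fun_ler.
have iind : mu.-integrable `[a, b] (EFin \o (fun s => g s * (s <= x)%R%:R)).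
  apply: (@bounded_integrable_itv _ _ M); first exact: measurable_funM.
  by move=> s _; rewrite normrM; case: (s <= x)%R; rewrite ?normr1 ?normr0 ?mulr1 ?mulr0.
rewrite -RintegralB//.
apply: (le_trans (le_normr_Rintegral _ _)) => //.
  by apply: integrableB_EFin => //; exact: int_gth.
pose ind (s : R) : R := \1_(`[x - e, x + e]%classic : set R) s.
have e0' := e0.
have Dle s : `|g s * th 0%N ((x - s) / e) - g s * (s <= x)%R%:R| <= M * ind s.
  rewrite -mulrBr normrM /ind indicE mem_setE in_itv/=.
  case: (leP (x - e) s) => s1 /=; last first.
    rewrite th_high; last by rewrite ler_pdivlMr//; lra.
    by rewrite (_ : (s <= x)%R = true) ?subrr ?normr0 ?mulr0//; apply/idP; lra.
  case: (leP s (x + e)) => s2 /=; last first.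
    rewrite th_low; last by rewrite ler_pdivrMr//; lra.
    by rewrite (_ : (s <= x)%R = false) ?subrr ?normr0 ?mulr0//; apply/negbTE; rewrite -ltNge; lra.
  rewrite ler_pM//; have /andP[t0 t1] := smooth_step_itv ((x - s) / e).
  by rewrite ler_norml; case: (s <= x)%R; rewrite ?mulr1n ?mulr0n; apply/andP; split; lra.
have mD : measurable_fun setT (fun s => `|g s * th 0%N ((x - s) / e) - g s * (s <= x)%R%:R|).
  apply: measurableT_comp => //; apply: measurable_funB; exact: measurable_funM.
rewrite -lee_fin /Rintegral fineK; last first.
  apply: integrable_fin_num => //; apply: (@bounded_integrable_itv _ _ M) => // s _.
  rewrite normr_id (le_trans (Dle s))// ler_piMr// /ind indicE.
  by case: (_ \in _).
apply: (@le_trans _ _ (\int[mu]_s (M * ind s)%:E)%E).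
  apply: (@le_trans _ _ (\int[mu]_s (`|g s * th 0%N ((x - s) / e) - g s * (s <= x)%R%:R|)%:E)%E).
    apply: ge0_subset_integral => //; exact/measurable_EFinP.
  apply: ge0_le_integral => //.
  - exact/measurable_EFinP.
  - by apply/measurable_EFinP; apply: measurable_funM => //; exact: measurable_indic.
  - by move=> s _; rewrite lee_fin.
under eq_integral do rewrite EFinM.
rewrite ge0_integralZl//; last 2 first.
- by apply/measurable_EFinP; exact: measurable_indic.
- by move=> s _; rewrite lee_fin /ind indicE.
rewrite /ind integral_indic// setIT.
have mE : mu `[x - e, x + e]%classic = (2 * e)%:E.
  rewrite lebesgue_measure_itv/= lte_fin ltrD2l gtrN// -EFinB; congr EFin; ring.
rewrite (_ : (2 * M * e)%:E = M%:E * (2 * e)%:E)%E; last by rewrite -EFinM mulrCA mulrA.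
by apply: lee_wpmul2l; [rewrite lee_fin|rewrite -mE].
Qed.

Let kernel (x s : R) := th 1%N ((x - s) / e) / e.

Let kernel_ge0 x s : 0 <= kernel x s.
Proof. by rewrite divr_ge0// ltW. Qed.

Let mkernel : measurable_fun setT (fun p : R * R => kernel p.1 p.2).
Proof.
apply: measurable_funM => //.
apply: (@measurableT_comp _ _ _ _ _ _ (th 1%N)); first exact: continuous_measurable_fun.
by apply: measurable_funM => //; apply: measurable_funB; [exact: measurable_fst|exact: measurable_snd].
Qed.

Let int_kernel_s x : (\int[mu]_(s in `[a, b]) (kernel x s)%:E <= 1)%E.
Proof.
have ck : {within `[a, b], continuous (kernel x)}.
  apply: continuous_subspaceT => s; apply: cvgM; last exact: cvg_cst.
  apply: (@continuous_comp _ _ _ (fun s => (x - s) / e) (th 1%N)); last exact: cth.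
  by apply: cvgM; [apply: cvgB; [exact: cvg_cst|exact: cvg_id]|exact: cvg_cst].
have dk (s : R) : s \in `[a, b] -> is_derive s 1 (fun s => - th 0%N ((x - s) / e)) (kernel x s).
  move=> _.
  have d1 : is_derive s 1 (fun s : R => (x - s) / e) (- e^-1).
    apply: (@is_derive_mul R (fun s => x - s) (fun=> e^-1) s (-1) 0).
    - have d0 : is_derive s 1 (fun s : R => -1 * s) (-1).
        by apply: is_derive_scale (is_derive_id s 1) _; rewrite mulr1.
      rewrite (_ : (fun s : R => x - s) = (fun s => x + -1 * s)); last by apply/funext => t; rewrite mulN1r.
      have d4 := @is_derive_add R (cst x) _ s 0 _ _ (is_derive_cst x s 1) d0 (erefl _).
      by rewrite add0r in d4; exact: d4.
    - by rewrite mulr0 addr0 mulN1r.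
  have d2 := @is_derive_comp R (th 0%N) (fun s => (x - s) / e) s _ _ _ (dth 0 ((x - s) / e)) d1 (erefl _).
  rewrite (_ : (fun s : R => - th 0%N ((x - s) / e)) = (fun s => -1 * th 0%N ((x - s) / e))); last by apply/funext => t; rewrite mulN1r.
  by apply: is_derive_scale d2 _; rewrite /kernel; ring.
have [ik Ek] := antiderivative_onC1 ab dk ck.
rewrite -[leLHS]fineK ?integrable_fin_num// lee_fin -/(Rintegral _ _ _) -Ek ?in_itv/= ?lexx ?ab//.
have /andP[t0 t1] := smooth_step_itv ((x - b) / e).
have /andP[t2 t3] := smooth_step_itv ((x - a) / e).
lra.
Qed.

Let int_kernel_x s : (\int[mu]_x (kernel x s)%:E <= 1)%E.
Proof.
have ck : {within `[s - e, s + e], continuous (kernel ^~ s)}.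
  apply: continuous_subspaceT => x; apply: cvgM; last exact: cvg_cst.
  apply: (@continuous_comp _ _ _ (fun x => (x - s) / e) (th 1%N)); last exact: cth.
  by apply: cvgM; [apply: cvgB; [exact: cvg_id|exact: cvg_cst]|exact: cvg_cst].
have dk (x : R) : x \in `[s - e, s + e] -> is_derive x 1 (fun x => th 0%N ((x - s) / e)) (kernel x s).
  move=> _.
  have d1 : is_derive x 1 (fun x : R => (x - s) / e) e^-1.
    apply: (@is_derive_mul R (fun x => x - s) (fun=> e^-1) x 1 0).
    - by apply: is_derive_add (is_derive_id x 1) (is_derive_cst (- s) x 1) _; rewrite addr0.
    - by rewrite mulr0 addr0 mul1r.
  exact: @is_derive_comp R (th 0%N) (fun x => (x - s) / e) x _ _ _ (dth 0 ((x - s) / e)) d1 (erefl _).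
have se : s - e <= s + e by rewrite lerD2l ge0_cp// ltW.
have [ik Ek] := antiderivative_onC1 se dk ck.
have -> : (\int[mu]_x (kernel x s)%:E = \int[mu]_(x in `[(s - e)%R, (s + e)%R]) (kernel x s)%:E)%E.
  rewrite [RHS]integral_mkcond; apply: eq_integral => x _; rewrite patchE mem_setE in_itv/=.
  case: ifPn => // /negP xI; rewrite /kernel th_out ?mul0r// leNgt; apply/negP => x1; apply: xI.
  move: x1; rewrite ltr_norml => /andP[]; rewrite ltr_pdivlMr// ltr_pdivrMr// => h1 h2.
  by apply/andP; split; lra.
rewrite -[leLHS]fineK ?integrable_fin_num// lee_fin -/(Rintegral _ _ _) -Ek ?in_itv/= ?lexx ?se//.
have /andP[t0 t1] := smooth_step_itv ((s + e - s) / e).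
have /andP[t2 t3] := smooth_step_itv ((s - e - s) / e).
lra.
Qed.

(** Jensen's inequality for a kernel of mass at most one: expand the integral of [(g - c)^2] against
    the kernel, where [c] is the integral of [g] against it. *)
Lemma mollified1_sqr x :
  ((mollified 1 x ^+ 2)%:E <= \int[mu]_(s in `[a, b]) (g s ^+ 2 * kernel x s)%:E)%E.
Proof.
set c := mollified 1 x.
have fin (c' X Y : R) : 0 <= X - 2 * c' * c' + c' ^+ 2 * Y -> 0 <= c' ^+ 2 -> c' ^+ 2 * Y <= c' ^+ 2 -> c' ^+ 2 <= X by lra.
have [C C0 HC] := smooth_step_bounded 1.
have mk : measurable_fun setT (kernel x) by apply: measurable_funM => //; exact: mth.
have Ck s : `|kernel x s| <= C / e.
  by rewrite normrM normfV (gtr0_norm e0) ler_wpM2r// invr_ge0 ltW.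
have Ce0 : 0 <= C / e by rewrite divr_ge0// ltW.
have ik : mu.-integrable `[a, b] (EFin \o kernel x) by exact: (@bounded_integrable_itv _ _ (C / e)).
have igk : mu.-integrable `[a, b] (EFin \o (fun s => g s * kernel x s)).
  apply: (@bounded_integrable_itv _ _ (M * (C / e))); first exact: measurable_funM.
  by move=> s _; rewrite normrM ler_pM.
have iggk : mu.-integrable `[a, b] (EFin \o (fun s => g s ^+ 2 * kernel x s)).
  apply: (@bounded_integrable_itv _ _ (M ^+ 2 * (C / e))).
    by apply: measurable_funM => //; exact: measurable_funX.
  by move=> s _; rewrite normrM ler_pM// normrX lerXn2r ?nnegrE.
have cE : c = \int[mu]_(s in `[a, b]) (g s * kernel x s).
  rewrite /c /mollified expr1 -RintegralZl//.
  by apply: eq_Rintegral => s _; rewrite /kernel; ring.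
have k1 : \int[mu]_(s in `[a, b]) (kernel x s) <= 1.
  by rewrite -lee_fin /Rintegral fineK ?integrable_fin_num// int_kernel_s.
have : 0 <= \int[mu]_(s in `[a, b]) (g s ^+ 2 * kernel x s - 2 * c * (g s * kernel x s) + c ^+ 2 * kernel x s).
  apply: Rintegral_ge0 => s _.
  rewrite (_ : _ + _ = (g s - c) ^+ 2 * kernel x s); last by ring.
  by rewrite mulr_ge0 ?sqr_ge0.
have i2 : mu.-integrable `[a, b] (EFin \o (fun s => 2 * c * (g s * kernel x s))) by exact: integrableZ_EFin.
have i3 : mu.-integrable `[a, b] (EFin \o (fun s => c ^+ 2 * kernel x s)) by exact: integrableZ_EFin.
rewrite RintegralD//; last exact: integrableB_EFin.
rewrite RintegralB// !RintegralZl// -cE => H.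
rewrite -[leRHS]fineK ?integrable_fin_num// lee_fin -/(Rintegral _ _ _).
have c20 := sqr_ge0 c.
have : c ^+ 2 * \int[mu]_(s in `[a, b]) (kernel x s) <= c ^+ 2 by rewrite ler_piMr.
move: H c20; exact: fin.
Qed.

(** Smoothing does not increase the energy: Jensen at each point, then Tonelli and the mass of the
    kernel in the other variable. *)
Lemma integral_mollified1_sqr :
  (\int[mu]_x (mollified 1 x ^+ 2)%:E <= \int[mu]_(s in `[a, b]) (g s ^+ 2)%:E)%E.
Proof.
pose G : R -> R := (fun s => g s ^+ 2) \_ `[a, b].
have mG : measurable_fun setT G.
  by apply/(measurable_restrictT _ _).1 => //; apply: measurable_funTS; exact: measurable_funX.
have G0 s : 0 <= G s by rewrite /G patchE; case: ifP => // _; exact: sqr_ge0.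
pose F (p : R * R) : \bar R := (G p.2 * kernel p.1 p.2)%:E.
have mF : measurable_fun setT F.
  apply/measurable_EFinP; apply: measurable_funM => //.
  by apply: (measurableT_comp mG); exact: measurable_snd.
have F0 p : (0 <= F p)%E by rewrite lee_fin mulr_ge0.
apply: (@le_trans _ _ (\int[mu]_x \int[mu]_s F (x, s))%E).
  apply: ge0_le_integral => //.
  - by move=> x _; rewrite lee_fin sqr_ge0.
  - apply/measurable_EFinP; apply: measurable_funX; apply: continuous_measurable_fun.
    exact: continuous_mollified.
  - exact: (@measurable_fun_fubini_tonelli_F _ _ _ _ _ mu F).
  - move=> x _; apply: (le_trans (mollified1_sqr x)).
    rewrite le_eqVlt; apply/orP; left; apply/eqP.
    rewrite integral_mkcond; apply: eq_integral => s _; rewrite /F /G /= !patchE.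
    by case: ifP => // _; rewrite mul0r.
have -> : (\int[mu]_x \int[mu]_s F (x, s) = \int[mu]_s \int[mu]_x F (x, s))%E.
  exact: (@fubini_tonelli _ _ _ _ _ mu mu F).
rewrite [leRHS]integral_mkcond.
apply: ge0_le_integral => //.
- by move=> s _; exact: integral_ge0.
- exact: (@measurable_fun_fubini_tonelli_G _ _ _ _ _ mu F).
- by apply/(measurable_restrictT _ _).1 => //; apply/measurable_EFinP; apply: measurable_funTS; exact: measurable_funX.
move=> s _; rewrite /F /=; under eq_integral do rewrite EFinM.
have mks : measurable_fun setT (fun x : R => kernel x s).
  exact: (measurableT_comp mkernel (measurable_pair2 s)).
rewrite ge0_integralZl//; [|exact/measurable_EFinP|by move=> x _; rewrite lee_fin|by rewrite lee_fin].
apply: (@le_trans _ _ ((G s)%:E * 1)%E).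
  by apply: lee_wpmul2l; [rewrite lee_fin|exact: int_kernel_x].
by rewrite mule1 /G !patchE; case: ifP.
Qed.

End mollifier.

(** * Radial test functions *)

Lemma is_derive_linear (R : realType) (c x : R) : is_derive x 1 (fun h : R => c * h) c.
Proof. exact: (@is_derive_scale R c (fun h => h) x 1 c (is_derive_id x 1) (esym (mulr1 c))). Qed.

Lemma is_derive_affine_fun (R : realType) (d c x : R) : is_derive x 1 (fun h : R => d + c * h) c.
Proof.
exact: (@is_derive_add R (cst d) _ x 0 c c (is_derive_cst d x (1 : R)) (is_derive_linear c x) (esym (add0r c))).
Qed.

Section smooth_radial.
Context {R : realType} {n : nat}.
Variable k : nat -> R -> R.
Variables A B : R.
Hypothesis dk : forall j (x : R), is_derive x 1 (k j) (k j.+1 x).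
Hypothesis k_low : forall j x, x <= A -> k j x = 0.
Hypothesis k_high : forall j x, B <= x -> k j x = 0.

(** At [s = r ^+ 2] with [r > 0] this is [r^c * k j (ln r)]. The squared radius is the variable
    because [enorm x ^+ 2] is a polynomial in the coordinates, so that derivatives stay explicit. *)
Definition log_profile (c : R) (j : nat) (s : R) : R :=
  if 0 < s then expR (c / 2 * ln s) * k j (ln s / 2) else 0.

Lemma log_profile0 c j s : s <= expR (2 * A) -> log_profile c j s = 0.
Proof.
move=> sA; rewrite /log_profile; case: ifP => // s0.
rewrite k_low ?mulr0// ler_pdivrMr// mulrC -[leRHS]expRK ler_ln// ?posrE ?expR_gt0//.
Qed.

Lemma is_derive_log_profile c j (s : R) : is_derive s 1 (log_profile c j)
  (2^-1 * (c * log_profile (c - 2) j s + log_profile (c - 2) j.+1 s)).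
Proof.
have [s0|s0] := ltP 0 s; last first.
  (* For [s <= 0] the profile vanishes on a whole neighbourhood, since [expR (2 * A)] is
     positive. *)
  have sA : s < expR (2 * A) by apply: le_lt_trans s0 _; exact: expR_gt0.
  rewrite !log_profile0 ?(ltW sA)// mulr0 addr0 mulr0.
  apply: (@near_eq_is_derive _ _ _ (cst 0)).
  by near=> t; rewrite log_profile0//; near: t; exact: lt_le_nbhsl.
have dl : is_derive s 1 (fun s : R => ln s) s^-1 by exact: is_derive1_ln.
have d1 : is_derive s 1 (fun s : R => expR (c / 2 * ln s)) (expR (c / 2 * ln s) * (c / 2 * s^-1)).
  apply: (@is_derive_comp R expR (fun s => c / 2 * ln s) s _ _ _ (is_derive_expR _)); last reflexivity.
have d2 : is_derive s 1 (fun s : R => k j (ln s / 2)) (k j.+1 (ln s / 2) * (2^-1 * s^-1)).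
  have dl2 : is_derive s 1 (fun s : R => ln s / 2) (2^-1 * s^-1).
    rewrite (_ : (fun s : R => ln s / 2) = (fun s => 2^-1 * ln s)); last by apply/funext => t; rewrite mulrC.
    exact: (@is_derive_scale R 2^-1 _ s _ _ dl (erefl _)).
  exact: (@is_derive_comp R (k j) (fun s => ln s / 2) s _ _ _ (dk j _) dl2 (erefl _)).
have d3 := is_derive_mul d1 d2 (erefl _).
have E : expR ((c - 2) / 2 * ln s) = expR (c / 2 * ln s) * s^-1.
  rewrite (_ : (c - 2) / 2 * ln s = c / 2 * ln s - ln s); last by field.
  by rewrite expRD expRN lnK.
apply: (@near_eq_is_derive _ _ _ (fun s : R => expR (c / 2 * ln s) * k j (ln s / 2))).
  near=> t; rewrite /log_profile ifT//; near: t; exact: lt_nbhsr.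
rewrite /log_profile s0 E.
rewrite (_ : 2^-1 * _ = expR (c / 2 * ln s) * (c / 2 / s) * k j (ln s / 2) + expR (c / 2 * ln s) * (k j.+1 (ln s / 2) * (2^-1 / s))); first exact: d3.
by field; rewrite gt_eqF.
Unshelve. all: by end_near. Qed.

Lemma is_derive_of_line (f : 'rV[R]_n -> R) (x u : 'rV[R]_n) (l : R) :
  is_derive (0 : R) 1 (fun h : R => f (x + h *: u)) l -> is_derive x u f l.
Proof.
move=> [d0 E0].
have E : (fun h : R => h^-1 *: (((fun h => f (x + h *: u)) \o shift 0) (h *: 1) - f (x + 0 *: u)))
    = (fun h => h^-1 *: ((f \o shift x) (h *: u) - f x)).
  apply/funext => h /=; rewrite scale0r [x + 0]addr0; congr (_ *: (f _ - _)).
  by rewrite (_ : h *: (1 : R) = h) 1?addr0 1?addrC// /GRing.scale/= mulr1.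
by split; [move: d0; rewrite /derivable E|move: E0; rewrite /derive E].
Qed.

Definition radial_profile c j (x : 'rV[R]_n) := log_profile c j (enorm x ^+ 2).

Lemma sqr_enorm_line (x : 'rV[R]_n) i (h : R) :
  enorm (x + h *: delta_mx ord0 i) ^+ 2 = enorm x ^+ 2 + (2 * x ord0 i) * h + h * h.
Proof.
rewrite !sqr_enorm (bigD1 i)//= [in RHS](bigD1 i)//= !mxE !eqxx/= mulr1.
rewrite (eq_bigr (fun j => x ord0 j ^+ 2)); first ring.
by move=> j ji; rewrite !mxE eqxx (negbTE ji)/= mulr0 addr0.
Qed.

Lemma is_derive_radial_profile c j i (x : 'rV[R]_n) :
  is_derive x (delta_mx ord0 i) (radial_profile c j)
    (x ord0 i * (c * radial_profile (c - 2) j x + radial_profile (c - 2) j.+1 x)).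
Proof.
apply: is_derive_of_line; rewrite /radial_profile.
under eq_fun do rewrite sqr_enorm_line.
have dq : is_derive (0 : R) 1 (fun h : R => enorm x ^+ 2 + 2 * x ord0 i * h + h * h) (2 * x ord0 i).
  have d2 := is_derive_affine_fun (enorm x ^+ 2) (2 * x ord0 i) 0.
  have d3 := is_derive_mul (is_derive_id (0 : R) 1) (is_derive_id (0 : R) 1) (erefl _).
  have d4 := is_derive_add d2 d3 (erefl _).
  by rewrite mulr0 mul0r !addr0 in d4; exact: d4.
have := @is_derive_comp R (log_profile c j) _ 0 _ _ _ (is_derive_log_profile c j _) dq (erefl _).
rewrite !mulr0 !addr0.
by rewrite (_ : 2^-1 * _ * _ = x ord0 i * (c * log_profile (c - 2) j (enorm x ^+ 2) + log_profile (c - 2) j.+1 (enorm x ^+ 2)))//; field.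
Qed.

Lemma continuous_radial_profile c j : continuous (radial_profile c j).
Proof.
move=> x; apply: (@continuous_comp _ _ _ (fun x : 'rV[R]_n => enorm x ^+ 2) (log_profile c j)).
  exact: continuous_sqr_enorm.
exact: is_derive_continuous (is_derive_log_profile c j _).
Qed.

(* A class of smooth functions that contains the radial profiles and is
   stable under partial derivatives. *)
Inductive profile_module : ('rV[R]_n -> R) -> Prop :=
| profile_base c j : profile_module (radial_profile c j)
| profile_coord i f : profile_module f -> profile_module (fun x => x ord0 i * f x)
| profile_add f g : profile_module f -> profile_module g -> profile_module (fun x => f x + g x)
| profile_scale c f : profile_module f -> profile_module (fun x => c * f x).

Lemma profile_module_continuous f : profile_module f -> continuous f.
Proof.
elim=> {f} [c j|i f _ IH|f g _ IHf _ IHg|c f _ IH] x.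
- exact: continuous_radial_profile.
- exact: cvgM (@coord_continuous R 1 n ord0 i x) (IH x).
- exact: cvgD (IHf x) (IHg x).
- by apply: cvgM (IH x); exact: cvg_cst.
Qed.

Lemma profile_module_derive f i : profile_module f ->
  exists2 g, profile_module g & forall x, is_derive x (delta_mx ord0 i) f (g x).
Proof.
elim=> {f} [c j|l f mf [g mg dg]|f f' _ [g mg dg] _ [g' mg' dg']|c f _ [g mg dg]].
- exists (fun x : 'rV[R]_n => x ord0 i * (c * radial_profile (c - 2) j x + radial_profile (c - 2) j.+1 x)).
    by apply/profile_coord/profile_add; [apply/profile_scale|]; exact: profile_base.
  by move=> x; exact: is_derive_radial_profile.
- exists (fun x : 'rV[R]_n => x ord0 l * g x + (l == i)%:R * f x).
    by apply: profile_add; [exact: profile_coord|exact: profile_scale].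
  move=> x.
  have dc : is_derive x (delta_mx ord0 i : 'rV[R]_n) (fun x => x ord0 l) ((l == i)%:R : R).
    apply: is_derive_of_line.
    rewrite (_ : (fun h : R => _) = (fun h => x ord0 l + (l == i)%:R * h)); last first.
      by apply/funext => h; rewrite !mxE eqxx/= mulrC.
    exact: is_derive_affine_fun.
  have := is_deriveM dc (dg x).
  by rewrite /GRing.scale/= [_ * (l == i)%:R]mulrC; exact.
- exists (fun x : 'rV[R]_n => g x + g' x); first exact: profile_add.
  by move=> x; exact: is_deriveD.
- exists (fun x : 'rV[R]_n => c * g x); first exact: profile_scale.
  by move=> x; exact: is_deriveZ.
Qed.

Lemma profile_module_smooth f : profile_module f -> smooth f.
Proof.
move=> mf s; have : profile_module (foldr (@partial R n) f s).
  elim: s => //= i s IH; have [g mg dg] := profile_module_derive i IH.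
  by rewrite (_ : partial i _ = g)//; apply/funext => x; exact: derive_val.
move=> ms; split; first exact: profile_module_continuous.
by move=> i x; have [g _ dg] := profile_module_derive i ms; have [] := dg x.
Qed.

End smooth_radial.

Section radial_test_function.
Context {R : realType} {n : nat}.
Variable k : nat -> R -> R.
Variables A B : R.
Hypothesis dk : forall j (x : R), is_derive x 1 (k j) (k j.+1 x).
Hypothesis k_low : forall j x, x <= A -> k j x = 0.
Hypothesis k_high : forall j x, B <= x -> k j x = 0.

Definition radial_test (c : R) (x : 'rV[R]_n.+1) : R := radial_profile k c 0 x.

Lemma log_profile_sqr c j (r : R) : 0 < r -> log_profile k c j (r ^+ 2) = expR (c * ln r) * k j (ln r).
Proof.
move=> r0; rewrite /log_profile exprn_gt0// lnXn// -mulr_natl.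
by congr (expR _ * k j _); field.
Qed.

Lemma closed_eball_compact (r : R) : compact [set x : 'rV[R]_n.+1 | enorm x <= r].
Proof.
apply: bounded_closed_compact.
  exists r; split; first exact: num_real.
  move=> M rM x /= xr; apply: le_trans (mx_norm_le_enorm x) _.
  exact: le_trans xr (ltW rM).
apply: (@closed_comp _ _ (@enorm R n.+1) [set t | t <= r]); first by move=> x _; exact: continuous_enorm.
exact: closed_le.
Qed.

(** The vanishing of [k] near [-oo] removes the singularity of the power at the origin; [k_high]
    with [B < ln rho] confines the closed support to a smaller closed ball. *)
Lemma radial_test_function c (rho : R) : 0 < rho -> B < ln rho -> test_function (eball rho) (radial_test c).
Proof.
move=> rho0 Brho.
have sub : closure [set x | radial_test c x != 0] `<=` [set x | enorm x <= expR B].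
  have cl : closed [set x : 'rV[R]_n.+1 | enorm x <= expR B].
    by apply: compact_closed; [exact: norm_hausdorff|exact: closed_eball_compact].
  rewrite [X in _ `<=` X](closure_id _).1//; apply: closure_subset => x /= /eqP ux.
  rewrite leNgt; apply/negP => xB; apply: ux.
  have x0 : 0 < enorm x by apply: lt_trans xB; exact: expR_gt0.
  rewrite /radial_test /radial_profile log_profile_sqr// k_high ?mulr0//.
  by rewrite -[leLHS]expRK ler_ln// ?posrE ?expR_gt0// ltW.
split.
- by apply: profile_module_smooth dk k_low _ _; exact: profile_base.
- by apply: subclosed_compact sub => //; [exact: closed_closure|exact: closed_eball_compact].
- move=> x /sub /= xB; rewrite /eball/= (le_lt_trans xB)//.
  by rewrite -[ltRHS]lnK// ltr_expR.
Qed.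

Lemma radial_test_partial c i (x : 'rV[R]_n.+1) : partial i (radial_test c) x =
  x ord0 i * (c * radial_profile k (c - 2) 0 x + radial_profile k (c - 2) 1 x).
Proof. exact: (@derive_val _ _ _ _ _ _ _ (is_derive_radial_profile dk k_low c 0 i x)). Qed.

Lemma radial_test_gradient c (x : 'rV[R]_n.+1) : \sum_i partial i (radial_test c) x ^+ 2 =
  enorm x ^+ 2 * (c * log_profile k (c - 2) 0 (enorm x ^+ 2) + log_profile k (c - 2) 1 (enorm x ^+ 2)) ^+ 2.
Proof.
rewrite {1}sqr_enorm mulr_suml; apply: eq_bigr => i _.
by rewrite radial_test_partial exprMn.
Qed.

Lemma radial_test_polar c (t : R) :
  log_profile k c 0 (expR t ^+ 2) ^+ 2 = expR (2 * c * t) * k 0 t ^+ 2.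
Proof.
rewrite log_profile_sqr ?expR_gt0// expRK exprMn -expRM_natl; congr (expR _ * _).
by ring.
Qed.

Lemma radial_gradient_polar c (t : R) :
  expR t ^+ 2 * (c * log_profile k (c - 2) 0 (expR t ^+ 2) + log_profile k (c - 2) 1 (expR t ^+ 2)) ^+ 2 =
  expR (2 * (c - 1) * t) * (c * k 0 t + k 1 t) ^+ 2.
Proof.
rewrite !log_profile_sqr ?expR_gt0// expRK.
rewrite (_ : 2 * (c - 1) * t = 2 * t + 2 * ((c - 2) * t)); last by ring.
by rewrite expRD !expRM_natl; ring.
Qed.

End radial_test_function.

(** * Integration by parts in several variables *)

Section integration_by_parts.
Context {R : realType} {n : nat}.
Local Notation leb := (lebesgue_rV R n.+1).
Local Notation cube r := [set x : 'rV[R]_n.+1 | forall i, `|x ord0 i| <= r].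
Implicit Types f : 'rV[R]_n.+1 -> R.

Lemma Rintegral_translate_rV f (c : 'rV[R]_n.+1) : measurable_fun setT f ->
  \int[leb]_x f (c + x) = \int[leb]_x f x.
Proof.
move=> mf; rewrite /Rintegral; congr fine; rewrite [LHS]integralE [RHS]integralE.
have mEf : measurable_fun setT (EFin \o f) by exact/measurable_EFinP.
have T (g : 'rV[R]_n.+1 -> \bar R) : measurable_fun setT g -> (forall x, 0 <= g x)%E ->
    (\int[leb]_x g (c + x)%R = \int[leb]_x g x)%E.
  move=> mg g0; rewrite [RHS](@ge0_integral_rV_affine R _ c 1)// expr1n mul1e.
  by apply: eq_integral => x _; rewrite scale1r.
congr (_ - _)%E.
  rewrite -(T _ (measurable_funepos mEf) (fun x => funepos_ge0 _ x)).
  by apply: eq_integral => x _; rewrite !funeposE.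
rewrite -(T _ (measurable_funeneg mEf) (fun x => funeneg_ge0 _ x)).
by apply: eq_integral => x _; rewrite !funenegE.
Qed.

Lemma bounded_support_bounded f (r : R) : continuous f -> (forall x, r < enorm x -> f x = 0) ->
  exists2 M, 0 <= M & forall x, `|f x| <= M.
Proof.
move=> cf f0.
have cfK : {within [set x : 'rV[R]_n.+1 | enorm x <= r], continuous f} by exact: continuous_subspaceT.
have /compact_bounded[M [Mr HM]] := continuous_compact cfK (@closed_eball_compact R n r).
exists (Num.max (M + 1) 0); first by rewrite le_max lexx orbT.
move=> x; case: (leP (enorm x) r) => xr.
  by rewrite le_max HM// ltrDl.
by rewrite f0// normr0 le_max lexx orbT.
Qed.

Lemma integrable_cube_indic (M r : R) :
  leb.-integrable setT (EFin \o (fun x => M * \1_(cube r) x)).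
Proof.
have mC := @measurable_cube R n.+1 r.
apply: integrableZ_EFin => //; apply/integrableP; split.
  by apply/measurable_EFinP; exact: measurable_indic.
under eq_integral => x _ do rewrite /= ger0_norm//.
by rewrite integral_indic// setIT; exact: lebesgue_rV_cube_lty.
Qed.

Lemma bounded_support_integrable f (r : R) : continuous f -> (forall x, r < enorm x -> f x = 0) ->
  leb.-integrable setT (EFin \o f).
Proof.
move=> cf f0; have [M M0 HM] := bounded_support_bounded cf f0.
apply: le_integrable (integrable_cube_indic M r) => //.
  by apply/measurable_EFinP; exact: continuous_measurable_rV.
move=> x _; rewrite lee_fin /= [leRHS]ger0_norm; last by rewrite mulr_ge0.
rewrite indicE; case: (boolP (x \in _)); first by rewrite mulr1.
move=> /negP xC; rewrite f0 ?normr0 ?mulr0// ltNge; apply/negP => xr; apply: xC.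
by rewrite inE => i /=; rewrite (le_trans (coord_le_enorm x i)).
Qed.

(** By translation invariance the integral of [f (x + h e)] does not depend on [h]; differentiating
    under the integral sign at [h = 0] gives the claim. *)
Lemma integral_partial0 f (r : R) i : continuous f -> continuous (partial i f) ->
  (forall x, derivable f x (delta_mx ord0 i)) -> (forall x, r < enorm x -> f x = 0) ->
  \int[leb]_x partial i f x = 0.
Proof.
move=> cf cdf df f0; set e : 'rV[R]_n.+1 := delta_mx ord0 i.
have df0 x : r < enorm x -> partial i f x = 0.
  move=> xr; rewrite /partial (@near_eq_derive _ _ _ f (cst 0)); first by rewrite derive_cst.
  have oU : open [set x : 'rV[R]_n.+1 | r < enorm x].
    apply: (@open_comp _ _ (@enorm R n.+1) [set t | r < t]); first by move=> y _; exact: continuous_enorm.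
    exact: open_gt.
  have nb : nbhs x [set x : 'rV[R]_n.+1 | r < enorm x] by exact: open_nbhs_nbhs.
  by apply: filterS nb => y /= /f0.
have [M M0 HM] := bounded_support_bounded cdf df0.
pose F (h : R) (x : 'rV[R]_n.+1) := f (x + h *: e).
have dF (h : R) x : is_derive h 1 (F ^~ x) (partial i f (x + h *: e)) by exact: is_derive_line.
have pE (h : R) x : partial1of2 F h x = partial i f (x + h *: e).
  by rewrite partial1of2E; have [_ ->] := dF h x.
have mf := continuous_measurable_rV cf.
have cT (h : R) : continuous (fun x : 'rV[R]_n.+1 => x + h *: e).
  by move=> x; exact: (cvgD cvg_id (cvg_cst _)).
have cF (h : R) : continuous (F h).
  by move=> x; exact: (@continuous_comp _ _ _ (fun x : 'rV[R]_n.+1 => x + h *: e) f x (cT h x) (cf _)).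
(* All translates with [|h| < 1] vanish outside one cube, which supplies the dominating function
   [M * \1_(cube (r + 1))]. *)
have cubeP (h : R) x : `|h| < 1 -> ~ cube (r + 1) x -> r < enorm (x + h *: e).
  move=> h1 xC; rewrite ltNge; apply/negP => xr; apply: xC => j.
  have := coord_le_enorm (x + h *: e) j; rewrite !mxE => H.
  have -> : x ord0 j = (x ord0 j + h * (((ord0 : 'I_1) == ord0) && (j == i))%:R) - h * (((ord0 : 'I_1) == ord0) && (j == i))%:R by rewrite addrK.
  apply: le_trans (ler_normB _ _) _; apply: lerD; first exact: le_trans H xr.
  by rewrite normrM; case: (_ && _); rewrite ?normr1 ?normr0 ?mulr1 ?mulr0// ltW.
have I0 : `]-1, 1[%classic (0 : R) by rewrite /= in_itv/= ltrN10 ltr01.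
have hI (h : R) : `]-1, 1[%classic h -> `|h| < 1 by rewrite /= in_itv/= ltr_norml.
have intF (h : R) : `]-1, 1[%classic h -> leb.-integrable setT (EFin \o F h).
  (* The cube of half side [r + 1] lies in the ball of radius [n.+1%:R * (r + 1)], a crude form of
     the radius with the square root of the dimension. *)
  move=> /hI h1; apply: (@bounded_support_integrable _ (n.+1%:R * (r + 1) + 1)) => //.
  move=> x xr; apply: f0; apply: cubeP => // xC; move: xr; apply/negP; rewrite -leNgt.
  have sqle : enorm x ^+ 2 <= (n.+1%:R * (r + 1)) ^+ 2.
    rewrite sqr_enorm (@le_trans _ _ (\sum_(j < n.+1) (r + 1) ^+ 2))//.
      apply: ler_sum => j _; rewrite -(@real_normK _ (x ord0 j)) ?num_real// lerXn2r ?nnegrE//.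
      exact: le_trans (xC j).
    rewrite sumr_const card_ord -[leLHS]mulr_natl exprMn ler_wpM2r ?sqr_ge0//.
    by rewrite -natrX ler_nat -mulnn leq_pmulr.
  have r1 : 0 <= r + 1 by apply: le_trans (xC ord0).
  rewrite -(@ler_pXn2r _ 2)// ?nnegrE ?enorm_ge0 ?addr_ge0 ?mulr_ge0//.
  apply: le_trans sqle _; rewrite ler_pXn2r ?nnegrE ?addr_ge0 ?mulr_ge0//.
  by rewrite lerDl.
have derF (h : R) x : `]-1, 1[%classic h -> [set: 'rV[R]_n.+1] x -> derivable (F ^~ x) h 1.
  by move=> _ _; have [] := dF h x.
have Gub (h : R) x : `]-1, 1[%classic h -> [set: 'rV[R]_n.+1] x ->
    `|partial1of2 F h x| <= M * \1_(cube (r + 1)) x.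
  move=> /hI h1 _; rewrite pE indicE; case: (boolP (x \in _)) => [_|/negP xC]; first by rewrite mulr1.
  by rewrite df0 ?normr0 ?mulr0// cubeP// => xC'; apply: xC; rewrite inE.
have G0 (x : 'rV[R]_n.+1) : 0 <= M * \1_(cube (r + 1)) x by rewrite mulr_ge0.
have := @differentiation_under_integral R _ _ leb F setT measurableT 0 (-1) 1 I0 intF derF _ G0
  (integrable_cube_indic M (r + 1)) Gub.
under [X in _ = X -> _]eq_Rintegral do rewrite pE scale0r addr0.
move=> <-.
rewrite (_ : (fun h : R => \int[leb]_x F h x) = cst (\int[leb]_x f x)); first by rewrite derive1_cst.
apply/funext => h; rewrite /F /cst -(@Rintegral_translate_rV f (h *: e))//.
by apply: eq_Rintegral => x _; rewrite addrC.
Qed.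

End integration_by_parts.

Section test_functions_H10.
Context {R : realType} {n : nat} (rho : R).
Local Notation leb := (lebesgue_rV R n.+1).

Let test_out (f : 'rV[R]_n.+1 -> R) x : test_function (eball rho) f -> rho < enorm x -> f x = 0.
Proof. by move=> tf xr; apply: test_function0 tf _; exact: ltW. Qed.

Let partial_out (f : 'rV[R]_n.+1 -> R) i x : test_function (eball rho) f -> rho < enorm x -> partial i f x = 0.
Proof.
move=> tf xr; apply: test_function_partial0 tf _; rewrite /eball/= => xr'.
by have := lt_trans xr xr'; rewrite ltxx.
Qed.

Let L2_bounded_support (f : 'rV[R]_n.+1 -> R) : continuous f -> (forall x, rho < enorm x -> f x = 0) ->
  L2 (eball rho) f.
Proof.
move=> cf f0; split; first by apply: measurable_funTS; exact: continuous_measurable_rV.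
have c2 : continuous (fun x => f x ^+ 2).
  move=> x; apply: (@continuous_comp _ _ _ f (fun r : R => r ^+ 2)); first exact: cf.
  exact: exprn_continuous.
have := @bounded_support_integrable R n _ rho c2 (fun x xr => _).
have f20 x : rho < enorm x -> f x ^+ 2 = 0 by move=> /f0 ->; rewrite expr0n.
have /integrableP[m2 fin2] := bounded_support_integrable c2 f20.
move=> _; apply: le_lt_trans fin2.
rewrite (_ : (fun x => `|_|%E) = (fun x => (f x ^+ 2)%:E)); last first.
  by apply/funext => x /=; rewrite ger0_norm// sqr_ge0.
by apply: ge0_subset_integral => //; [exact: measurable_eball|move=> x _; rewrite lee_fin sqr_ge0].
Qed.

(** The weak gradient identity is [integral_partial0] for the product [f * phi], and the constant
    sequence [f] serves as the approximation. *)
Lemma test_function_H10 (f : 'rV[R]_n.+1 -> R) : test_function (eball rho) f ->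
  H10 (eball rho) f (fun i => partial i f).
Proof.
move=> tf; have [sf _ _] := tf.
have cf : continuous f := (sf [::]).1.
have cdf i : continuous (partial i f) := (sf [:: i]).1.
have dfe i x : derivable f x (delta_mx ord0 i) := (sf [::]).2 i x.
split; first split.
- by apply: L2_bounded_support => // x; exact: test_out.
- by move=> i; apply: L2_bounded_support => // x; exact: partial_out.
- move=> phi tphi i; have [sphi _ _] := tphi.
  have cphi : continuous phi := (sphi [::]).1.
  have cdphi : continuous (partial i phi) := (sphi [:: i]).1.
  have dphi x : derivable phi x (delta_mx ord0 i) := (sphi [::]).2 i x.
  have toT (h : 'rV[R]_n.+1 -> R) : (forall x, rho <= enorm x -> h x = 0) ->
      \int[leb]_(x in eball rho) h x = \int[leb]_x h x.
    move=> h0; rewrite /Rintegral integral_mkcond; congr fine; apply: eq_integral => x _.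
    by rewrite patchE; case: ifPn => // /negP; rewrite inE /eball/= => /negP; rewrite -leNgt => /h0 ->.
  rewrite !toT; last 2 first.
  - by move=> x xr; rewrite (test_function0 tphi xr) mulr0.
  - by move=> x xr; rewrite (test_function0 tf xr) mul0r.
  have pM x : partial i (fun x => f x * phi x) x = f x * partial i phi x + partial i f x * phi x.
    by rewrite /partial (deriveM (dfe i x) (dphi x)) /GRing.scale/= [phi x * _]mulrC.
  have c1 : continuous (fun x => f x * partial i phi x) by move=> x; exact: cvgM (cf x) (cdphi x).
  have c2 : continuous (fun x => partial i f x * phi x) by move=> x; exact: cvgM (cdf i x) (cphi x).
  have i1 : leb.-integrable setT (EFin \o (fun x => f x * partial i phi x)).
    by apply: bounded_support_integrable c1 _ => x /(test_out tf) ->; rewrite mul0r.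
  have i2 : leb.-integrable setT (EFin \o (fun x => partial i f x * phi x)).
    by apply: bounded_support_integrable c2 _ => x /(test_out tphi) ->; rewrite mulr0.
  apply/eqP; rewrite -addr_eq0 -RintegralD//; apply/eqP.
  under eq_Rintegral do rewrite -pM.
  apply: (@integral_partial0 R n _ rho).
  + by move=> x; exact: cvgM (cf x) (cphi x).
  + rewrite (_ : partial i _ = (fun x => f x * partial i phi x + partial i f x * phi x)); last exact/funext.
    by move=> x; exact: cvgD (c1 x) (c2 x).
  + by move=> x; apply: derivableM.
  + by move=> x /(test_out tf) ->; rewrite mul0r.
exists (fun=> f); split=> //.
- by rewrite (_ : (fun _ => _) = cst 0%E); [exact: cvg_cst|
    apply/funext => k; rewrite integral0_eq// => x _; rewrite subrr expr0n].
- move=> i; rewrite (_ : (fun _ => _) = cst 0%E); first exact: cvg_cst.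
  by apply/funext => k; rewrite integral0_eq// => x _; rewrite subrr expr0n.
Qed.

End test_functions_H10.

(** * The line inequality *)

Lemma cvg_sqr (R : realType) T (F : set_system T) {FF : Filter F} (f : T -> R) (l : R) :
  f x @[x --> F] --> l -> f x ^+ 2 @[x --> F] --> l ^+ 2.
Proof. by move=> cf; under eq_cvg do rewrite expr2; rewrite expr2; exact: cvgM. Qed.

Section line_inequality_of_hardy.
Context {R : realType} {n : nat} (rho : R) (V : 'rV[R]_n.+1 -> R) (v : R -> R) (m : R).
Local Notation mu := (@lebesgue_measure R).
Local Notation leb := (lebesgue_rV R n.+1).
Hypothesis rho0 : 0 < rho.
Hypothesis v_ge0 : forall r, r \in `]0, rho[ -> 0 <= v r.
Hypothesis v_meas : measurable_fun `]0, rho[ v.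
Hypothesis V_radial : forall x, 0 < enorm x < rho -> V x = v (enorm x).
Hypothesis m2 : 2 * m + 2 = n.+1%:R.
Hypothesis hardy : forall u : 'rV[R]_n.+1 -> R, test_function (eball rho) u ->
  (\int[leb]_(x in eball rho) (V x * u x ^+ 2)%:E <=
   hardy_deficit (eball rho) u (fun i => partial i u))%E.

Section family.
Variable k : nat -> R -> R.
Variables A B : R.
Hypothesis AB : A <= B.
Hypothesis dk : forall j (x : R), is_derive x 1 (k j) (k j.+1 x).
Hypothesis k_low : forall j x, x <= A -> k j x = 0.
Hypothesis k_high : forall j x, B <= x -> k j x = 0.
Hypothesis Brho : B < ln rho.

Let u : 'rV[R]_n.+1 -> R := radial_test k (- m).

Let tu : test_function (eball rho) u.
Proof. exact: radial_test_function dk k_low k_high _ _ rho0 Brho. Qed.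

Let ck j : continuous (k j).
Proof. by move=> x; exact: is_derive_continuous (dk j x). Qed.

Let mlp c j : measurable_fun setT (fun r : R => log_profile k c j (r ^+ 2)).
Proof.
apply: (@measurableT_comp _ _ _ _ _ _ (log_profile k c j)).
  apply: continuous_measurable_fun => x.
  exact: is_derive_continuous (is_derive_log_profile dk k_low c j x).
exact: measurable_funX.
Qed.

Let expE (t : R) : expR (n.+1%:R * t) = expR (2 * m * t) * expR t ^+ 2.
Proof. by rewrite -m2 -expRM_natl -expRD; congr expR; ring. Qed.

Let potential_part :
  (\int[leb]_(x in eball rho) (V x * u x ^+ 2)%:E =
   @sphere_area R n * \int[mu]_t (log_potential rho v t * k 0 t ^+ 2)%:E)%E.
Proof.
pose F (r : R) := potential rho v r * log_profile k (- m) 0 (r ^+ 2) ^+ 2.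
transitivity (\int[leb]_x (F (enorm x))%:E)%E.
  rewrite integral_mkcond; apply: eq_integral => x _; rewrite patchE /F.
  case: ifPn => [|/negP]; rewrite inE /eball/= => xr; last first.
    by rewrite /potential patchE mem_setE in_itv/= (introF idP xr) andbF mul0r.
  (* The value [V 0] is arbitrary, but the test function vanishes at the origin. *)
  have [->|x0] := eqVneq x 0.
    have e0 : enorm (0 : 'rV[R]_n.+1) = 0 by apply/eqP; rewrite enorm_eq0.
    by rewrite /u /radial_test /radial_profile e0 /log_profile expr0n/= ltxx expr0n/= !mulr0.
  have xI : 0 < enorm x < rho by rewrite enorm_gt0 x0.
  by rewrite potentialE ?in_itv// V_radial.
rewrite ge0_integral_radial.
- congr (_ * _)%E; apply: eq_integral => t _; congr EFin.
  rewrite /F radial_test_polar expE /log_potential.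
  rewrite (_ : expR (2 * m * t) = (expR (2 * - m * t))^-1); last by rewrite -expRN; congr expR; ring.
  by field; rewrite gt_eqF// expR_gt0.
- apply: measurable_funM; first exact: measurable_potential.
  by apply: measurable_funX; exact: mlp.
- by move=> r; rewrite mulr_ge0 ?sqr_ge0// potential_ge0.
Qed.

Let gradient_part :
  (\int[leb]_(x in eball rho) (\sum_i partial i u x ^+ 2)%:E =
   @sphere_area R n * \int[mu]_t ((- m * k 0 t + k 1 t) ^+ 2)%:E)%E.
Proof.
pose F (r : R) := r ^+ 2 * (- m * log_profile k (- m - 2) 0 (r ^+ 2) + log_profile k (- m - 2) 1 (r ^+ 2)) ^+ 2.
transitivity (\int[leb]_x (F (enorm x))%:E)%E.
  rewrite integral_mkcond; apply: eq_integral => x _.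
  rewrite /F -(radial_test_gradient dk k_low) patchE; case: ifPn => // /negP; rewrite inE => xr.
  by rewrite big1// => i _; rewrite (test_function_partial0 i tu xr) expr0n.
rewrite ge0_integral_radial.
- congr (_ * _)%E; apply: eq_integral => t _; congr EFin.
  rewrite /F radial_gradient_polar expE.
  rewrite (_ : 2 * m * t = - (2 * (- m - 1) * t) - 2 * t); last by ring.
  rewrite expRD !expRN expRM_natl.
  by field; rewrite !gt_eqF// expR_gt0.
- apply: measurable_funM; first exact: measurable_funX.
  apply: measurable_funX; apply: measurable_funD; last exact: mlp.
  by apply: measurable_funM => //; exact: mlp.
- by move=> r; rewrite mulr_ge0 ?sqr_ge0.
Qed.

Let hardy_part :
  (\int[leb]_(x in eball rho) (u x ^+ 2 / enorm x ^+ 2)%:E =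
   @sphere_area R n * \int[mu]_t (k 0 t ^+ 2)%:E)%E.
Proof.
pose F (r : R) := log_profile k (- m) 0 (r ^+ 2) ^+ 2 / r ^+ 2.
transitivity (\int[leb]_x (F (enorm x))%:E)%E.
  rewrite integral_mkcond; apply: eq_integral => x _; rewrite patchE /F.
  case: ifPn => [|/negP]; rewrite inE /eball/= => xr //.
  have := test_function0 tu; move=> /(_ x); rewrite /u /radial_test /radial_profile => ->.
    by rewrite expr0n mul0r.
  by rewrite leNgt; apply/negP.
rewrite ge0_integral_radial.
- congr (_ * _)%E; apply: eq_integral => t _; congr EFin.
  rewrite /F radial_test_polar expE.
  rewrite (_ : expR (2 * m * t) = (expR (2 * - m * t))^-1); last by rewrite -expRN; congr expR; ring.
  by field; rewrite !gt_eqF// expR_gt0.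
- apply: measurable_funM; first by apply: measurable_funX; exact: mlp.
  apply: (@measurableT_comp _ _ _ _ _ _ (fun r : R => r^-1)); first exact: measurable_invr.
  exact: measurable_funX.
- by move=> r; rewrite mulr_ge0 ?sqr_ge0// invr_ge0 sqr_ge0.
Qed.

Let on_support (f : R -> R) : (forall t, (t <= A) || (B <= t) -> f t = 0) ->
  (\int[mu]_t (f t)%:E = \int[mu]_(t in `[A, B]) (f t)%:E)%E.
Proof.
move=> f0; rewrite [RHS]integral_mkcond; apply: eq_integral => t _.
rewrite patchE mem_setE in_itv/=; case: ifPn => //.
by rewrite negb_and -!ltNge => h; rewrite f0//; case/orP: h => /ltW ->; rewrite ?orbT.
Qed.

(** In the square of [- m k + k'] the cross term is the derivative of [- m k^2] and integrates to
    zero. There remains [K1 + m ^+ 2 * K0], from which the Hardy term takes away exactly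
    [m ^+ 2 * K0]; the common factor [sphere_area] is positive and finite and cancels. *)
Lemma line_inequality_smooth :
  (\int[mu]_t (log_potential rho v t * k 0 t ^+ 2)%:E <= \int[mu]_t (k 1 t ^+ 2)%:E)%E.
Proof.
have kout j t : (t <= A) || (B <= t) -> k j t = 0 by case/orP => [/k_low|/k_high] ->.
have icont (f : R -> R) : continuous f -> mu.-integrable `[A, B] (EFin \o f).
  move=> cf; apply: continuous_compact_integrable; first exact: segment_compact.
  exact: continuous_subspaceT.
have i01 : mu.-integrable `[A, B] (EFin \o (fun t => k 0 t * k 1 t)).
  by apply: icont => t; apply: cvgM; exact: ck.
have i00 : mu.-integrable `[A, B] (EFin \o (fun t => k 0 t ^+ 2)).
  by apply: icont => t; apply: cvg_sqr; exact: ck.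
have i11 : mu.-integrable `[A, B] (EFin \o (fun t => k 1 t ^+ 2)).
  by apply: icont => t; apply: cvg_sqr; exact: ck.
set K0 := \int[mu]_(t in `[A, B]) (k 0 t ^+ 2).
set K1 := \int[mu]_(t in `[A, B]) (k 1 t ^+ 2).
have E0 : (\int[mu]_t (k 0 t ^+ 2)%:E = K0%:E)%E.
  by rewrite on_support ?/K0 /Rintegral ?fineK ?integrable_fin_num// => t /kout ->; rewrite expr0n.
have E1 : (\int[mu]_t (k 1 t ^+ 2)%:E = K1%:E)%E.
  by rewrite on_support ?/K1 /Rintegral ?fineK ?integrable_fin_num// => t /kout ->; rewrite expr0n.
have k01 : \int[mu]_(t in `[A, B]) (k 0 t * k 1 t) = 0.
  have ad : antiderivative_on A B (k 0) (k 1).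
    by apply: antiderivative_onC1 => // ; exact: continuous_subspaceT.
  have := antiderivativeM AB ad ad.
  rewrite (kout 0 A) ?lexx// (kout 0 B) ?lexx ?orbT// mulr0 subrr.
  under eq_Rintegral => t _ do rewrite [k 1 t * _]mulrC.
  by rewrite RintegralD// => /esym/eqP; rewrite -mulr2n mulrn_eq0/= => /eqP.
have E2 : (\int[mu]_t ((- m * k 0 t + k 1 t) ^+ 2)%:E = (K1 + m ^+ 2 * K0)%:E)%E.
  rewrite on_support; last by move=> t tK; rewrite !kout// mulr0 addr0 expr0n.
  rewrite -[LHS]fineK; last first.
    apply: integrable_fin_num => //; apply: icont => t.
    apply: cvg_sqr; apply: cvgD; last exact: ck.
    by apply: cvgM; [exact: cvg_cst|exact: ck].
  congr EFin; rewrite -/(Rintegral _ _ _).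
  transitivity (\int[mu]_(t in `[A, B]) (k 1 t ^+ 2 + (- (2 * m)) * (k 0 t * k 1 t) + m ^+ 2 * (k 0 t ^+ 2))).
    by apply: eq_Rintegral => t _; ring.
  have i2 : mu.-integrable `[A, B] (EFin \o (fun t => - (2 * m) * (k 0 t * k 1 t))) by exact: integrableZ_EFin.
  have i3 : mu.-integrable `[A, B] (EFin \o (fun t => m ^+ 2 * (k 0 t ^+ 2))) by exact: integrableZ_EFin.
  rewrite RintegralD//; last exact: integrableD_EFin.
  by rewrite RintegralD// !RintegralZl// k01 mulr0 addr0.
have wfin : @sphere_area R n \is a fin_num by rewrite ge0_fin_numE ?sphere_area_lty// ltW// sphere_area_gt0.
have w0 : (0 < @sphere_area R n)%E by exact: sphere_area_gt0.
have := hardy tu.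
rewrite /hardy_deficit potential_part gradient_part hardy_part E0 E1 E2.
move: w0; rewrite -(fineK wfin); set w := fine _ => w0.
rewrite -!EFinM -EFinB (_ : _ - _ = w * K1); last first.
  by rewrite -m2; field.
by rewrite EFinM lee_pmul2l.
Qed.

End family.

Lemma line_inequality_bounded (g : R -> R) (M a b : R) : a <= b -> b < ln rho ->
  measurable_fun setT g -> (forall s, `|g s| <= M) -> \int[mu]_(s in `[a, b]) g s = 0 ->
  (\int[mu]_t (log_potential rho v t * (\int[mu]_(s in `[a, b]) (g s * (s <= t)%R%:R)) ^+ 2)%:E <=
   \int[mu]_(s in `[a, b]) (g s ^+ 2)%:E)%E.
Proof.
move=> ab brho mg gM g0.
have [th [dth th_low th_high th_out th1_ge0]] := @smooth_step R.
(* Half of the gap to [ln rho]: widths up to [d] keep the mollified supports inside. *)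
pose d := (ln rho - b) / 2.
have d0 : 0 < d by rewrite divr_gt0// subr_gt0.
pose e (j : nat) : R := d / j.+1%:R.
have e0 j : 0 < e j by rewrite divr_gt0.
have ed j : e j <= d by rewrite ler_pdivrMr// ler_pMr// ler1n.
have q0 := log_potential_ge0 v_ge0.
have mq := measurable_log_potential v_meas.
pose F (j : nat) (t : R) : \bar R := (log_potential rho v t * mollified th a b (e j) g 0 t ^+ 2)%:E.
have Fle j : (\int[mu]_t F j t <= \int[mu]_(s in `[a, b]) (g s ^+ 2)%:E)%E.
  apply: (@le_trans _ _ (\int[mu]_t (mollified th a b (e j) g 1 t ^+ 2)%:E)%E).
    apply: (@line_inequality_smooth _ (a - e j) (b + e j)).
    - by have := e0 j; lra.
    - by move=> i x; apply: is_derive_mollified gM _ _.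
    - by move=> i x; exact: mollified_low.
    - by move=> i x; exact: mollified_high.
    - by have := ed j; rewrite /d; lra.
  exact: (integral_mollified1_sqr dth th_low th_high th_out th1_ge0 ab (e0 j) mg gM).
have mF j : measurable_fun setT (F j).
  apply/measurable_EFinP; apply: measurable_funM => //; apply: measurable_funX.
  by apply: continuous_measurable_fun; apply: continuous_mollified gM _.
have F0 j t : setT t -> (0 <= F j t)%E by move=> _; rewrite lee_fin mulr_ge0 ?sqr_ge0.
apply: le_trans (_ : (_ <= limn_einf (fun j => \int[mu]_t F j t))%E) _.
  apply: le_trans (fatou mu measurableT mF F0).
  rewrite le_eqVlt; apply/orP; left; apply/eqP; apply: eq_integral => t _.
  apply: esym; apply: (cvg_limn_einf_sup _).1; rewrite /F.
  apply: cvg_EFin; first by near=> j.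
  apply: cvgM; first exact: cvg_cst.
  set h := \int[mu]_(s in _) _.
  have ch : mollified th a b (e j) g 0 t @[j --> \oo] --> h.
    have ce : e j @[j --> \oo] --> 0.
      rewrite -(mulr0 d); apply: cvgM; first exact: cvg_cst.
      exact: cvg_harmonic.
    have cMe : 2 * M * e j @[j --> \oo] --> 0.
      by rewrite -(mulr0 (2 * M)); apply: cvgM => //; exact: cvg_cst.
    apply/cvgrPdist_le => eps eps0.
    move/cvgrPdist_le : cMe => /(_ _ eps0); apply: filterS => j.
    rewrite sub0r normrN => H; rewrite distrC.
    apply: (le_trans (mollified_dist dth th_low th_high th_out th1_ge0 a b (e0 j) mg gM t)).
    exact: le_trans (ler_norm _) H.
  exact: cvg_sqr.
apply: le_trans (limn_einf_sup _) _.
rewrite limn_esup_lim; apply: lime_le; first exact: is_cvg_esups.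
near=> j; apply: ge_ereal_sup => _ [i _ <-]; exact: Fle.
Unshelve. all: by end_near. Qed.

End line_inequality_of_hardy.

(** * The Riccati equation *)

Section line_calculus.
Context {R : realType}.
Local Notation mu := (@lebesgue_measure R).

Lemma continuous_segment_bounded (f : R -> R) (a b : R) : {within `[a, b], continuous f} ->
  exists2 M, 0 <= M & forall x, x \in `[a, b] -> `|f x| <= M.
Proof.
move=> cf; have /compact_bounded[M [Mr HM]] := continuous_compact cf (@segment_compact _ a b).
exists (Num.max (M + 1) 0); first by rewrite le_max lexx orbT.
by move=> x xI; rewrite le_max HM// ltrDl.
Qed.

Lemma integrable_restrict (I J : interval R) (f : R -> R) : [set` I] `<=` [set` J] ->
  mu.-integrable [set` I] (EFin \o f) -> mu.-integrable [set` J] (EFin \o (f \_ [set` I])).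
Proof.
move=> IJ fI; rewrite -restrict_EFin.
apply: (@integrableS _ _ _ mu setT) => //.
by apply/(integrable_mkcond _ _).1.
Qed.

Lemma measurable_restrict_itv (I : interval R) (f : R -> R) : measurable_fun [set` I] f ->
  measurable_fun setT (f \_ [set` I]).
Proof. by move=> mf; exact: (measurable_restrictT f (measurable_itv I)).1. Qed.

Lemma Rintegral_restrict (I J : set R) (f : R -> R) : I `<=` J ->
  \int[mu]_(x in J) (f \_ I) x = \int[mu]_(x in I) f x.
Proof. by move=> IJ; rewrite -Rintegral_mkcondr setIC (setIidl IJ). Qed.

Lemma primitive_of_continuous (P : R -> R) (T : R) : (forall t : R, t < T -> {for t, continuous P}) ->
  exists L : R -> R, forall t : R, t < T -> is_derive t 1 L (P t).
Proof.
move=> cP; pose c := T - 1.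
have iP a b : b < T -> mu.-integrable `[a, b] (EFin \o P).
  move=> bT; apply: continuous_compact_integrable; first exact: segment_compact.
  apply: continuous_in_subspaceT => x; rewrite inE/= in_itv/= => /andP[_ xb].
  by apply: cP; exact: le_lt_trans xb bT.
(* This difference is the oriented integral from [c] to [t], since at least one of the two segments
   is empty or a point. Moving the base point to [x0], left of [t] and [c], changes it by a
   constant. *)
exists (fun t => \int[mu]_(s in `[c, t]) P s - \int[mu]_(s in `[t, c]) P s) => t tT.
pose x0 := Num.min t c - 1; pose u := (t + T) / 2.
have [tu uT] : t < u /\ u < T by rewrite /u; split; lra.
have [x0t x0c] : x0 < t /\ x0 < c by rewrite /x0; case: (leP t c) => h; split; lra.
have cT : c < T by rewrite /c; lra.
have [dF F'] := @continuous_FTC1_closed R P x0 t u tu (iP _ _ uT) x0t (cP _ tT).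
have d0 : is_derive t 1 (fun s : R => - (\int[mu]_(x in `[x0, c]) P x) + \int[mu]_(x in `[x0, s]) P x) (P t).
  have dFt : is_derive t 1 (fun s : R => \int[mu]_(x in `[x0, s]) P x) (P t).
    by apply: DeriveDef; [exact: dF|rewrite -derive1E; exact: F'].
  exact: (@is_derive_add R (cst _) _ t 0 _ _ (is_derive_cst _ t (1 : R)) dFt (esym (add0r _))).
apply: near_eq_is_derive d0.
near=> s.
have x0s : x0 <= s by apply/ltW; near: s; exact: lt_nbhsr.
have sT : s < T by apply: (@lt_trans _ _ u) => //; near: s; exact: lt_nbhsl.
case: (leP c s) => cs.
  have -> : \int[mu]_(x in `[s, c]) P x = 0.
    move: cs; rewrite le_eqVlt => /predU1P[->|cs]; first by rewrite set_itv1 Rintegral_set1.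
    by rewrite set_itv_ge ?Rintegral_set0// bnd_simp -ltNge.
  have := @Rintegral_itvB R P (BLeft x0) (BRight s) c (iP _ _ sT).
  rewrite !bnd_simp => /(_ (ltW x0c) cs); rewrite Rintegral_itv_obnd_cbnd; last first.
    by apply: integrableS (iP c s sT) => //; exact: subset_itv_oc_cc.
  by move=> <-; ring.
have -> : \int[mu]_(x in `[c, s]) P x = 0.
  by rewrite set_itv_ge ?Rintegral_set0// bnd_simp -ltNge.
have := @Rintegral_itvB R P (BLeft x0) (BRight c) s (iP _ _ cT).
rewrite !bnd_simp => /(_ x0s (ltW cs)); rewrite Rintegral_itv_obnd_cbnd; last first.
  by apply: integrableS (iP s c cT) => //; exact: subset_itv_oc_cc.
by move=> <-; ring.
Unshelve. all: by end_near. Qed.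

Lemma is_derive_decay (L : R -> R) (c s p : R) : is_derive s 1 L p ->
  is_derive s 1 (fun s : R => expR (c - L s)) (- p * expR (c - L s)).
Proof.
move=> dL.
have d1 : is_derive s 1 (fun s : R => c + (-1) * L s) (- p).
  have d2 := @is_derive_scale R (-1) _ s _ _ dL (erefl _).
  by have := @is_derive_add R (cst c) _ s 0 _ _ (is_derive_cst _ s (1 : R)) d2 (erefl _); rewrite mulN1r add0r.
rewrite (_ : (fun s => expR (c - L s)) = (fun s => expR (c + (-1) * L s))); last by apply/funext => t; rewrite mulN1r.
have := @is_derive_comp R expR _ s _ _ _ (is_derive_expR _) d1 (erefl _).
by rewrite mulN1r mulrC; exact.
Qed.

End line_calculus.

(** * The test function behind the a priori bound *)

Section riccati_test.
Context {R : realType} (T : R) (q : R -> R).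
Local Notation mu := (@lebesgue_measure R).
Hypothesis q_ge0 : forall t, 0 <= q t.
Hypothesis q_meas : measurable_fun setT q.
Hypothesis q_ineq : forall (g : R -> R) (M a b : R), a <= b -> b < T ->
  measurable_fun setT g -> (forall s, `|g s| <= M) -> \int[mu]_(s in `[a, b]) g s = 0 ->
  (\int[mu]_t (q t * (\int[mu]_(s in `[a, b]) (g s * (s <= t)%R%:R)) ^+ 2)%:E <=
   \int[mu]_(s in `[a, b]) (g s ^+ 2)%:E)%E.

(** The energies of the two flanks of the test function: [1] on the left, and on the right that of a
    linear drop from [1] to [0] between [b] and the midpoint of [b] and [T]. The bound depends
    neither on [a] nor on [P], so it serves all iterates at once. *)
Definition riccati_bound (b : R) : R := 1 + ((b + T) / 2 - b)^-1.

(* The test function is [E] on [[a, b]], with linear flanks down to [0]; the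
   left flank has length [E a ^+ 2] and hence unit energy. *)
Lemma riccati_test (P L : R -> R) (a b : R) : a <= b -> b < T ->
  (forall t : R, t < T -> {for t, continuous P}) ->
  (forall t : R, t < T -> is_derive t 1 L (P t)) ->
  (\int[mu]_(s in `[a, b]) (q s * expR (L b - L s) ^+ 2)%:E <=
   (riccati_bound b + \int[mu]_(s in `[a, b]) (P s * expR (L b - L s)) ^+ 2)%:E)%E.
Proof.
move=> ab bT cP dL; pose E s := expR (L b - L s).
pose w s := - P s * E s.
have Eb : E b = 1 by rewrite /E subrr expR0.
have E0 s : 0 < E s by exact: expR_gt0.
have dE (s : R) : s < T -> is_derive s 1 E (w s) by move=> sT; exact: is_derive_decay (dL s sT).
have cw (s : R) : s < T -> {for s, continuous w}.
  move=> sT; apply: cvgM; last exact: is_derive_continuous (dE s sT).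
  by apply: cvgN; exact: cP.
have cwab : {within `[a, b], continuous w}.
  apply: continuous_in_subspaceT => x; rewrite inE/= in_itv/= => /andP[_ xb].
  by apply: cw; exact: le_lt_trans xb bT.
have aw : antiderivative_on a b E w.
  apply: antiderivative_onC1 => // x; rewrite in_itv/= => /andP[_ xb].
  by apply: dE; exact: le_lt_trans xb bT.
have [iw Ew] := aw.
have [Mw Mw0 HMw] := continuous_segment_bounded cwab.
pose T' := (b + T) / 2.
have [bT' T'T] : b < T' /\ T' < T by rewrite /T'; split; lra.
pose d := T' - b; have d0 : 0 < d by rewrite subr_gt0.
pose A := a - E a ^+ 2.
have Aa : A < a by rewrite /A ltrBlDr ltrDl exprn_gt0.
pose c1 := (E a)^-1; pose c3 := - d^-1.
(* The derivative of the test function: slope [c1] on the left flank, [w = E'] on [[a, b]], slope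
   [c3] on the right flank. *)
pose g s := (cst c1 \_ `[A, a[) s + (w \_ `[a, b]) s + (cst c3 \_ `]b, T']) s.
have mw : measurable_fun `[a, b] w by exact: subspace_continuous_measurable_fun.
have mg : measurable_fun setT g.
  apply: measurable_funD; first apply: measurable_funD.
  - by apply: measurable_restrict_itv; exact: measurable_cst.
  - exact: measurable_restrict_itv.
  - by apply: measurable_restrict_itv; exact: measurable_cst.
have gM s : `|g s| <= `|c1| + Mw + `|c3|.
  rewrite /g; apply: le_trans (ler_normD _ _) _; apply: lerD; last first.
    by rewrite patchE; case: ifP => _; rewrite /= ?normr0.
  apply: le_trans (ler_normD _ _) _; apply: lerD; first by rewrite patchE; case: ifP => _; rewrite /= ?normr0.
  by rewrite patchE mem_setE; case: ifPn => [/HMw//|_]; rewrite normr0.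
have gE s : g s = if (s < A) || (T' < s) then 0 else if s < a then c1 else if s <= b then w s else c3.
  rewrite /g !patchE !mem_setE !in_itv/=.
  case: (ltP s A) => sA /=.
    have -> : (a <= s) = false by apply/negbTE; rewrite -ltNge; lra.
    have -> : (b < s) = false by apply/negbTE; rewrite -leNgt; lra.
    by rewrite !addr0.
  case: (ltP s a) => sa /=.
    have -> : (T' < s) = false by apply/negbTE; rewrite -leNgt; lra.
    have -> : (b < s) = false by apply/negbTE; rewrite -leNgt; lra.
    by rewrite !addr0.
  case: (leP s b) => sb /=; last by case: (leP s T') => _; rewrite /= !add0r.
  have -> : (T' < s) = false by apply/negbTE; rewrite -leNgt; lra.
  by rewrite add0r addr0.
have sub1 : `[A, a[ `<=` `[A, T'] by move=> x /=; rewrite !in_itv/= => /andP[h1 h2]; rewrite h1 (le_trans (ltW h2))// (le_trans ab)// ltW.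
have sub2 : `[a, b] `<=` `[A, T'] by move=> x /=; rewrite !in_itv/= => /andP[h1 h2]; rewrite (le_trans (ltW Aa))// (le_trans h2)// ltW.
have sub3 : `]b, T'] `<=` `[A, T'] by move=> x /=; rewrite !in_itv/= => /andP[h1 h2]; rewrite h2 andbT (le_trans (ltW Aa))// (le_trans ab)// ltW.
have icst (c : R) (I : interval R) : [set` I] `<=` `[A, T'] -> mu.-integrable [set` I] (EFin \o cst c).
  move=> IJ; apply: (@integrableS _ _ _ mu `[A, T']) => //.
  exact: (@bounded_integrable_itv _ _ `|c|).
have mu1 (c : R) : \int[mu]_(x in `[A, a[) c = c * E a ^+ 2.
  transitivity (c * fine (mu `[A, a[%classic)); first exact: Rintegral_cst.
  rewrite lebesgue_measure_itv/= lte_fin Aa -EFinB/=.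
  by congr (_ * _); rewrite /A; ring.
have mu3 (c : R) : \int[mu]_(x in `]b, T']) c = c * d.
  transitivity (c * fine (mu `]b, T']%classic)); first exact: Rintegral_cst.
  by rewrite lebesgue_measure_itv/= lte_fin bT' -EFinB/=.
have Eint s : s \in `[a, b] -> \int[mu]_(x in `[a, s]) w x = E s - E a by move=> /Ew ->.
(* Kept general in the right end [s] and in the two constants: it computes the mean of [g], its
   energy, and the value of the test function at a point. *)
have split3 (x1 x3 : R) (f : R -> R) (s : R) : a <= s -> s <= b -> mu.-integrable `[a, s] (EFin \o f) ->
    \int[mu]_(x in `[A, T']) ((cst x1 \_ `[A, a[) x + (f \_ `[a, s]) x + (cst x3 \_ `]b, T']) x) =
    x1 * E a ^+ 2 + \int[mu]_(x in `[a, s]) f x + x3 * d.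
  move=> as_ sb fi.
  have subs : `[a, s] `<=` `[A, T'] by move=> x /=; rewrite !in_itv/= => /andP[h1 h2]; rewrite (le_trans (ltW Aa))// (le_trans h2)// (le_trans sb)// ltW.
  have j1 := integrable_restrict sub1 (icst x1 _ sub1).
  have j2 := integrable_restrict subs fi.
  have j3 := integrable_restrict sub3 (icst x3 _ sub3).
  rewrite RintegralD//; last exact: integrableD_EFin.
  by rewrite RintegralD// !Rintegral_restrict// mu1 mu3.
(* The test function climbs by [E a], changes by [1 - E a] on [[a, b]], and drops by [1]. *)
have g0 : \int[mu]_(s in `[A, T']) g s = 0.
  rewrite split3// Eint ?in_itv/= ?ab ?lexx// Eb /c1 /c3.
  by field; rewrite !gt_eqF.
have AT' : A <= T' by lra.
have := q_ineq AT' T'T mg gM g0.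
have -> : (\int[mu]_(s in `[A, T']) (g s ^+ 2)%:E =
    (riccati_bound b + \int[mu]_(s in `[a, b]) (P s * expR (L b - L s)) ^+ 2)%:E)%E.
  have iw2 : mu.-integrable `[a, b] (EFin \o (fun s => w s ^+ 2)).
    apply: continuous_compact_integrable; first exact: segment_compact.
    apply: continuous_in_subspaceT => x; rewrite inE/= in_itv/= => /andP[_ xb].
    by apply: cvg_sqr; apply: cw; exact: le_lt_trans xb bT.
  have ig2 : mu.-integrable `[A, T'] (EFin \o (fun s => g s ^+ 2)).
    apply: (@bounded_integrable_itv _ _ ((`|c1| + Mw + `|c3|) ^+ 2)); first exact: measurable_funX.
    by move=> s _; rewrite normrX lerXn2r ?nnegrE ?addr_ge0.
  rewrite -[LHS]fineK ?integrable_fin_num//; congr EFin; rewrite -/(Rintegral _ _ _).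
  transitivity (\int[mu]_(x in `[A, T']) ((cst (c1 ^+ 2) \_ `[A, a[) x + ((fun s => w s ^+ 2) \_ `[a, b]) x + (cst (c3 ^+ 2) \_ `]b, T']) x)).
    apply: eq_Rintegral => s _; rewrite gE !patchE !mem_setE !in_itv/=.
    case: (ltP s A) => sA /=.
      have -> : (a <= s) = false by apply/negbTE; rewrite -ltNge; lra.
      have -> : (b < s) = false by apply/negbTE; rewrite -leNgt; lra.
      by rewrite !addr0 expr0n.
    case: (ltP s a) => sa /=.
      have -> : (T' < s) = false by apply/negbTE; rewrite -leNgt; lra.
      have -> : (b < s) = false by apply/negbTE; rewrite -leNgt; lra.
      by rewrite !addr0.
    case: (leP s b) => sb /=; last by case: (leP s T') => _; rewrite /= ?add0r// expr0n.
    have -> : (T' < s) = false by apply/negbTE; rewrite -leNgt; lra.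
    by rewrite add0r addr0.
  rewrite split3// /riccati_bound -/T' -/d.
  rewrite (_ : c1 ^+ 2 * E a ^+ 2 = 1); last by rewrite /c1 -exprMn mulVf ?gt_eqF// expr1n.
  rewrite (_ : c3 ^+ 2 * d = d^-1); last by rewrite /c3; field; rewrite gt_eqF.
  rewrite addrAC; congr (_ + _); apply: eq_Rintegral => s _.
  by rewrite /w mulNr sqrrN.
apply: le_trans.
rewrite integral_mkcond; apply: ge0_le_integral => //.
- by move=> s _; rewrite patchE; case: ifP => // _; rewrite lee_fin mulr_ge0 ?sqr_ge0.
- apply/(measurable_restrictT _ _).1 => //; apply/measurable_EFinP.
  apply: measurable_funM; first exact: measurable_funTS.
  apply: measurable_funX; apply: subspace_continuous_measurable_fun => //.
  exact: antiderivative_continuous aw.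
- apply/measurable_EFinP; apply: measurable_funM => //; apply: measurable_funX.
  rewrite (_ : (fun t : R => _) = (fun t => \int[mu]_(x in `[A, t]) g x) \_ `[A, T']).
    apply: measurable_restrict_itv; apply: subspace_continuous_measurable_fun => //.
    by apply: parameterized_integral_continuous AT' _; exact: (@bounded_integrable_itv _ _ (`|c1| + Mw + `|c3|)).
  apply/funext => t; rewrite patchE mem_setE in_itv/=.
  case: (leP A t) => At /=; last first.
    rewrite /Rintegral integral0_eq// => s /=; rewrite in_itv/= => /andP[As _].
    by rewrite (_ : (s <= t)%R = false) ?mulr0//; apply/negbTE; rewrite -ltNge (lt_le_trans At).
  case: (leP t T') => tT' /=; last first.
    rewrite -[RHS]g0; apply: eq_Rintegral => s; rewrite mem_setE in_itv/= => /andP[_ sT'].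
    by rewrite (le_trans sT' (ltW tT')) mulr1.
  rewrite -(@Rintegral_restrict _ `[A, t] `[A, T']); last by apply: subset_itvl; rewrite bnd_simp.
  apply: eq_Rintegral => s; rewrite patchE !mem_setE !in_itv/= => /andP[-> _] /=.
  by case: (s <= t)%R; rewrite ?mulr1 ?mulr0.
- move=> t _; rewrite patchE; case: ifPn => [|_]; last by rewrite lee_fin mulr_ge0 ?sqr_ge0.
  rewrite mem_setE in_itv/= => /andP[at_ tb]; rewrite lee_fin.
  (* The left flank accounts for [c1 * E a ^+ 2 = E a], and [w] adds [E t - E a]. *)
  suff -> : \int[mu]_(s in `[A, T']) (g s * (s <= t)%R%:R) = E t by [].
  have iwt : mu.-integrable `[a, t] (EFin \o w).
    by apply: integrableS iw => //; apply: subset_itvl; rewrite bnd_simp.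
  transitivity (\int[mu]_(x in `[A, T']) ((cst c1 \_ `[A, a[) x + (w \_ `[a, t]) x + (cst 0 \_ `]b, T']) x)).
    apply: eq_Rintegral => s _; rewrite gE !patchE !mem_setE !in_itv/=.
    case: (ltP s A) => sA /=.
      have -> : (a <= s) = false by apply/negbTE; rewrite -ltNge; lra.
      have -> : (b < s) = false by apply/negbTE; rewrite -leNgt; lra.
      by rewrite !addr0 mul0r.
    case: (ltP s a) => sa /=.
      have -> : (T' < s) = false by apply/negbTE; rewrite -leNgt; lra.
      have -> : (b < s) = false by apply/negbTE; rewrite -leNgt; lra.
      by rewrite (_ : (s <= t)%R = true) ?mulr1 ?addr0//; apply/idP; lra.
    case: (leP s t) => st /=; last first.
      by rewrite mulr0 add0r; case: ifP; rewrite !addr0.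
    have -> : (T' < s) = false by apply/negbTE; rewrite -leNgt; lra.
    have -> : (s <= b)%R by lra.
    have -> : (b < s) = false by apply/negbTE; rewrite -leNgt; lra.
    by rewrite add0r addr0 mulr1.
  rewrite split3// Eint ?in_itv/= ?at_// mul0r addr0.
  rewrite (_ : c1 * E a ^+ 2 = E a); first by ring.
  by rewrite /c1 expr2 mulrA mulVf ?mul1r ?gt_eqF.
Qed.

End riccati_test.

Section riccati_iteration.
Context {R : realType} (T : R) (q : R -> R).
Local Notation mu := (@lebesgue_measure R).
Hypothesis q_ge0 : forall t, 0 <= q t.
Hypothesis q_meas : measurable_fun setT q.
Hypothesis q_ineq : forall (g : R -> R) (M a b : R), a <= b -> b < T ->
  measurable_fun setT g -> (forall s, `|g s| <= M) -> \int[mu]_(s in `[a, b]) g s = 0 ->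
  (\int[mu]_t (q t * (\int[mu]_(s in `[a, b]) (g s * (s <= t)%R%:R)) ^+ 2)%:E <=
   \int[mu]_(s in `[a, b]) (g s ^+ 2)%:E)%E.

(** Picard iterates of the Riccati equation, with the initial time [-oo] replaced by [- k], which
    moves left together with the iteration. Extended real values allow them to be defined before
    their finiteness is known. *)
Fixpoint riccati_iter (k : nat) (t : R) : \bar R :=
  if k is j.+1 then
    (\int[mu]_(s in `[(- k%:R)%R, t]) (riccati_iter j s * riccati_iter j s + (q s)%:E))%E
  else 0%E.

Local Notation f := riccati_iter.
Local Notation F k := (fun s => (f k s * f k s + (q s)%:E)%E).

Lemma riccati_iterS k t : f k.+1 t = (\int[mu]_(s in `[(- k.+1%:R)%R, t]) F k s)%E.
Proof. by []. Qed.

Lemma riccati_iter_ge0 k t : (0 <= f k t)%E.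
Proof.
elim: k t => //= k IH t; apply: integral_ge0 => s _.
by rewrite adde_ge0 ?mule_ge0 ?lee_fin.
Qed.

Let F_ge0 k s : (0 <= F k s)%E.
Proof. by rewrite adde_ge0 ?mule_ge0 ?riccati_iter_ge0 ?lee_fin. Qed.

Lemma measurable_riccati_iter k : measurable_fun setT (f k).
Proof.
elim: k => [|k IH]; first exact: measurable_cst.
have mF : measurable_fun setT (F k).
  by apply: emeasurable_funD; [exact: emeasurable_funM|exact/measurable_EFinP].
pose G (p : R * R) : \bar R := (F k p.2 * ((- k.+1%:R <= p.2)%R && (p.2 <= p.1)%R)%:R%:E)%E.
have mG : measurable_fun setT G.
  apply: emeasurable_funM; first by apply: (measurableT_comp mF); exact: measurable_snd.
  apply/measurable_EFinP.
  apply: (@measurableT_comp _ _ _ _ _ _ (fun b : bool => b%:R : R)) => //.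
  apply: measurable_and.
    by apply: measurable_fun_ler => //; exact: measurable_snd.
  by apply: measurable_fun_ler; [exact: measurable_snd|exact: measurable_fst].
rewrite (_ : f k.+1 = fun t => (\int[mu]_s G (t, s))%E).
  apply: (@measurable_fun_fubini_tonelli_F _ _ _ _ _ mu G) => // p.
  by rewrite mule_ge0// lee_fin.
apply/funext => t; rewrite [LHS]/= integral_mkcond; apply: eq_integral => s _.
rewrite patchE mem_setE in_itv/= /G /=.
by case: ifP => _; rewrite ?mule1 ?mule0.
Qed.

Let mF k : measurable_fun setT (F k).
Proof.
apply: emeasurable_funD; last exact/measurable_EFinP.
by apply: emeasurable_funM; exact: measurable_riccati_iter.
Qed.

Lemma riccati_iter_homo k (t t' : R) : t <= t' -> (f k t <= f k t')%E.
Proof.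
case: k => [//|k] tt' /=; apply: ge0_subset_integral => //.
- by apply: measurable_funTS; exact: mF.
- by apply: subset_itvl; rewrite bnd_simp.
Qed.

Lemma riccati_iter_le k t : (f k t <= f k.+1 t)%E.
Proof.
elim: k t => [|k IH] t; first exact: riccati_iter_ge0.
rewrite [leLHS]/= [leRHS]/=.
apply: (@le_trans _ _ (\int[mu]_(s in `[(- k.+1%:R)%R, t]) F k.+1 s)%E).
  apply: ge0_le_integral => //.
  - by apply: measurable_funTS; exact: mF.
  - by apply: measurable_funTS; exact: mF.
  - move=> s _; apply: leeD => //.
    by apply: lee_pmul; rewrite ?riccati_iter_ge0//; exact: IH.
apply: ge0_subset_integral => //.
- by apply: measurable_funTS; exact: mF.
- by apply: subset_itvr; rewrite bnd_simp lerN2 ler_nat.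
Qed.

(** The lower limit of the iterate moves with [k]; this form, with a fixed left end [x], is the one
    that passes to the limit. *)
Lemma riccati_iter_split k (x t : R) : - k.+1%:R <= x -> x <= t ->
  f k.+1 t = (f k.+1 x + \int[mu]_(s in `[x, t]) F k s)%E.
Proof.
move=> kx xt; rewrite [LHS]/=.
have -> : `[- k.+1%:R, t]%classic = `[- k.+1%:R, x]%classic `|` `]x, t]%classic.
  by apply: itv_bndbnd_setU; rewrite bnd_simp.
rewrite ge0_integral_setU//.
- by rewrite integral_itv_obnd_cbnd//; apply: measurable_funTS; exact: mF.
- by apply: measurable_funTS; exact: mF.
- apply/disj_setPS => s [] /=; rewrite !in_itv/= => /andP[_ sx] /andP[xs _].
  by have := lt_le_trans xs sx; rewrite ltxx.
Qed.

Let bound_ge0 b : b < T -> 0 <= riccati_bound T b.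
Proof. by move=> bT; rewrite /riccati_bound addr_ge0// invr_ge0; lra. Qed.

(** Local integrability of the potential is a consequence of the inequality: for [P = L = 0] the
    exponential is one and [riccati_test] bounds the integral of [q]. *)
Let iq (a b : R) : b < T -> mu.-integrable `[a, b] (EFin \o q).
Proof.
move=> bT; case: (leP a b) => ab; last first.
  by rewrite set_itv_ge ?bnd_simp -?ltNge//; exact: integrable_set0.
apply/integrableP; split; first by apply/measurable_EFinP; exact: measurable_funTS.
have c0 (t : R) : t < T -> {for t, continuous (cst 0 : R -> R)} by move=> _; exact: cvg_cst.
have d0 (t : R) : t < T -> is_derive t 1 (cst 0 : R -> R) ((cst 0 : R -> R) t) by move=> _; exact: is_derive_cst.
have H := @riccati_test R T q q_ge0 q_meas q_ineq _ _ _ _ ab bT c0 d0.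
apply: le_lt_trans (ltry (riccati_bound T b + \int[mu]_(s in `[a, b]) (cst 0 s * expR (cst 0 b - cst 0 s)) ^+ 2)).
apply: le_trans H; rewrite le_eqVlt; apply/orP; left; apply/eqP; apply: eq_integral => s _.
by rewrite /= subrr expR0 expr1n mulr1 ger0_norm.
Qed.

Section step.
Variable k : nat.
Hypothesis fbound : forall t, t < T -> (f k t <= (riccati_bound T t)%:E)%E.
Let P s := fine (f k s).
Hypothesis cP : forall t : R, t < T -> {for t, continuous P}.
Let a : R := - k.+1%:R.
Let p s := P s ^+ 2 + q s.

Let f_fin t : t < T -> f k t \is a fin_num.
Proof. by move=> tT; rewrite ge0_fin_numE ?riccati_iter_ge0// (le_lt_trans (fbound tT))// ltry. Qed.

Let P_ge0 s : 0 <= P s.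
Proof. by rewrite fine_ge0// riccati_iter_ge0. Qed.

Let mP : measurable_fun setT P.
Proof. by apply: measurableT_comp => //; exact: measurable_riccati_iter. Qed.

Let P_le (s b : R) : b < T -> s <= b -> P s <= riccati_bound T b.
Proof.
move=> bT sb; have sT := le_lt_trans sb bT.
rewrite -lee_fin fineK ?f_fin//; apply: le_trans (riccati_iter_homo k sb) _; exact: fbound.
Qed.

Let ip (x b : R) : b < T -> mu.-integrable `[x, b] (EFin \o p).
Proof.
move=> bT; apply: integrableD_EFin => //; last exact: iq.
apply: (@bounded_integrable_itv _ _ (riccati_bound T b ^+ 2)); first exact: measurable_funX.
move=> s; rewrite in_itv/= => /andP[_ sb]; rewrite normrX lerXn2r ?nnegrE//.
  exact: bound_ge0.
by rewrite ger0_norm//; exact: P_le.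
Qed.

Let fS (t : R) : t < T -> f k.+1 t = (\int[mu]_(s in `[a, t]) p s)%:E.
Proof.
move=> tT; rewrite riccati_iterS /Rintegral fineK; last by apply: integrable_fin_num => //; exact: ip.
apply: eq_integral => s; rewrite mem_setE in_itv/= => /andP[_ st].
have sT := le_lt_trans st tT.
by rewrite -(fineK (f_fin sT)) -EFinM -EFinD.
Qed.

Let Pn s := fine (f k.+1 s).

Let PnE (t : R) : t < T -> Pn t = \int[mu]_(s in `[a, t]) p s.
Proof. by move=> tT; rewrite /Pn fS. Qed.

Let P_le_Pn (t : R) : t < T -> P t <= Pn t.
Proof.
by move=> tT; rewrite -lee_fin !fineK ?f_fin ?fS//; rewrite -fS//; exact: riccati_iter_le.
Qed.

Lemma riccati_iter_continuous (t : R) : t < T -> {for t, continuous Pn}.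
Proof.
move=> tT; pose b := (t + T) / 2; pose x := Num.min t a - 1.
have [tb bT] : t < b /\ b < T by rewrite /b; split; lra.
have [xt xa] : x < t /\ x < a by rewrite /x; case: (leP t a) => h; split; lra.
(* Cutting the density off below [a] turns [Pn] near [t] into an integral from a base point [x] left
   of both, which also covers [t <= a]. *)
pose p' := p \_ `[a, +oo[.
have ip' : mu.-integrable `[x, b] (EFin \o p').
  apply: le_integrable (ip x bT) => //.
    apply/measurable_EFinP; apply: measurable_funTS; apply: measurable_restrict_itv.
    by apply: measurable_funTS; apply: measurable_funD => //; exact: measurable_funX.
  by move=> s _; rewrite /= lee_fin /p' patchE; case: ifP => // _; rewrite normr0.
have /(continuous_within_itvP _ (lt_trans xt tb))[+ _ _] := parameterized_integral_continuous (ltW (lt_trans xt tb)) ip'.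
move=> /(_ t); rewrite in_itv/= xt tb => /(_ isT) cF.
have e1 : {near t, parameterized_integral mu x ^~ p' =1 Pn}.
  near=> s.
  have xs : x < s by near: s; exact: lt_nbhsr.
  have sb : s < b by near: s; exact: lt_nbhsl.
  rewrite PnE ?(lt_trans sb)// /parameterized_integral /p' -Rintegral_mkcondr.
  congr (Rintegral _ _ _); apply/seteqP; split => z /=; rewrite !in_itv/= ?andbT.
    by move=> [/andP[_ ->] ->].
  by move=> /andP[az ->]; rewrite az (le_trans _ az)// ltW.
change (Pn s @[s --> t] --> Pn t); rewrite -(nbhs_singleton e1).
by apply: cvg_trans; [exact: (near_eq_cvg e1)|exact: cF].
Unshelve. all: by end_near. Qed.

(* By parts against [E ^+ 2], [E' = - P E]: since [P <= Pn],
   [Pn b = \int (p E^2 - 2 Pn P E^2) <= \int (q E^2 - (P E)^2)]. *)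
Lemma riccati_iter_bound (b : R) : b < T -> (f k.+1 b <= (riccati_bound T b)%:E)%E.
Proof.
move=> bT; case: (leP a b) => ab; last first.
  by rewrite [leLHS]/= set_itv_ge ?bnd_simp -?ltNge// integral_set0 lee_fin bound_ge0.
have [L dL] := primitive_of_continuous cP.
pose E s := expR (L b - L s); pose w s := - P s * E s.
have Eb : E b = 1 by rewrite /E subrr expR0.
have sT s : s \in `[a, b] -> s < T by rewrite in_itv/= => /andP[_ sb]; exact: le_lt_trans bT.
have dE (s : R) : s \in `[a, b] -> is_derive s 1 E (w s).
  by move=> /sT sT'; exact: is_derive_decay (dL s sT').
have cE (s : R) : s \in `[a, b] -> {for s, continuous E}.
  by move=> /dE; exact: is_derive_continuous.
have cw : {within `[a, b], continuous w}.
  apply: continuous_in_subspaceT => x; rewrite inE/= => xI.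
  by apply: cvgM; [apply: cvgN; apply: cP; exact: sT|exact: cE].
have aE : antiderivative_on a b E w by exact: antiderivative_onC1.
have aEE := antiderivative_onM ab aE aE.
have aPn : antiderivative_on a b Pn p.
  split; first exact: ip.
  move=> s sI; rewrite PnE ?sT// PnE; last by apply: le_lt_trans bT.
  by rewrite set_itv1 Rintegral_set1 subr0.
have Pna : Pn a = 0.
  by rewrite PnE ?(le_lt_trans ab)// set_itv1 Rintegral_set1.
have := antiderivativeM ab aPn aEE; rewrite Eb Pna !mulr1 mul0r subr0 => H.
have iqE : mu.-integrable `[a, b] (EFin \o (fun s => q s * E s ^+ 2)).
  rewrite (_ : EFin \o _ = EFin \o (fun x => (E x * E x) * q x)); last first.
    by apply/funext => s /=; rewrite mulrC expr2.
  exact: antiderivative_integrableM ab aEE (iq _ bT).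
have iPE : mu.-integrable `[a, b] (EFin \o (fun s => (P s * E s) ^+ 2)).
  apply: continuous_compact_integrable; first exact: segment_compact.
  apply: continuous_in_subspaceT => x; rewrite inE/= => xI.
  by apply: cvg_sqr; apply: cvgM; [apply: cP; exact: sT|exact: cE].
have Hle : Pn b <= \int[mu]_(s in `[a, b]) (q s * E s ^+ 2 - (P s * E s) ^+ 2).
  rewrite H; apply: le_Rintegral => //.
  - exact: (antiderivative_onM ab aPn aEE).1.
  - exact: integrableB_EFin.
  - move=> s sI; rewrite -subr_ge0.
    rewrite (_ : _ - _ = 2 * (Pn s - P s) * P s * E s ^+ 2); last by rewrite /p /w; ring.
    have Ps : 0 <= Pn s - P s by rewrite subr_ge0 P_le_Pn// sT.
    by rewrite mulr_ge0 ?sqr_ge0// mulr_ge0// mulr_ge0.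
(* The test bounds the integral of [q E^2] by [riccati_bound] plus the integral of [(P E)^2], and
   the latter is finite and is exactly what [Hle] subtracts. *)
have := @riccati_test R T q q_ge0 q_meas q_ineq P L a b ab bT cP dL.
rewrite -[leLHS]fineK; last by exact: integrable_fin_num.
rewrite lee_fin -/(Rintegral _ _ _) => Hq.
rewrite fS// lee_fin -PnE// (le_trans Hle)// RintegralB// lerBlDr.
exact: Hq.
Qed.

End step.

Lemma riccati_iter_regular k : (forall t, t < T -> (f k t <= (riccati_bound T t)%:E)%E) /\
  (forall t : R, t < T -> {for t, continuous (fun s => fine (f k s))}).
Proof.
elim: k => [|k [IHb IHc]].
  split=> t tT; first by rewrite lee_fin bound_ge0.
  exact: cvg_cst.
by split=> t tT; [exact: riccati_iter_bound|exact: riccati_iter_continuous].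
Qed.

(** The limit of the increasing iterates is finite by [riccati_bound]. The identity
    [riccati_iter_split], valid once [- k.+1%:R <= x], passes to it by monotone convergence; the
    finiteness of the limit also gives integrability of its density. *)
Lemma riccati_solution : exists2 P : R -> R, forall t, 0 <= P t &
  forall a b : R, a <= b -> b < T -> antiderivative_on a b P (fun s => P s ^+ 2 + q s).
Proof.
have nd t : {homo f ^~ t : n m / (n <= m)%N >-> (n <= m)%E}.
  by apply: homo_leq => [x//|x y z|k]; [exact: le_trans|exact: riccati_iter_le].
pose G t := limn (f ^~ t).
have cG t : f k t @[k --> \oo] --> G t by exact: ereal_nondecreasing_is_cvgn.
have G0 t : (0 <= G t)%E.
  by apply: lime_ge; [exact: ereal_nondecreasing_is_cvgn|near=> k; exact: riccati_iter_ge0].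
have Gle t : t < T -> (G t <= (riccati_bound T t)%:E)%E.
  move=> tT; apply: lime_le; first exact: ereal_nondecreasing_is_cvgn.
  by near=> k; exact: (riccati_iter_regular k).1.
have Gfin t : t < T -> G t \is a fin_num.
  by move=> tT; rewrite ge0_fin_numE// (le_lt_trans (Gle _ tT))// ltry.
pose P t := fine (G t).
have mP : measurable_fun setT P.
  apply: measurableT_comp => //; apply: (emeasurable_fun_cvg (fun k => f k)).
    by move=> k; exact: measurable_riccati_iter.
  by move=> t _; exact: cG.
have P0 t : 0 <= P t by rewrite fine_ge0.
have GE (x t : R) : x <= t -> t < T -> G t = (G x + \int[mu]_(s in `[x, t]) (P s ^+ 2 + q s)%:E)%E.
  move=> xt tT; have xT := le_lt_trans xt tT.
  have c1 : f k.+1 t @[k --> \oo] --> G t by have := cG t; rewrite -cvg_shiftS.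
  have c2 : f k.+1 x @[k --> \oo] --> G x by have := cG x; rewrite -cvg_shiftS.
  have c3 := @cvg_monotone_convergence _ _ R mu `[x, t] (measurable_itv _) (fun k => F k)
    (fun k => measurable_funTS (mF k)) (fun k s _ => F_ge0 k s).
  have {}c3 : (\int[mu]_(s in `[x, t]) F k s)%E @[k --> \oo] --> (\int[mu]_(s in `[x, t]) (P s ^+ 2 + q s)%:E)%E.
    have ndF (s : R) : `[x, t]%classic s -> {homo (fun k => F k s) : n m / (n <= m)%N >-> (n <= m)%E}.
      move=> _ n m nm /=; apply: leeD => //.
      by apply: lee_pmul; rewrite ?riccati_iter_ge0//; exact: nd.
    have := c3 ndF; rewrite (_ : integral mu _ _ = \int[mu]_(s in `[x, t]) (P s ^+ 2 + q s)%:E)%E//.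
    apply: eq_integral => s; rewrite mem_setE in_itv/= => /andP[_ st].
    have sT := le_lt_trans st tT.
    apply/cvg_lim => //.
    rewrite EFinD expr2 EFinM /P fineK ?Gfin//.
    apply: cvgeD; [| |exact: cvg_cst].
      by rewrite fin_num_adde_defl.
    by apply: cvgeM; [rewrite mule_def_fin ?Gfin|exact: cG|exact: cG].
  have c4 : (f k.+1 x + \int[mu]_(s in `[x, t]) F k s)%E @[k --> \oo] -->
      (G x + \int[mu]_(s in `[x, t]) (P s ^+ 2 + q s)%:E)%E.
    apply: cvgeD => //; rewrite fin_num_adde_defr// Gfin//.
  have e1 : \forall k \near \oo, f k.+1 t = (f k.+1 x + \int[mu]_(s in `[x, t]) F k s)%E.
    near=> k; apply: riccati_iter_split => //.
    rewrite lerNl; apply: (@le_trans _ _ k%:R); last by rewrite ler_nat.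
    by near: k; exact: nbhs_infty_ger.
  apply: (cvg_unique _ c1); first exact: ereal_hausdorff.
  apply: cvg_trans c4; apply: near_eq_cvg.
  by apply: filterS e1 => k ->.
exists P => // a b ab bT.
have ip (s : R) : s \in `[a, b] -> mu.-integrable `[a, s] (EFin \o (fun s => P s ^+ 2 + q s)).
  rewrite in_itv/= => /andP[as_ sb].
  have sT := le_lt_trans sb bT; have aT := le_lt_trans as_ sT.
  apply/integrableP; split.
    by apply/measurable_EFinP; apply: measurable_funTS; apply: measurable_funD => //; exact: measurable_funX.
  apply: (@le_lt_trans _ _ (\int[mu]_(x in `[a, s]) (P x ^+ 2 + q x)%:E)%E).
    rewrite le_eqVlt; apply/orP; left; apply/eqP; apply: eq_integral => z _.
    by rewrite /= ger0_norm// addr_ge0// sqr_ge0.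
  have := Gfin _ sT; rewrite (GE a s)// fin_numD => /andP[_].
  by rewrite ge0_fin_numE//; apply: integral_ge0 => z _; rewrite lee_fin addr_ge0// sqr_ge0.
split; first by apply: ip; rewrite in_itv/= ab lexx.
move=> s sI; have := sI; rewrite in_itv/= => /andP[as_ sb].
have sT := le_lt_trans sb bT; have aT := le_lt_trans as_ sT.
have IE : (\int[mu]_(x in `[a, s]) (P x ^+ 2 + q x)%:E = (\int[mu]_(x in `[a, s]) (P x ^+ 2 + q x))%:E)%E.
  by rewrite /Rintegral fineK//; apply: integrable_fin_num => //; exact: ip.
have := GE a s as_ sT; rewrite IE -(fineK (Gfin _ sT)) -(fineK (Gfin _ aT)) -EFinD => E.
have -> : P s = P a + \int[mu]_(x in `[a, s]) (P x ^+ 2 + q x) by exact: EFin_inj E.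
by rewrite addrC addKr.
Unshelve. all: by end_near. Qed.

End riccati_iteration.

(** * From the Riccati equation back to the radial equation *)

Section solution_of_riccati.
Context {R : realType} (rho : R) (v P : R -> R).
Local Notation mu := (@lebesgue_measure R).
Hypothesis rho0 : 0 < rho.
Hypothesis v_ge0 : forall r, r \in `]0, rho[ -> 0 <= v r.
Hypothesis v_meas : measurable_fun `]0, rho[ v.
Hypothesis P_ge0 : forall t, 0 <= P t.
Local Notation T := (ln rho).
Local Notation q := (log_potential rho v).
Hypothesis P_riccati : forall a b : R, a <= b -> b < T ->
  antiderivative_on a b P (fun s => P s ^+ 2 + q s).

Let ln_lt r : r \in `]0, rho[ -> ln r < T.
Proof. by rewrite in_itv/= => /andP[r0 rr]; rewrite ltr_ln. Qed.

Let cP (t : R) : t < T -> {for t, continuous P}.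
Proof.
move=> tT; pose b := (t + T) / 2.
have [tb bT] : t < b /\ b < T by rewrite /b; split; lra.
have t1 : t - 1 < t by rewrite gtrBl.
have := antiderivative_continuous (ltW (lt_trans t1 tb)) (P_riccati (ltW (lt_trans t1 tb)) bT).
move=> /(continuous_within_itvP _ (lt_trans t1 tb))[+ _ _].
by move=> /(_ t); rewrite in_itv/= t1 tb; exact.
Qed.

Let ge0_integral_expR_segment (f : R -> R) (a b : R) : 0 < a -> 0 < b ->
  measurable_fun `[a, b] f -> (forall r, r \in `[a, b] -> 0 <= f r) ->
  (\int[mu]_(r in `[a, b]) (f r)%:E = \int[mu]_(t in `[ln a, ln b]) (f (expR t) * expR t)%:E)%E.
Proof.
move=> a0 b0 mf f0.
have := @ge0_integral_expR_itv R (f \_ `[a, b]) (ln a) (ln b) (measurable_restrict_itv mf).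
rewrite !lnK ?posrE// => H.
transitivity (\int[mu]_(r in `[a, b]) ((f \_ `[a, b]) r)%:E)%E.
  by apply: eq_integral => r rI; rewrite patchE rI.
rewrite H; last by move=> r; rewrite patchE mem_setE; case: ifPn => // /f0.
apply: eq_integral => t; rewrite mem_setE in_itv/= => /andP[at_ tb].
rewrite patchE mem_setE in_itv/=.
by rewrite -[a]lnK// ler_expR at_ -[b]lnK// ler_expR tb.
Qed.

(** Formally [Y = exp (- L)] with [L' = P] satisfies [Y'' = (P^2 - P') Y = - q Y]. As [P] is only
    absolutely continuous, this is done in integrated form in [t] and then transported to [r]. *)
Lemma positive_solution_of_riccati : has_positive_solution rho v.
Proof.
have [L dL] := primitive_of_continuous cP.
pose Y t := expR (0 - L t).
have Y0 t : 0 < Y t by exact: expR_gt0.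
have dY (t : R) : t < T -> is_derive t 1 Y (- P t * Y t) by move=> tT; exact: is_derive_decay (dL t tT).
have cY (t : R) : t < T -> {for t, continuous Y} by move=> /dY; exact: is_derive_continuous.
pose y r := Y (ln r).
pose y1 r := - P (ln r) * Y (ln r) * r^-1.
have dy (r : R) : r \in `]0, rho[ -> is_derive r 1 y (y1 r).
  move=> rI; have r0 : 0 < r by move: rI; rewrite in_itv/= => /andP[].
  exact: (@is_derive_comp R Y (fun r => ln r) r _ _ _ (dY _ (ln_lt rI)) (is_derive1_ln r0) (erefl _)).
have y1E (r : R) : r \in `]0, rho[ -> derive1 y r = y1 r by move=> /dy dyr; rewrite derive1E derive_val.
have cln (r : R) : r \in `]0, rho[ -> {for r, continuous (fun r : R => ln r)}.
  by rewrite in_itv/= => /andP[r0 _]; exact: continuous_ln.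
have cPln (r : R) : r \in `]0, rho[ -> {for r, continuous (fun r : R => P (ln r))}.
  by move=> rI; apply: (@continuous_comp _ _ _ (fun r : R => ln r) P); [exact: cln|apply: cP; exact: ln_lt].
have cy (r : R) : r \in `]0, rho[ -> {for r, continuous y}.
  by move=> /dy; exact: is_derive_continuous.
(* The second derivative dictated by the equation is [f2 - f1], since [f2 r = - y1 r / r]. *)
pose f1 r := v r * y r; pose f2 r := P (ln r) * y r / r ^+ 2.
have my : measurable_fun `]0, rho[ y.
  by apply: open_continuous_measurable_fun; [exact: interval_open|move=> r /set_mem; exact: cy].
have mPln : measurable_fun `]0, rho[ (fun r : R => P (ln r)).
  by apply: open_continuous_measurable_fun; [exact: interval_open|move=> r /set_mem; exact: cPln].
have mf1 : measurable_fun `]0, rho[ f1 by exact: measurable_funM.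
have mf2 : measurable_fun `]0, rho[ f2.
  apply: measurable_funM; first exact: measurable_funM.
  apply: (@measurable_funTS).
  by apply: (@measurableT_comp _ _ _ _ _ _ (fun r : R => r^-1)); [exact: measurable_invr|exact: measurable_funX].
have sub (a b : R) : 0 < a -> b < rho -> `[a, b] `<=` `]0, rho[.
  by move=> a0 br r /=; rewrite !in_itv/= => /andP[ar rb]; rewrite (lt_le_trans a0 ar) (le_lt_trans rb br).
have f10 r : r \in `]0, rho[ -> 0 <= f1 r by move=> rI; rewrite mulr_ge0 ?v_ge0// ltW// Y0.
have f20 r : 0 <= f2 r by rewrite !mulr_ge0 ?invr_ge0 ?sqr_ge0// ltW// Y0.
have key (a b : R) : 0 < a -> a <= b -> b < rho ->
    [/\ mu.-integrable `[a, b] (EFin \o f1), mu.-integrable `[a, b] (EFin \o f2) &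
        y1 b - y1 a = \int[mu]_(r in `[a, b]) (f2 r - f1 r)].
  move=> a0 ab br; have b0 := lt_le_trans a0 ab.
  have bI : b \in `]0, rho[ by rewrite in_itv/= b0.
  have aI : a \in `]0, rho[ by rewrite in_itv/= a0 (le_lt_trans ab).
  have lab : ln a <= ln b by rewrite ler_ln.
  have lbT := ln_lt bI.
  (* In the variable [t], [y1] is [- P W]. Here [W' = - (P + 1) W], so the density of [P W] is
     [(P^2 + q) W - P (P + 1) W = q W - P W]: the square drops out. *)
  pose W t := Y t * expR (- t).
  have inT (t : R) : t \in `[ln a, ln b] -> t < T by rewrite in_itv/= => /andP[_ tb]; exact: le_lt_trans lbT.
  have dW (t : R) : t \in `[ln a, ln b] -> is_derive t 1 W (- (P t + 1) * W t).
    move=> /inT tT; 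
    have d1 : is_derive t 1 (fun t : R => expR (- t)) (- expR (- t)).
      have := is_derive_decay 0 (is_derive_id t 1).
      by under eq_fun do rewrite sub0r; rewrite sub0r mulN1r.
    by apply: is_derive_mul (dY t tT) d1 _; rewrite /W; ring.
  have cW (t : R) : t \in `[ln a, ln b] -> {for t, continuous W} by move=> /dW; exact: is_derive_continuous.
  have aW : antiderivative_on (ln a) (ln b) W (fun t => - (P t + 1) * W t).
    apply: antiderivative_onC1 => //.
    apply: continuous_in_subspaceT => t; rewrite inE/= => tI.
    apply: cvgM; last exact: cW.
    by apply: cvgN; apply: cvgD; [apply: cP; exact: inT|exact: cvg_cst].
  have aP := P_riccati lab lbT.
  have := antiderivativeM lab aP aW.
  have ePW : \int[mu]_(t in `[ln a, ln b]) ((P t ^+ 2 + q t) * W t + P t * (- (P t + 1) * W t)) =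
      \int[mu]_(t in `[ln a, ln b]) (q t * W t - P t * W t).
    by apply: eq_Rintegral => t _; ring.
  have iPW : mu.-integrable `[ln a, ln b] (EFin \o (fun t => P t * W t)).
    apply: continuous_compact_integrable; first exact: segment_compact.
    apply: continuous_in_subspaceT => t; rewrite inE/= => tI.
    by apply: cvgM; [apply: cP; exact: inT|exact: cW].
  have iqW : mu.-integrable `[ln a, ln b] (EFin \o (fun t => q t * W t)).
    rewrite (_ : EFin \o _ = EFin \o (fun t => ((P t ^+ 2 + q t) * W t + P t * (- (P t + 1) * W t)) + P t * W t)).
      by apply: integrableD_EFin => //; exact: (antiderivative_onM lab aP aW).1.
    by apply/funext => t /=; congr EFin; ring.
  rewrite ePW RintegralB// => E.
  have T1 : (\int[mu]_(r in `[a, b]) (f1 r)%:E = (\int[mu]_(t in `[ln a, ln b]) (q t * W t))%:E)%E.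
    rewrite ge0_integral_expR_segment//; last 2 first.
    - by apply: measurable_funS mf1 => //; exact: sub.
    - by move=> r rI; apply: f10; exact: (sub _ _ a0 br).
    rewrite /Rintegral fineK ?integrable_fin_num//; apply: eq_integral => t; rewrite mem_setE => /inT tT.
    congr EFin; rewrite /f1 /y /W expRK /log_potential potentialE; last first.
      by rewrite in_itv/= expR_gt0/= -[ltRHS]lnK ?posrE// ltr_expR.
    by rewrite expRN; field; rewrite gt_eqF// expR_gt0.
  have T2 : (\int[mu]_(r in `[a, b]) (f2 r)%:E = (\int[mu]_(t in `[ln a, ln b]) (P t * W t))%:E)%E.
    rewrite ge0_integral_expR_segment//; last first.
    - by apply: measurable_funS mf2 => //; exact: sub.
    rewrite /Rintegral fineK ?integrable_fin_num//; apply: eq_integral => t _.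
    congr EFin; rewrite /f2 /y /W expRK expRN.
    by field; rewrite gt_eqF// expR_gt0.
  have if1 : mu.-integrable `[a, b] (EFin \o f1).
    apply/integrableP; split; first by apply/measurable_EFinP; apply: measurable_funS mf1 => //; exact: sub.
    apply: (@le_lt_trans _ _ (\int[mu]_(r in `[a, b]) (f1 r)%:E)%E); last by rewrite T1 ltry.
    rewrite le_eqVlt; apply/orP; left; apply/eqP; apply: eq_integral => r; rewrite inE/= => /(sub _ _ a0 br) rI.
    by rewrite /= ger0_norm// f10.
  have if2 : mu.-integrable `[a, b] (EFin \o f2).
    apply/integrableP; split; first by apply/measurable_EFinP; apply: measurable_funS mf2 => //; exact: sub.
    apply: (@le_lt_trans _ _ (\int[mu]_(r in `[a, b]) (f2 r)%:E)%E); last by rewrite T2 ltry.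
    rewrite le_eqVlt; apply/orP; left; apply/eqP; apply: eq_integral => r _.
    by rewrite /= ger0_norm.
  split=> //; rewrite RintegralB//.
  have -> : \int[mu]_(r in `[a, b]) f1 r = \int[mu]_(t in `[ln a, ln b]) (q t * W t) by rewrite {1}/Rintegral T1.
  have -> : \int[mu]_(r in `[a, b]) f2 r = \int[mu]_(t in `[ln a, ln b]) (P t * W t) by rewrite {1}/Rintegral T2.
  have -> : y1 a = - (P (ln a) * W (ln a)) by rewrite /y1 /W expRN lnK ?posrE//; ring.
  have -> : y1 b = - (P (ln b) * W (ln b)) by rewrite /y1 /W expRN lnK ?posrE//; ring.
  by rewrite opprK addrC -[LHS]opprB E opprB.
exists y; last by move=> r _; exact: Y0.
split; first by move=> r rI; have [] := dy r rI.
exists (fun r => f2 r - f1 r); split.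
- split; [exact: measurable_funB|exact: interval_open|].
  move=> K KI cK; have [->|/set0P K0] := eqVneq K set0; first by rewrite integral_set0 ltry.
  (* A nonempty compact subset of []0, rho[] lies between its minimum and its maximum, which are
     inside the interval; [key] applies there. The minimum is found by maximizing [- r]. *)
  have cid : {within K, continuous (fun r : R => r)} by apply: continuous_subspaceT => x; exact: cvg_id.
  have cidN : {within K, continuous (fun r : R => - r)}.
    by apply: continuous_subspaceT => x; apply: cvgN; exact: cvg_id.
  have [b Kb Hb] := compact_EVT_max K0 cK cid.
  have [a Ka Ha] := compact_EVT_max K0 cK cidN.
  have a0 : 0 < a by have := KI _ (set_mem Ka); rewrite /= in_itv/= => /andP[].
  have br : b < rho by have := KI _ (set_mem Kb); rewrite /= in_itv/= => /andP[].
  have [if1 if2 _] := key a b a0 (Hb _ Ka) br.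
  have i12 : mu.-integrable `[a, b] (EFin \o (fun r => f2 r - f1 r)) by exact: integrableB_EFin.
  have /integrableP[my2 fin2] := i12.
  apply: le_lt_trans fin2; apply: ge0_subset_integral => //.
  + exact: compact_measurable.
  + apply/measurable_EFinP; apply: measurableT_comp => //; exact/measurable_EFinP.
  + by move=> r Kr /=; rewrite in_itv/= Hb ?inE// andbT -lerN2 Ha ?inE.
- move=> a b a0 ab br.
  rewrite !y1E ?in_itv/= ?a0 ?(lt_trans ab)// ?(lt_trans a0 ab)//.
  by have [] := key a b a0 (ltW ab) br.
- apply: aeW => r rI; rewrite y1E//; have r0 : r != 0 by move: rI; rewrite in_itv/= => /andP[/gt_eqF ->].
  by rewrite /f1 /f2 /y1 /y; field.
Qed.

End solution_of_riccati.

(** * The equivalence *)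

Section hardy_equivalence.
Context {R : realType} {n : nat} (rho : R).
Local Notation leb := (lebesgue_rV R n.+1).
Local Notation m := ((n.+1%:R - 2) / 2 : R).
Hypothesis n_ge1 : (1 <= n)%N.
Hypothesis rho0 : 0 < rho.

Let m2 : 2 * m + 2 = n.+1%:R.
Proof. by field. Qed.

Let m_ge0 : 0 <= m.
Proof. by rewrite divr_ge0// subr_ge0 ler_nat. Qed.

Section potential_integral.
Variables (V : 'rV[R]_n.+1 -> R) (v : R -> R).
Hypothesis v_ge0 : forall r, r \in `]0, rho[ -> 0 <= v r.
Hypothesis v_meas : measurable_fun `]0, rho[ v.
Hypothesis V_radial : forall x, 0 < enorm x < rho -> V x = v (enorm x).

Lemma measurable_potential_enorm : measurable_fun setT (fun x : 'rV[R]_n.+1 => potential rho v (enorm x)).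
Proof. by apply: (measurableT_comp (measurable_potential v_meas)); exact: measurable_enorm. Qed.

(* [V] is constrained, and [V u^2] nonnegative, only away from the origin. *)
Lemma integral_radial_potential (u : 'rV[R]_n.+1 -> R) : measurable_fun (eball rho) u ->
  (\int[leb]_(x in eball rho) (V x * u x ^+ 2)%:E =
   \int[leb]_(x in eball rho) (potential rho v (enorm x) * u x ^+ 2)%:E)%E.
Proof.
move=> mu_; have mB := @measurable_eball R n.+1 rho.
have enorm0 : enorm (0 : 'rV[R]_n.+1) = 0 by apply/eqP; rewrite enorm_eq0.
(* A measurable function that agrees with [V] on the whole ball, the origin included, whatever the
   value [V 0]. *)
pose V' (x : 'rV[R]_n.+1) := potential rho v (enorm x) + V 0 * \1_[set (0 : 'rV[R]_n.+1)] x.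
have V'E x : eball rho x -> V x = V' x.
  move=> xr; rewrite /V' indicE; have [->|x0] := eqVneq x 0.
    rewrite enorm0 mem_set// mulr1 /potential patchE mem_setE in_itv/= ltxx/= add0r//.
  rewrite memNset; last by move=> /= /eqP; rewrite (negbTE x0).
  have xI : 0 < enorm x < rho by rewrite enorm_gt0 x0.
  by rewrite mulr0 addr0 potentialE ?in_itv// V_radial.
transitivity (\int[leb]_(x in eball rho) (V' x * u x ^+ 2)%:E)%E.
  by apply: eq_integral => x; rewrite inE => /V'E ->.
have mpot := measurable_potential_enorm.
apply: ae_eq_integral => //.
- apply/measurable_EFinP; apply: measurable_funM; last exact: measurable_funX.
  apply: measurable_funTS; apply: measurable_funD => //; apply: measurable_funM => //.
  by apply: measurable_indic; exact: measurable_set0_rV.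
- apply/measurable_EFinP; apply: measurable_funM; last exact: measurable_funX.
  exact: measurable_funTS.
- exists [set (0 : 'rV[R]_n.+1)]; split; [exact: measurable_set0_rV|exact: lebesgue_rV_set0|].
  move=> x /= Hx; apply/eqP; apply: contra_notT Hx => x0 _.
  rewrite /V' indicE memNset ?mulr0 ?addr0//.
  by move=> /= /eqP; rewrite (negbTE x0).
Qed.

Lemma hardy_of_positive_solution : has_positive_solution rho v ->
  forall u g, H10 (eball rho) u g ->
  (\int[leb]_(x in eball rho) (V x * u x ^+ 2)%:E <= hardy_deficit (eball rho) u g)%E.
Proof.
move=> [y y_sol y_gt0] u g Hug; have [[[mu_ _] Hg _] _] := Hug.
have mB := @measurable_eball R n.+1 rho.
have := @hardy_H10 R n.+1 rho (hardy_weight rho v m) (hardy_weight_ge0 v_ge0 m)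
  (@measurable_hardy_weight R n rho v v_meas m)
  (fun phi => @hardy_test_function R n rho v y rho0 v_ge0 v_meas y_sol y_gt0 m m_ge0 m2 phi) u g Hug.
have mu2 : measurable_fun (eball rho) (fun x => u x ^+ 2) by exact: measurable_funX.
have mI : measurable_fun (eball rho) (fun x : 'rV[R]_n.+1 => u x ^+ 2 / enorm x ^+ 2).
  apply: measurable_funM => //; apply: measurable_funTS.
  apply: (@measurableT_comp _ _ _ _ _ _ (fun r : R => r^-1)); first exact: measurable_invr.
  by apply: measurable_funX; exact: measurable_enorm.
have -> : (\int[leb]_(x in eball rho) (hardy_weight rho v m x * u x ^+ 2)%:E =
    (m ^+ 2)%:E * \int[leb]_(x in eball rho) (u x ^+ 2 / enorm x ^+ 2)%:E +
    \int[leb]_(x in eball rho) (potential rho v (enorm x) * u x ^+ 2)%:E)%E.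
  rewrite -ge0_integralZl//; last 3 first.
  - exact/measurable_EFinP.
  - by move=> x _; rewrite lee_fin mulr_ge0 ?invr_ge0 ?sqr_ge0.
  - by rewrite lee_fin sqr_ge0.
  rewrite -ge0_integralD//.
  - by apply: eq_integral => x _; rewrite -EFinM -EFinD /hardy_weight; congr EFin; ring.
  - by move=> x _; rewrite -EFinM lee_fin mulr_ge0 ?sqr_ge0// divr_ge0 ?sqr_ge0.
  - by apply/measurable_EFinP; apply: measurable_funM.
  - by move=> x _; rewrite lee_fin mulr_ge0 ?sqr_ge0// potential_ge0.
  - apply/measurable_EFinP; apply: measurable_funM => //.
    by apply: measurable_funTS; exact: measurable_potential_enorm.
rewrite (integral_radial_potential mu_) /hardy_deficit.
set A := (X in ((_%:E * X)%E)); set C := (X in (_ + X <= _)%E); set G := (X in (_ <= X)%E).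
have C0 : (0 <= C)%E by apply: integral_ge0 => x _; rewrite lee_fin mulr_ge0 ?sqr_ge0// potential_ge0.
have A0 : (0 <= (m ^+ 2)%:E * A)%E.
  rewrite mule_ge0 ?lee_fin ?sqr_ge0//; apply: integral_ge0 => x _.
  by rewrite lee_fin mulr_ge0 ?invr_ge0 ?sqr_ge0.
have Gfin : (G < +oo)%E.
  rewrite /G; under eq_integral do rewrite -sumEFin.
  rewrite ge0_integral_sum//; last 2 first.
  - by move=> i; apply/measurable_EFinP; apply: measurable_funX; exact: (Hg i).1.
  - by move=> i x _; rewrite lee_fin sqr_ge0.
  by apply: lte_sum_pinfty => i _; exact: (Hg i).2.
(* The Hardy integral is at most the gradient integral, which is finite, so it may be moved across
   the inequality in the extended reals. *)
move=> H; rewrite leeBrDr; first by rewrite addeC.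
by rewrite ge0_fin_numE// (le_lt_trans _ Gfin)// (le_trans _ H)// leeDl.
Qed.

Lemma positive_solution_of_hardy :
  (forall u g, H10 (eball rho) u g ->
    (\int[leb]_(x in eball rho) (V x * u x ^+ 2)%:E <= hardy_deficit (eball rho) u g)%E) ->
  has_positive_solution rho v.
Proof.
move=> hardy.
have q_ineq := @line_inequality_bounded R n rho V v m rho0 v_ge0 v_meas V_radial m2
  (fun u tu => hardy _ _ (test_function_H10 tu)).
have [P P0 HP] := riccati_solution (log_potential_ge0 v_ge0) (measurable_log_potential v_meas) q_ineq.
exact: positive_solution_of_riccati rho0 v_ge0 v_meas P0 HP.
Qed.

End potential_integral.
End hardy_equivalence.

(** The constant one solves the equation with zero potential. This puts [0] in the second set of the
    formula for the best constant, and through the equivalence also in the first. *)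
Lemma positive_solution0 (R : realType) (rho : R) (v : R -> R) :
  has_positive_solution rho (fun r => 0 * v r).
Proof.
have d0 : derive1 (cst 1 : R -> R) = cst 0 by apply/funext => x; rewrite derive1_cst.
exists (cst 1) => //; split; first by move=> r _; exact: derivable_cst.
exists (cst 0); split.
- split; [exact: measurable_cst|exact: interval_open|].
  by move=> K _ _; rewrite integral0_eq// => x _; rewrite /= normr0.
- by move=> a b _ _ _; rewrite d0 /= subrr /Rintegral integral0_eq.
- by apply: aeW => r _; rewrite d0 /= !mul0r !addr0.
Qed.

Theorem theorem2p1 (R : realType) (n : nat) (rho : R)
    (V : 'rV[R]_n -> R) (v : R -> R)
    (n_ge3 : (3 <= n)%N) (rho_gt0 : 0 < rho)
    (v_ge0 : forall r, r \in `]0, rho[ -> 0 <= v r)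
    (v_meas : measurable_fun `]0, rho[ v)
    (V_radial : forall x, 0 < enorm x < rho -> V x = v (enorm x)) :
  (has_positive_solution rho v <->
   forall u g, H10 (eball rho) u g ->
     (\int[lebesgue_rV R n]_(x in eball rho) (V x * u x ^+ 2)%:E
      <= hardy_deficit (eball rho) u g)%E)
  /\
  ereal_sup [set c%:E | c in [set c : R |
    forall u g, H10 (eball rho) u g ->
      (c%:E * \int[lebesgue_rV R n]_(x in eball rho) (V x * u x ^+ 2)%:E
       <= hardy_deficit (eball rho) u g)%E]] =
  ereal_sup [set c%:E | c in [set c : R |
    has_positive_solution rho (fun r => c * v r)]].
Proof.
case: n n_ge3 V V_radial => [//|k] k2 W Wv.
have k1 : (1 <= k)%N by exact: ltnW.
have iff1 (w : R -> R) (U : 'rV[R]_k.+1 -> R) : (forall r, r \in `]0, rho[ -> 0 <= w r) ->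
    measurable_fun `]0, rho[ w -> (forall x, 0 < enorm x < rho -> U x = w (enorm x)) ->
    has_positive_solution rho w <-> forall u g, H10 (eball rho) u g ->
     (\int[lebesgue_rV R k.+1]_(x in eball rho) (U x * u x ^+ 2)%:E
      <= hardy_deficit (eball rho) u g)%E.
  move=> w0 mw Uw; split.
    by move=> sol u g; exact: (hardy_of_positive_solution k1 rho_gt0 w0 mw Uw sol).
  exact: (positive_solution_of_hardy rho_gt0 w0 mw Uw).
split; first exact: iff1.
have iffc (c : R) : 0 <= c -> has_positive_solution rho (fun r => c * v r) <->
    forall u g, H10 (eball rho) u g ->
      (c%:E * \int[lebesgue_rV R k.+1]_(x in eball rho) (W x * u x ^+ 2)%:E
       <= hardy_deficit (eball rho) u g)%E.
  move=> c0.
  have cv0 r : r \in `]0, rho[ -> 0 <= c * v r by move=> rI; rewrite mulr_ge0// v_ge0.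
  have mcv : measurable_fun `]0, rho[ (fun r => c * v r) by exact: measurable_funM.
  have cW x : 0 < enorm x < rho -> c * W x = c * v (enorm x) by move=> /Wv ->.
  (* Both sides go through the potential extended by zero: [W 0] may be negative, and the constant
     is taken out of an integral with nonnegative integrand. *)
  have E u g : H10 (eball rho) u g ->
      (\int[lebesgue_rV R k.+1]_(x in eball rho) (c * W x * u x ^+ 2)%:E =
       c%:E * \int[lebesgue_rV R k.+1]_(x in eball rho) (W x * u x ^+ 2)%:E)%E.
    move=> [[[mu2 _] _ _] _].
    rewrite (integral_radial_potential mcv cW mu2) (integral_radial_potential v_meas Wv mu2).
    rewrite -ge0_integralZl//; last 3 first.
    - exact: measurable_eball.
    - apply/measurable_EFinP; apply: measurable_funM; last exact: measurable_funX.
      by apply: measurable_funTS; exact: measurable_potential_enorm.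
    - by move=> x _; rewrite lee_fin mulr_ge0 ?sqr_ge0// potential_ge0.
    apply: eq_integral => x _.
    rewrite (_ : potential rho _ (enorm x) = c * potential rho v (enorm x)) -?mulrA ?EFinM//.
    by rewrite /potential !patchE; case: ifP; rewrite ?mulr0.
  have [H1 H2] := iff1 _ _ cv0 mcv cW.
  split=> [/H1 H u g Hug|H]; first by rewrite -(E u g)//; exact: H.
  by apply: H2 => u g Hug; rewrite (E u g)//; exact: H.
(* The equivalence needs a nonnegative potential, hence [c >= 0]. A negative [c] is dominated by
   [0], which belongs to both sets. *)
apply/eqP; rewrite eq_le; apply/andP; split; apply: ge_ereal_sup => _ [c Hc <-].
  case: (leP 0 c) => c0; first by apply: ereal_sup_ubound; exists c => //; apply/iffc.
  apply: (@le_trans _ _ 0%:E); first by rewrite lee_fin ltW.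
  by apply: ereal_sup_ubound; exists 0 => //; exact: positive_solution0.
case: (leP 0 c) => c0; first by apply: ereal_sup_ubound; exists c => //; apply/iffc.
apply: (@le_trans _ _ 0%:E); first by rewrite lee_fin ltW.
by apply: ereal_sup_ubound; exists 0 => //; apply/iffc => //; exact: positive_solution0.
Qed.
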